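(* Let $\alpha>0$, $\mu=\sqrt2/\alpha$ and $\Lambda\in\mathbb C\setminus\mathbb R$. Then $$(\mathbf A_\alpha-\Lambda)^{-1}-(\mathbf A_0-\Lambda)^{-1}=\mathbf T(\Lambda)\bigl(\mu\,\mathcal J(\Lambda;\mu)^{-1}-(2\mathrm Y(\Lambda))^{-1}\bigr)\mathbf T(\overline\Lambda)^*.$$
   Context: $\mathbb N_0=\{0,1,2,\dots\}$, $\mathfrak H=\ell^2(\mathbb N_0,L^2(\mathbb R))$, elements written $U\sim\{u_n\}$. Operators $\mathbf A_\alpha$: let $\mathcal W(\mathbb R)=\{u\in C(\mathbb R): u|_{\mathbb R_\pm}\in H^2(\mathbb R_\pm)\}$ and $(Lu)(x)=-u''(x)+u(x)/2$, $x\ne0$. For $\alpha>0$, $\mu=\sqrt2/\alpha$, the domain of $\mathbf A_\alpha$ consists of all $U\sim\{u_n\}\in\mathfrak H$ with $u_n\in\mathcal W(\mathbb R)$ for each $n$, $\mu(u_n'(0+)-u_n'(0-))=\sqrt{n+1}\,u_{n+1}(0)+\sqrt n\,u_{n-1}(0)$ for all $n\in\mathbb N_0$ (last term absent for $n=0$), and $\sum_n\|(L+n)u_n\|^2_{L^2(\mathbb R)}<\infty$; $\mathbf A_\alpha U\sim\{(L+n)u_n\}$. This operator is self-adjoint. $\mathbf A_0$ is the orthogonal sum over $n\in\mathbb N_0$ of the self-adjoint operators $-d^2/dx^2+1/2+n$ with domain $H^2(\mathbb R)$. Functions of $\Lambda$: $\zeta_n(\Lambda)=\sqrt{n+1/2-\Lambda}$,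 with the branch analytic in $\mathbb C\setminus[n+1/2,\infty)$ and positive for real $\Lambda<n+1/2$ (so $\operatorname{Re}\zeta_n(\Lambda)>0$); $y_n(\Lambda)=(n+1/2)^{1/2}\zeta_n(\Lambda)$; $\eta_n(x;\Lambda)=(n+1/2)^{1/4}e^{-\zeta_n(\Lambda)|x|}$. $\mathrm Y(\Lambda)$ is the diagonal operator in $\ell^2(\mathbb N_0)$ with entries $y_n(\Lambda)$. $\mathbf T(\Lambda):\ell^2(\mathbb N_0)\to\mathfrak H$ is the bounded operator $\mathbf T(\Lambda)\{X_n\}\sim\{X_n\eta_n(\cdot;\Lambda)\}$, and $\mathbf T(\overline\Lambda)^*$ is the Hilbert space adjoint of $\mathbf T(\overline\Lambda)$. Jacobi operators in $\ell^2(\mathbb N_0)$: with $d_n=n^{1/2}(n^2-1/4)^{1/4}$ for $n\ge1$ and $d_0=0$, $$(\mathcal J(\Lambda;\mu)C)_n=d_{n+1}C_{n+1}+2\mu\,y_n(\Lambda)C_n+d_nC_{n-1},$$ a closed operator on the domain $Dom\,\mathcal J(\Lambda;\mu)=Dom\,\mathcal J_0(\mu)$, where $\mathcal J_0(\mu)$ is the self-adjoint closure of the operator $(\mathcal J_0(\mu)C)_n=d_{n+1}C_{n+1}+(2n+1)\mu C_n+d_nC_{n-1}$ defined on finitely supported sequences (where it is essentially self-adjoint). For $\Lambda\notin\mathbb R$ the operator $\mathcal J(\Lambda;\mu)$ has a bounded inverse. *)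

(* Defs.v *)
From HB Require Import structures.
From mathcomp Require Import all_boot all_order all_algebra.
From mathcomp Require Import sesquilinear ring_quotient complex.
From mathcomp Require Import all_classical all_reals all_analysis.
From mathcomp Require Import ring lra.

Set Implicit Arguments.
Unset Strict Implicit.
Unset Printing Implicit Defensive.
Import Order.TTheory GRing.Theory Num.Theory.
Import numFieldNormedType.Exports.

Local Open Scope classical_set_scope.
Local Open Scope ring_scope.
Local Open Scope complex_scope.
Local Open Scope quotient_scope.

Local Notation Re := complex.Re.
Local Notation Im := complex.Im.

Section ComplexFacts.
Variable R : realType.
Local Notation C := R[i].
Implicit Types (z w a : C).

Lemma cReM z w : Re (z * w) = Re z * Re w - Im z * Im w.
Proof. by case: z w => [a b] [c d]. Qed.

Lemma cImM z w : Im (z * w) = Re z * Im w + Im z * Re w.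
Proof. by case: z w => [a b] [c d]. Qed.

Lemma cReD z w : Re (z + w) = Re z + Re w. Proof. by case: z w => [a b] [c d]. Qed.
Lemma cImD z w : Im (z + w) = Im z + Im w. Proof. by case: z w => [a b] [c d]. Qed.
Lemma cReN z : Re (- z) = - Re z. Proof. by case: z. Qed.
Lemma cImN z : Im (- z) = - Im z. Proof. by case: z. Qed.
Lemma cReJ z : Re (Num.conj z) = Re z. Proof. by case: z. Qed.
Lemma cImJ z : Im (Num.conj z) = - Im z. Proof. by case: z. Qed.

Lemma complex_eq z w : Re z = Re w -> Im z = Im w -> z = w.
Proof. by case: z w => [a b] [c d] /= -> ->. Qed.

End ComplexFacts.


Section Dot.
Variable R : realType.
Local Notation C := R[i].

Definition complex_dot (x y : C) : C := x * Num.conj y.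

Lemma complex_dot_bilinear :
  bilinear_for *%R (@Num.conj C \; *%R) complex_dot.
Proof.
split=> z a x y; rewrite /complex_dot /=.
  by rewrite mulrDl -mulrA.
by rewrite rmorphD rmorphM mulrDr mulrCA.
Qed.

HB.instance Definition _ := bilinear_isBilinear.Build C C C C
  *%R (@Num.conj C \; *%R) complex_dot complex_dot_bilinear.

Lemma complex_dot_hermitian (x y : C) :
  complex_dot x y = (-1) ^+ false * Num.conj (complex_dot y x).
Proof. by rewrite expr0 mul1r /complex_dot rmorphM /= Num.Theory.conjCK mulrC. Qed.

HB.instance Definition _ := isHermitianSesquilinear.Build C C false
  (@Num.conj C) complex_dot complex_dot_hermitian.

Lemma complex_dot_gt0 (x : C) : x != 0 -> 0 < complex_dot x x.
Proof. by move=> x0; rewrite /complex_dot mul_conjC_gt0. Qed.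

HB.instance Definition _ := isDotProduct.Build C C complex_dot complex_dot_gt0.

Section DotFacts.
Variables (V : lmodType C) (f : {dot V for @Num.conj C}).

Definition hnorm2 (x : V) : R := Re (f x x).
Definition hnorm (x : V) : R := Num.sqrt (hnorm2 x).

Lemma hnorm2E x : f x x = (hnorm2 x)%:C.
Proof. by rewrite /hnorm2 RRe_real// ger0_real// dnorm_ge0. Qed.

End DotFacts.
End Dot.

Section DotInequalities.
Variables (R : realType) (V : lmodType R[i]) (f : {dot V for @Num.conj R[i]}).
Implicit Types x y : V.

Lemma hnorm2_ge0 x : 0 <= hnorm2 f x.
Proof. by rewrite -(lecR 0) -hnorm2E dnorm_ge0. Qed.

Lemma hnorm2Z (a : R[i]) x :
  hnorm2 f (a *: x) = (Re a ^+ 2 + Im a ^+ 2) * hnorm2 f x.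
Proof.
rewrite /hnorm2 linearZl_LR linearZr_LR/= mulrA hnorm2E cReM/= mulr0 subr0.
by congr (_ * _); rewrite cReM cReJ cImJ mulrN opprK -!expr2.
Qed.

Lemma hnorm2D x y :
  hnorm2 f (x + y) = hnorm2 f x + hnorm2 f y + 2 * Re (f x y).
Proof.
rewrite /hnorm2 linearDl/= !linearDr/= (hermC f y x)/= expr0 mul1r.
rewrite !cReD cReJ; ring.
Qed.

Lemma Re_dot_le x y : `|Re (f x y)| <= hnorm2 f x + hnorm2 f y.
Proof.
have h0 := hnorm2_ge0 (x + y); have h1 := hnorm2_ge0 (x - y).
have hx := hnorm2_ge0 x; have hy := hnorm2_ge0 y.
move: h0 h1; rewrite !hnorm2D -[- y]scaleN1r hnorm2Z/= linearZr_LR/=.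
rewrite rmorphN rmorph1 mulN1r cReN => h0 h1.
by rewrite ler_norml; apply/andP; split; nra.
Qed.

Lemma Im_dot_le x y : `|Im (f x y)| <= hnorm2 f x + hnorm2 f y.
Proof.
have := Re_dot_le (- 'i *: x) y; rewrite hnorm2Z linearZl_LR/= cReM/=.
by rewrite !oppr0 !(mul0r, expr0n, add0r) sqrrN expr1n mul1r mulN1r opprK.
Qed.

Lemma hnorm2D_le x y : hnorm2 f (x + y) <= 3 * (hnorm2 f x + hnorm2 f y).
Proof.
rewrite hnorm2D; have := Re_dot_le x y; rewrite ler_norml => /andP[_]; lra.
Qed.

End DotInequalities.

Section ComplexSeries.
Variable R : realType.
Local Notation C := R[i].

Definition csummable (z : nat -> C) : Prop :=
  cvgn (series (fun n => Re (z n))) /\ cvgn (series (fun n => Im (z n))).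

Definition csum (z : nat -> C) : C :=
  limn (series (fun n => Re (z n))) +i* limn (series (fun n => Im (z n))).

Lemma csumD (z w : nat -> C) : csummable z -> csummable w ->
  csum (fun n => z n + w n) = csum z + csum w.
Proof.
move=> [z1 z2] [w1 w2]; apply: complex_eq; rewrite /csum ?cReD ?cImD /=.
  rewrite -lim_seriesD//; congr (limn (series _)); apply/funext => n.
  by rewrite cReD.
rewrite -lim_seriesD//; congr (limn (series _)); apply/funext => n.
by rewrite cImD.
Qed.

Lemma csumZ (a : C) (z : nat -> C) : csummable z ->
  csum (fun n => a * z n) = a * csum z.
Proof.
move=> [z1 z2]; apply: complex_eq; rewrite /csum ?cReM ?cImM /=.
  rewrite -[_ * _]/(Re a *: limn _) -lim_seriesZ//.
  rewrite -[Im a * _]/(Im a *: limn _) -lim_seriesZ//.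
  rewrite -lim_seriesB; [|exact: is_cvg_seriesZ..].
  congr (limn (series _)); apply/funext => n; exact: cReM.
rewrite -[_ * _]/(Re a *: limn _) -lim_seriesZ//.
rewrite -[Im a * _]/(Im a *: limn _) -lim_seriesZ//.
rewrite -lim_seriesD; [|exact: is_cvg_seriesZ..].
congr (limn (series _)); apply/funext => n; exact: cImM.
Qed.

Lemma csumJ (z : nat -> C) : csummable z ->
  csum (fun n => Num.conj (z n)) = Num.conj (csum z).
Proof.
move=> [z1 z2]; apply: complex_eq; rewrite /csum ?cReJ ?cImJ /=.
  by congr (limn (series _)); apply/funext => n; rewrite cReJ.
rewrite -lim_seriesN//; congr (limn (series _)); apply/funext => n.
by rewrite cImJ.
Qed.

End ComplexSeries.

Section Ell2.
Variables (R : realType) (V : lmodType R[i]) (f : {dot V for @Num.conj R[i]}).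
Local Notation C := R[i].
Implicit Types u v : nat -> V.

Definition square_summable : {pred nat -> V} :=
  mem [set u : nat -> V | cvgn (series (fun n => hnorm2 f (u n)))].

Lemma square_summableP u :
  u \in square_summable <-> cvgn (series (fun n => hnorm2 f (u n))).
Proof. by split; [move/set_mem | move=> h; apply/mem_set]. Qed.

Lemma square_summable_submod_closed : submod_closed square_summable.
Proof.
split.
  apply/square_summableP; rewrite (_ : (fun n => _) = (fun=> 0)).
    rewrite (_ : series _ = cst 0); first exact: is_cvg_cst.
    by apply/funext => n; rewrite /series/= big1.
  by apply/funext => n; rewrite /hnorm2 linear0l.
move=> a u v /square_summableP hu /square_summableP hv.
apply/square_summableP.
pose b := Re a ^+ 2 + Im a ^+ 2.
apply: (@series_le_cvg _ _
  (3 *: (b *: (fun n => hnorm2 f (u n)) + (fun n => hnorm2 f (v n))))).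
- by move=> n; exact: hnorm2_ge0.
- move=> n; rewrite -[leRHS]/(3 * (b * hnorm2 f (u n) + hnorm2 f (v n))).
  by rewrite mulr_ge0// addr_ge0 ?mulr_ge0 ?hnorm2_ge0// addr_ge0 ?sqr_ge0.
- move=> n; rewrite -[leRHS]/(3 * (b * hnorm2 f (u n) + hnorm2 f (v n))).
  by rewrite -hnorm2Z; exact: hnorm2D_le.
- apply: is_cvg_seriesZ; rewrite seriesD; apply: is_cvgD => //.
  exact: is_cvg_seriesZ.
Qed.

HB.instance Definition _ := GRing.isSubmodClosed.Build C (nat -> V)
  square_summable square_summable_submod_closed.

Record ell2 := Ell2 { ell2_val :> nat -> V; _ : ell2_val \in square_summable }.

HB.instance Definition _ := [isSub for ell2_val].
HB.instance Definition _ := [Choice of ell2 by <:].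
HB.instance Definition _ := [SubChoice_isSubLmodule of ell2 by <:].

Definition ell2_dot (x y : ell2) : C := csum (fun n => f (x n) (y n)).

Lemma ell2_summable (x y : ell2) : csummable (fun n => f (x n) (y n)).
Proof.
have /square_summableP hx := valP x; have /square_summableP hy := valP y.
have h : cvgn (series ((fun n => hnorm2 f (x n)) + (fun n => hnorm2 f (y n)))).
  by rewrite seriesD; exact: is_cvgD.
split; apply: normed_cvg; apply: series_le_cvg h => n;
  rewrite /= ?normr_ge0//; rewrite -?[leRHS]/(hnorm2 f (x n) + hnorm2 f (y n));
  by rewrite ?addr_ge0 ?hnorm2_ge0 ?Re_dot_le ?Im_dot_le.
Qed.

Lemma ell2_dot_hermitian x y :
  ell2_dot x y = (-1) ^+ false * Num.conj (ell2_dot y x).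
Proof.
rewrite expr0 mul1r /ell2_dot -csumJ; last exact: ell2_summable.
by congr csum; apply/funext => n; rewrite (hermC f)/= expr0 mul1r.
Qed.

Lemma ell2_dot_bilinear : bilinear_for *%R (@Num.conj C \; *%R) ell2_dot.
Proof.
have hl z : GRing.linear_for *%R (ell2_dot ^~ z).
  move=> a x y; rewrite /ell2_dot -csumZ; last exact: ell2_summable.
  rewrite -csumD; first last.
  - exact: ell2_summable.
  - rewrite (_ : (fun _ => _) = (fun n => f ((a *: x) n) (z n))).
      exact: ell2_summable.
    by apply/funext => n; rewrite linearZl_LR.
  by congr csum; apply/funext => n; rewrite linearDl linearZl_LR.
split=> // z a x y; rewrite /= ell2_dot_hermitian hl expr0 mul1r rmorphD rmorphM.
by rewrite (ell2_dot_hermitian z x) (ell2_dot_hermitian z y) !expr0 !mul1r.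
Qed.

Lemma ell2_dot_gt0 x : x != 0 -> 0 < ell2_dot x x.
Proof.
move=> x0; have [n xn0] : exists n, x n != 0.
  apply/not_existsP => h; move/eqP: x0; apply; apply/val_inj/funext => n.
  by apply/eqP/negPn/negP => /h.
have [h1 h2] := ell2_summable x x.
have -> : ell2_dot x x = (limn (series (fun n => hnorm2 f (x n))))%:C.
  apply: complex_eq => //=; rewrite (_ : (fun n => _) = (fun=> 0)).
    rewrite (_ : series _ = cst 0) ?lim_cst//.
    by apply/funext => m; rewrite /series/= big1.
  by apply/funext => m; rewrite hnorm2E.
rewrite ltcR; apply: (@lt_le_trans _ _ (hnorm2 f (x n))).
  by rewrite -(ltcR 0) -hnorm2E dnorm_gt0.
apply: (@le_trans _ _ (series (fun n => hnorm2 f (x n)) n.+1)).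
  rewrite /series/= big_nat_recr//= lerDr sumr_ge0// => i _.
  exact: hnorm2_ge0.
apply: (@nondecreasing_cvgn_le _ (series (fun n => hnorm2 f (x n)))) => //.
by apply: nondecreasing_series => i _ _; exact: hnorm2_ge0.
Qed.

HB.instance Definition _ := bilinear_isBilinear.Build C ell2 ell2 C
  *%R (@Num.conj C \; *%R) ell2_dot ell2_dot_bilinear.
HB.instance Definition _ := isHermitianSesquilinear.Build C ell2 false
  (@Num.conj C) ell2_dot ell2_dot_hermitian.
HB.instance Definition _ := isDotProduct.Build C ell2 ell2_dot ell2_dot_gt0.

End Ell2.

Section L2.
Variable R : realType.
Local Notation C := R[i].
Local Notation leb := (@lebesgue_measure R).
Implicit Types u v : R -> C.

Definition cintegral (D : set R) u : C :=
  (\int[leb]_(x in D) Re (u x)) +i* (\int[leb]_(x in D) Im (u x)).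

Lemma ae_impl2 (P Q S : R -> Prop) : (forall x, P x -> Q x -> S x) ->
  {ae leb, forall x, P x} -> {ae leb, forall x, Q x} -> {ae leb, forall x, S x}.
Proof.
by move=> h; apply: filterS2 => //; exact: (ae_filter_ringOfSetsType leb).
Qed.

Lemma ae_all (P : R -> Prop) : (forall x, P x) -> {ae leb, forall x, P x}.
Proof. by move=> h; apply: filterE h; exact: (ae_filter_ringOfSetsType leb). Qed.

Definition square_integrable : {pred R -> C} :=
  [pred u | (@Re R \o u \in Lfun leb 2%:E) && (@Im R \o u \in Lfun leb 2%:E)].

Lemma square_integrable_submod_closed : submod_closed square_integrable.
Proof.
have le12 : (1 <= 2%:E :> \bar R)%E by rewrite lee_fin ler1n.
have [L0 LD] := @Lfun_submod_closed _ _ R leb 2%:E le12.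
have LZ a g : g \in Lfun leb 2%:E -> a *: g \in Lfun leb 2%:E.
  by move=> hg; rewrite -[a *: g]addr0; exact: LD.
split; first by apply/andP; split; exact: L0.
move=> a u v /andP[ur ui] /andP[vr vi]; apply/andP; split.
  have -> : @Re R \o (a *: u + v) =
      Re a *: (@Re R \o u : R -> R) +
      (- Im a *: (@Im R \o u : R -> R) + (@Re R \o v : R -> R)).
    apply/funext => x; rewrite -[LHS]/(Re (a * u x + v x)) cReD cReM.
    by rewrite -[RHS]/(Re a * Re (u x) + (- Im a * Im (u x) + Re (v x))); ring.
  by apply: (LD) => //; exact: LD.
have -> : @Im R \o (a *: u + v) =
    Re a *: (@Im R \o u : R -> R) +
    (Im a *: (@Re R \o u : R -> R) + (@Im R \o v : R -> R)).
  apply/funext => x; rewrite -[LHS]/(Im (a * u x + v x)) cImD cImM.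
  by rewrite -[RHS]/(Re a * Im (u x) + (Im a * Re (u x) + Im (v x))); ring.
by apply: (LD) => //; exact: LD.
Qed.

HB.instance Definition _ := GRing.isSubmodClosed.Build C (R -> C)
  square_integrable square_integrable_submod_closed.

Record L2fun := L2Fun { L2fun_val :> R -> C; _ : L2fun_val \in square_integrable }.

HB.instance Definition _ := [isSub for L2fun_val].
HB.instance Definition _ := [Choice of L2fun by <:].
HB.instance Definition _ := [SubChoice_isSubLmodule of L2fun by <:].

Definition ae_zero : {pred L2fun} :=
  mem [set u : L2fun | {ae leb, forall x, u x = 0}].

Lemma ae_zeroP (u : L2fun) : u \in ae_zero <-> {ae leb, forall x, u x = 0}.
Proof. by split; [move/set_mem | move=> h; apply/mem_set]. Qed.

Lemma ae_zero_submod_closed : submod_closed ae_zero.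
Proof.
split; first by apply/ae_zeroP; exact: ae_all.
move=> a u v /ae_zeroP hu /ae_zeroP hv; apply/ae_zeroP.
apply: ae_impl2 hu hv => x /= ux vx.
by rewrite -[LHS]/(a * u x + v x) ux vx mulr0 addr0.
Qed.

HB.instance Definition _ := GRing.isSubmodClosed.Build C L2fun
  ae_zero ae_zero_submod_closed.

Definition L2 := Quotient.quot (ae_zero : zmodClosed L2fun).
HB.instance Definition _ := GRing.Zmodule.on L2.
HB.instance Definition _ := EqQuotient.on L2.

Lemma L2_eqP (f g : L2fun) :
  \pi_L2 f = \pi_L2 g <-> {ae leb, forall x, f x = g x}.
Proof.
have e : (\pi_L2 f == \pi_L2 g) = (f - g \in ae_zero).
  by rewrite (Quotient.idealrBE (ae_zero : zmodClosed L2fun)).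
split=> [/eqP|h].
  rewrite e => /ae_zeroP h; apply: (ae_impl2 _ h h) => x /eqP + _.
  by rewrite -[(f - g) x]/(f x - g x) subr_eq0 => /eqP.
apply/eqP; rewrite e; apply/ae_zeroP; apply: (ae_impl2 _ h h) => x + _.
by rewrite -[(f - g) x]/(f x - g x) => ->; rewrite subrr.
Qed.

Lemma L2_reprP (f : L2fun) : {ae leb, forall x, repr (\pi_L2 f) x = f x}.
Proof. by apply/L2_eqP; rewrite reprK. Qed.

Lemma L2_piD (f g : L2fun) : \pi_L2 (f + g) = \pi_L2 f + \pi_L2 g.
Proof. exact: (Quotient.pi_add (ae_zero : zmodClosed L2fun)). Qed.

Definition L2_scale (a : C) (u : L2) : L2 := \pi_L2 (a *: repr u).

Lemma L2_piZ a (f : L2fun) : L2_scale a (\pi_L2 f) = \pi_L2 (a *: f).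
Proof.
apply/L2_eqP; have h := L2_reprP f; apply: (ae_impl2 _ h h) => x hx _.
by rewrite -[LHS]/(a * repr (\pi_L2 f) x) hx.
Qed.

Lemma L2_scaleA a b (u : L2) : L2_scale a (L2_scale b u) = L2_scale (a * b) u.
Proof. by rewrite [L2_scale b u]/L2_scale L2_piZ scalerA. Qed.
Lemma L2_scale1 : left_id 1 L2_scale.
Proof. by move=> u; rewrite -[u in LHS]reprK L2_piZ scale1r reprK. Qed.
Lemma L2_scaleDr : right_distributive L2_scale +%R.
Proof.
by move=> a u v; rewrite -[in LHS](reprK u) -[in LHS](reprK v) -L2_piD L2_piZ scalerDr L2_piD.
Qed.
Lemma L2_scaleDl (u : L2) : {morph L2_scale^~ u : a b / a + b}.
Proof. by move=> a b; rewrite {1}/L2_scale scalerDl L2_piD. Qed.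

HB.instance Definition _ := GRing.Zmodule_isLmodule.Build C L2
  L2_scaleA L2_scale1 L2_scaleDr L2_scaleDl.

Lemma L2_repr_linear a (u v : L2) :
  {ae leb, forall x, repr (a *: u + v) x = a * repr u x + repr v x}.
Proof.
have -> : a *: u + v = \pi_L2 (a *: repr u + repr v).
  by rewrite L2_piD reprK -[a *: u]/(\pi_L2 (a *: repr u)).
exact: L2_reprP.
Qed.

Definition L2_dot (u v : L2) : C :=
  cintegral setT (fun x => repr u x * Num.conj (repr v x)).


Definition rintegrable (f : R -> R) : Prop :=
  leb.-integrable setT (fun x => (f x)%:E).

Lemma rintegrableD (f g : R -> R) : rintegrable f -> rintegrable g ->
  rintegrable (fun x => f x + g x).
Proof.
move=> hf hg; have := integrableD measurableT hf hg.
by apply: eq_integrable => // x _; rewrite EFinD.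
Qed.

Lemma rintegrableZ k (f : R -> R) : rintegrable f ->
  rintegrable (fun x => k * f x).
Proof.
move=> hf; have := integrableZl measurableT k hf.
by apply: eq_integrable => // x _; rewrite EFinM.
Qed.

Definition cintegrable u : Prop :=
  rintegrable (fun x => Re (u x)) /\ rintegrable (fun x => Im (u x)).

Lemma cintegrableP a u v : cintegrable u -> cintegrable v ->
  cintegrable (fun x => a * u x + v x).
Proof.
move=> [ur ui] [vr vi]; split.
  have := rintegrableD (rintegrableD (rintegrableZ (Re a) ur)
    (rintegrableZ (- Im a) ui)) vr.
  by apply: eq_integrable => // x _; congr EFin; rewrite cReD cReM; ring.
have := rintegrableD (rintegrableD (rintegrableZ (Re a) ui)
  (rintegrableZ (Im a) ur)) vi.
by apply: eq_integrable => // x _; congr EFin; rewrite cImD cImM; ring.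
Qed.

Lemma cintegralP a u v : cintegrable u -> cintegrable v ->
  cintegral setT (fun x => a * u x + v x) =
  a * cintegral setT u + cintegral setT v.
Proof.
move=> [ur ui] [vr vi]; apply: complex_eq.
  rewrite cReD cReM /cintegral /=.
  transitivity (\int[leb]_x (Re a * Re (u x) + - Im a * Im (u x) + Re (v x))).
    by apply: eq_Rintegral => x _; rewrite cReD cReM; ring.
  rewrite RintegralD//; last exact: rintegrableD (rintegrableZ _ _) (rintegrableZ _ _).
  rewrite RintegralD//; [|exact: rintegrableZ..].
  by rewrite !RintegralZl//; ring.
rewrite cImD cImM /cintegral /=.
transitivity (\int[leb]_x (Re a * Im (u x) + Im a * Re (u x) + Im (v x))).
  by apply: eq_Rintegral => x _; rewrite cImD cImM; ring.
rewrite RintegralD//; last exact: rintegrableD (rintegrableZ _ _) (rintegrableZ _ _).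
rewrite RintegralD//; [|exact: rintegrableZ..].
by rewrite !RintegralZl//; ring.
Qed.

Lemma cintegral_conj u : cintegrable u ->
  cintegral setT (fun x => Num.conj (u x)) = Num.conj (cintegral setT u).
Proof.
move=> [ur ui]; apply: complex_eq; rewrite ?cReJ ?cImJ /cintegral /=.
  by apply: eq_Rintegral => x _; rewrite cReJ.
transitivity (\int[leb]_x (- 1 * Im (u x))).
  by apply: eq_Rintegral => x _; rewrite cImJ mulN1r.
by rewrite RintegralZl// mulN1r.
Qed.

Lemma ae_eq_cintegral u v : cintegrable u -> cintegrable v ->
  {ae leb, forall x, u x = v x} -> cintegral setT u = cintegral setT v.
Proof.
move=> [ur ui] [vr vi] h; apply: complex_eq; rewrite /cintegral /=;
  congr fine; apply: ae_eq_integral => //.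
- by case/integrableP: ur.
- by case/integrableP: vr.
- by apply: (ae_impl2 _ h h) => x -> _.
- by case/integrableP: ui.
- by case/integrableP: vi.
- by apply: (ae_impl2 _ h h) => x -> _.
Qed.

Lemma cintegrable_mul (f g : L2fun) :
  cintegrable (fun x => f x * Num.conj (g x)).
Proof.
have /andP[fr fi] := valP f; have /andP[gr gi] := valP g.
have h (p q : R -> R) : p \in Lfun leb 2%:E -> q \in Lfun leb 2%:E ->
    rintegrable (fun x => p x * q x).
  by move=> hp hq; apply/Lfun1_integrable; exact: Lfun2_mul_Lfun1.
split.
  have := rintegrableD (h _ _ fr gr) (h _ _ fi gi).
  by apply: eq_integrable => // x _; congr EFin; rewrite cReM cReJ cImJ/=; ring.
have := rintegrableD (rintegrableZ (- 1) (h _ _ fr gi)) (h _ _ fi gr).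
by apply: eq_integrable => // x _; congr EFin; rewrite cImM cReJ cImJ/=; ring.
Qed.

Lemma L2_dot_hermitian (u v : L2) :
  L2_dot u v = (-1) ^+ false * Num.conj (L2_dot v u).
Proof.
rewrite expr0 mul1r /L2_dot -cintegral_conj; last exact: cintegrable_mul.
by congr cintegral; apply/funext => x; rewrite rmorphM /= Num.Theory.conjCK mulrC.
Qed.

Lemma L2_dot_bilinear : bilinear_for *%R (@Num.conj C \; *%R) L2_dot.
Proof.
have hl w : GRing.linear_for *%R (L2_dot ^~ w).
  move=> a u v; rewrite /L2_dot -cintegralP; [|exact: cintegrable_mul..].
  apply: ae_eq_cintegral; first exact: cintegrable_mul.
    by apply: cintegrableP; exact: cintegrable_mul.
  have h := L2_repr_linear a u v; apply: (ae_impl2 _ h h) => x -> _.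
  by rewrite mulrDl mulrA.
split=> // w a u v; rewrite /= L2_dot_hermitian hl expr0 mul1r rmorphD rmorphM.
by rewrite (L2_dot_hermitian w u) (L2_dot_hermitian w v) !expr0 !mul1r.
Qed.

Lemma L2_dot_gt0 (u : L2) : u != 0 -> 0 < L2_dot u u.
Proof.
move=> u0; pose q x := Re (repr u x) ^+ 2 + Im (repr u x) ^+ 2.
have [ir ii] := cintegrable_mul (repr u) (repr u).
have iq : rintegrable q.
  move: ir; apply: eq_integrable => // x _; congr EFin.
  by rewrite cReM cReJ cImJ /q; ring.
have -> : L2_dot u u = (\int[leb]_x q x)%:C.
  apply: complex_eq; rewrite /L2_dot /cintegral/=.
    by apply: eq_Rintegral => x _; rewrite cReM cReJ cImJ /q; ring.
  rewrite (@eq_Rintegral _ _ _ leb setT (cst 0)) ?Rintegral_cst ?mul0r// => x _.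
  by rewrite cImM cReJ cImJ/=; ring.
rewrite ltcR lt_neqAle Rintegral_ge0 ?andbT; last first.
  by move=> x _; rewrite addr_ge0 ?sqr_ge0.
apply: contra u0 => /eqP/esym q0; apply/eqP.
have q00 : (\int[leb]_x `|(q x)%:E| = 0)%E.
  transitivity (\int[leb]_x (q x)%:E)%E.
    by apply: eq_integral => x _; rewrite gee0_abs// lee_fin addr_ge0 ?sqr_ge0.
  rewrite -[LHS]fineK ?integrable_fin_num//.
  by move: q0; rewrite /Rintegral => ->.
have /ae_eq_integral_abs := q00.
move=> /(_ measurableT); case/integrableP: (iq) => mq _ /(_ mq) h.
rewrite -[u]reprK; transitivity (\pi_L2 (0 : L2fun)); last first.
  by apply: (@addIr _ (\pi_L2 0)); rewrite -L2_piD !add0r.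
apply/L2_eqP; apply: (ae_impl2 _ h h) => x + _ => /(_ I)/= [].
move=> /eqP; rewrite paddr_eq0 ?sqr_ge0// !sqrf_eq0 => /andP[/eqP r0 /eqP i0].
exact: complex_eq.
Qed.

HB.instance Definition _ := bilinear_isBilinear.Build C L2 L2 C
  *%R (@Num.conj C \; *%R) L2_dot L2_dot_bilinear.
HB.instance Definition _ := isHermitianSesquilinear.Build C L2 false
  (@Num.conj C) L2_dot L2_dot_hermitian.
HB.instance Definition _ := isDotProduct.Build C L2 L2_dot L2_dot_gt0.

End L2.

(* A (possibly unbounded) operator from U to V is given by its graph. Sums,
   composites and inverses carry their usual maximal domains, so equality of
   operators includes equality of domains. *)
Definition operator (U V : Type) := set (U * V).

Section Operators.
Variables (R : realType) (U V W : lmodType R[i]).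
Local Notation C := R[i].

Definition op_dom (T : operator U V) : set U := [set x | exists y, T (x, y)].

Definition op_inv (T : operator U V) : operator V U := [set p | T (p.2, p.1)].

Definition op_comp (S : operator V W) (T : operator U V) : operator U W :=
  [set p | exists2 y, T (p.1, y) & S (y, p.2)].

Definition op_scale (a : C) (T : operator U V) : operator U V :=
  [set p | exists2 y, T (p.1, y) & p.2 = a *: y].

Definition op_sub (S T : operator U V) : operator U V :=
  [set p | exists y z, [/\ S (p.1, y), T (p.1, z) & p.2 = y - z]].

Definition op_id : operator U U := [set p | p.2 = p.1].

Variables (f : {dot U for @Num.conj C}) (g : {dot V for @Num.conj C}).

Definition op_adjoint (T : operator U V) : operator V U :=
  [set p | forall x y, T (x, y) -> g y p.1 = f x p.2].

Definition op_closure (T : operator U V) : operator U V :=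
  [set p | forall e : R, 0 < e -> exists x y,
     [/\ T (x, y), hnorm f (x - p.1) < e & hnorm g (y - p.2) < e]].

(* T is a bounded linear operator defined on the whole of U. *)
Definition bounded_operator (T : operator U V) : Prop :=
  exists2 F : {linear U -> V}, T = [set p | p.2 = F p.1] &
    exists M : R, forall x, hnorm g (F x) <= M * hnorm f x.

End Operators.

Definition resolvent (R : realType) (U : lmodType R[i]) (A : operator U U)
  (Lambda : R[i]) : operator U U :=
  op_inv (op_sub A (op_scale Lambda (@op_id _ U))).

Section Spaces.
Variable R : realType.
Local Notation C := R[i].
Local Notation leb := (@lebesgue_measure R).
Implicit Types u v w : R -> C.

(* The class U of L2 contains the function u. *)
Definition L2_of (U : L2 R) u : Prop := {ae leb, forall x, repr U x = u x}.

Definition square_integrable_on (D : set R) u : Prop :=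
  patch (cst 0) D u \in @square_integrable R.

Definition C1c (D : set R) (phi : R -> R) : Prop :=
  [/\ forall x, derivable phi x 1, continuous (derive1 phi) &
      exists a b, [set` `[a, b]] `<=` D /\
        forall x, x \notin `[a, b] -> phi x = 0].

(* v = u' in the weak sense on the open interval D; D is R, R_+ or R_- below.
   Testing against C^1_c or C^oo_c functions gives the same notion. *)
Definition weak_derivative (D : set R) u v : Prop :=
  [/\ square_integrable_on D u, square_integrable_on D v &
      forall phi, C1c D phi ->
        cintegral D (fun x => u x * (derive1 phi x)%:C) =
        - cintegral D (fun x => v x * (phi x)%:C)].

(* u belongs to the Sobolev space H^2(D) and w = u''. *)
Definition H2_derivative2 (D : set R) u w : Prop :=
  exists v, weak_derivative D u v /\ weak_derivative D v w.

Definition H2 (D : set R) u : Prop := exists w, H2_derivative2 D u w.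

Definition Rpos : set R := `]0, +oo[.
Definition Rneg : set R := `]-oo, 0[.

Definition calW u : Prop :=
  [/\ continuous (fun x => Re (u x)), continuous (fun x => Im (u x)),
      H2 Rpos u & H2 Rneg u].

(* u'(0+) and u'(0-) for u in calW: such u are C^1 on R_+ and on R_-, and u'
   has one-sided limits at 0. *)
Definition derivative_0p u : C :=
  lim (derive1 (fun y => Re (u y)) x @[x --> 0^'+]) +i*
  lim (derive1 (fun y => Im (u y)) x @[x --> 0^'+]).
Definition derivative_0m u : C :=
  lim (derive1 (fun y => Re (u y)) x @[x --> 0^'-]) +i*
  lim (derive1 (fun y => Im (u y)) x @[x --> 0^'-]).

End Spaces.

Section Model.
Variable R : realType.
Local Notation C := R[i].
Local Notation l2 := (ell2 (@complex_dot R)).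
Local Notation H := (ell2 (@L2_dot R)).
Local Notation rt x := (Num.sqrt x).
Implicit Types (alpha mu : R) (Lambda : C).

(* Here u_n(0) and u_n'(0+-) refer to the continuous representative u n of the
   class p.1 n, and w n is u_n'' off 0. Since the terms with n.-1 are
   multiplied by rt n, they are absent for n = 0. *)
Definition opA alpha : operator H H :=
  let mu := rt 2 / alpha in
  [set p : H * H | exists u w : nat -> R -> C,
    (forall n,
      [/\ L2_of (p.1 n) (u n) /\ calW (u n),
          H2_derivative2 (@Rpos R) (u n) (w n),
          H2_derivative2 (@Rneg R) (u n) (w n),
          mu%:C * (derivative_0p (u n) - derivative_0m (u n)) =
            (rt n.+1%:R)%:C * u n.+1 0 + (rt n%:R)%:C * u n.-1 0 &
          L2_of (p.2 n) (fun x => (- w n x + u n x / 2) + n%:R * u n x)])].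

Definition free_operator n : operator (L2 R) (L2 R) :=
  [set q | exists u w : R -> C,
    [/\ L2_of q.1 u, H2_derivative2 setT u w &
        L2_of q.2 (fun x => - w x + (2^-1 + n%:R) * u x)]].

Definition orthogonal_sum (B : nat -> operator (L2 R) (L2 R)) : operator H H :=
  [set p : H * H | forall n, B n (p.1 n, p.2 n)].

Definition opA0 : operator H H := orthogonal_sum free_operator.

(* sqrtc is the branch with nonnegative real part: it is analytic on
   C \ ]-oo, 0] and positive on ]0, +oo[. *)
Definition zeta n Lambda : C := sqrtc (n%:R + 2^-1 - Lambda).

Definition y_ n Lambda : C := (rt (n%:R + 2^-1))%:C * zeta n Lambda.

Definition cexp (z : C) : C := (expR (Re z))%:C * (cos (Im z) +i* sin (Im z)).

Definition eta n Lambda (x : R) : C :=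
  ((n%:R + 2^-1) `^ (4^-1))%:C * cexp (- zeta n Lambda * `|x|%:C).

Definition opY Lambda : operator l2 l2 :=
  [set p : l2 * l2 | forall n, p.2 n = y_ n Lambda * p.1 n].

Definition opT Lambda : operator l2 H :=
  [set p : l2 * H | forall n, L2_of (p.2 n) (fun x => p.1 n * eta n Lambda x)].

Definition d_ n : R :=
  if n is 0 then 0 else rt n%:R * (n%:R ^+ 2 - 4^-1) `^ (4^-1).

(* The term with n.-1 vanishes for n = 0 because d_ 0 = 0. *)
Definition jacobi (b X : nat -> C) n : C :=
  (d_ n.+1)%:C * X n.+1 + b n * X n + (d_ n)%:C * X n.-1.

Definition opJ00 mu : operator l2 l2 :=
  [set p : l2 * l2 | (exists N, forall n, (N <= n)%N -> p.1 n = 0) /\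
           forall n, p.2 n = jacobi (fun n => ((2 * n + 1)%N%:R * mu)%:C) p.1 n].

Definition opJ0 mu : operator l2 l2 :=
  op_closure (@ell2_dot R _ (@complex_dot R)) (@ell2_dot R _ (@complex_dot R)) (opJ00 mu).

Definition opJ Lambda mu : operator l2 l2 :=
  [set p : l2 * l2 | op_dom (opJ0 mu) p.1 /\
           forall n, p.2 n = jacobi (fun n => (2 * mu)%:C * y_ n Lambda) p.1 n].

End Model.

(* Main.v *)
(* Off the origin both resolvents solve [- u'' + zeta_n^2 u = f_n], where
   [zeta_n^2 = n + 1/2 - Lambda]. Hence [u_n = u0_n + c_n exp (- zeta_n |x|)],
   where [u0_n] is the convolution of [f_n] with the Green function of the line:
   the difference [u_n - u0_n] solves the homogeneous equation on each half-line
   and only its decaying part is square integrable. The jump condition then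
   couples the [c_n]. With [c_n = (n + 1/2)^(1/4) X_n], and with
   [G = T(conj Lambda)^* F], so that [G_n = 2 (n + 1/2)^(1/4) zeta_n u0_n(0)], it
   becomes [J C = G] for the sequence [C] given by [X = mu C - (2 Y)^(-1) G].
   [J] is boundedly invertible because the imaginary parts of its diagonal have a
   fixed sign and are bounded away from 0, and its domain is the maximal one:
   since [d_n <= n], commutators with linear cut-offs at scale [N] stay bounded. *)

(* Every operator is only a graph, so totality, single-valuedness and boundedness have to be proved
   along with the formula. A total linear relation with a norm bound is the graph of a bounded
   operator; the resolvent of [opA] obtains these properties from the formula itself.

   The existence half of the inversion of [J] uses the three-term recurrence. Its solutions form a
   line with one complex parameter, coercivity bounds the solution that vanishes at index [N]
   uniformly in [N], and compactness provides a limit parameter.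

   The weight [(n + 1/2)^(1/4)] makes the jump condition symmetric, since
   [(n + 1)^2 - 1/4 = (n + 1/2) (n + 3/2)]. It also keeps the norms of the [eta n] between two
   positive constants, so the coefficients found from the boundary values are square summable.

   Boundary values need functions rather than classes. Weak solutions are therefore compared with
   explicit continuous ones, first almost everywhere and then, by continuity, at every point. *)
Require Import Defs.
From HB Require Import structures.
From mathcomp Require Import all_boot all_order all_algebra.
From mathcomp Require Import sesquilinear ring_quotient complex.
From mathcomp Require Import all_classical all_reals all_analysis.
From mathcomp Require Import measurable_realfun.
From mathcomp Require Import ring lra.
Set Implicit Arguments.
Unset Strict Implicit.
Unset Printing Implicit Defensive.
Import Order.TTheory GRing.Theory Num.Theory.
Import numFieldNormedType.Exports.

Local Open Scope classical_set_scope.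
Local Open Scope ring_scope.
Local Open Scope complex_scope.

Local Notation Re := complex.Re.
Local Notation Im := complex.Im.
Local Notation eta := Defs.eta.

(** * Bounded operators given by graphs *)

Section SquaredNorm.
Variables (R : realType) (U : lmodType R[i]) (f : {dot U for @Num.conj R[i]}).

Lemma hnorm2_eq0 x : hnorm2 f x = 0 -> x = 0.
Proof.
by move=> x0; apply/eqP; rewrite -(dnorm_eq0 f) hnorm2E x0.
Qed.

Lemma hnorm2_0 : hnorm2 f 0 = 0.
Proof. by rewrite /hnorm2 linear0l. Qed.

Lemma hnorm2N x : hnorm2 f (- x) = hnorm2 f x.
Proof. by rewrite -scaleN1r hnorm2Z /= oppr0 sqrrN expr1n expr0n addr0 mul1r. Qed.

Lemma hnorm2B_le x y : hnorm2 f (x - y) <= 3 * (hnorm2 f x + hnorm2 f y).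
Proof. by rewrite -(hnorm2N y); exact: hnorm2D_le. Qed.

Lemma hnorm_lt x (e : R) : 0 < e -> (hnorm f x < e) = (hnorm2 f x < e ^+ 2).
Proof.
move=> e0; rewrite /hnorm -[in LHS](gtr0_norm e0) -sqrtr_sqr ltr_sqrt//.
by rewrite exprn_gt0.
Qed.

Lemma cauchy_schwarz x y :
  Re (f x y) ^+ 2 + Im (f x y) ^+ 2 <= hnorm2 f x * hnorm2 f y.
Proof.
have [y0|ny0] := eqVneq (hnorm2 f y) 0.
  by rewrite (hnorm2_eq0 y0) linear0r /= expr0n addr0 hnorm2_0 mulr0.
have yp : 0 < hnorm2 f y by rewrite lt_neqAle eq_sym ny0 hnorm2_ge0.
(* The squared norm of [|y|^2 x - <x, y> y] expands to [|y|^2] times the difference of the two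
   sides. *)
have := hnorm2_ge0 f ((hnorm2 f y)%:C *: x + (- f x y) *: y).
rewrite hnorm2D !hnorm2Z linearZl_LR linearZr_LR/= !(cReM, cReN, cImN, cReJ, cImJ)/=.
move=> H; rewrite -(ler_pM2l yp) -subr_ge0 (le_trans H)// le_eqVlt.
apply/orP; left; apply/eqP; ring.
Qed.
End SquaredNorm.

Section Bounded.
Variables (R : realType) (U V : lmodType R[i]).
Variables (f : {dot U for @Num.conj R[i]}) (g : {dot V for @Num.conj R[i]}).

(** Estimates are carried out on squared norms throughout. The sign of [M] is not prescribed, hence
    the bound [sqrt |M|]. *)
Lemma graph_bounded_operator (F : {linear U -> V}) (M : R) :
  (forall x, hnorm2 g (F x) <= M * hnorm2 f x) ->
  bounded_operator f g [set p | p.2 = F p.1].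
Proof.
move=> hM; exists F => //; exists (Num.sqrt `|M|) => x.
rewrite /hnorm -sqrtrM// ler_wsqrtr// (le_trans (hM x))// ler_wpM2r ?hnorm2_ge0//.
exact: ler_norm.
Qed.

Lemma bounded_operator_sq (T : operator U V) : bounded_operator f g T ->
  exists2 F : {linear U -> V}, T = [set p | p.2 = F p.1] &
    exists2 M : R, 0 <= M & forall x, hnorm2 g (F x) <= M * hnorm2 f x.
Proof.
case=> F TF [M hM]; exists F => //; exists (M ^+ 2); first exact: sqr_ge0.
move=> x; have := hM x => hx.
have /ler_sqr := sqrtr_ge0 (hnorm2 g (F x)).
have M0 : 0 <= M * hnorm f x by apply: le_trans hx; exact: sqrtr_ge0.
move=> /(_ _ M0); rewrite hx => /esym.
by rewrite exprMn !sqr_sqrtr ?hnorm2_ge0.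
Qed.

(** Single-valuedness comes for free: by linearity the difference of two images of [x] is an image
    of 0, and the bound makes it vanish. Choice then turns the relation into a linear map. *)
Lemma linear_relation_bounded_operator (T : operator U V) (M : R) :
  (forall x, exists y, T (x, y)) ->
  (forall a x y x' y', T (x, y) -> T (x', y') -> T (a *: x + x', a *: y + y')) ->
  (forall x y, T (x, y) -> hnorm2 g y <= M * hnorm2 f x) ->
  bounded_operator f g T.
Proof.
move=> tot lin bnd.
have uniq x y y' : T (x, y) -> T (x, y') -> y = y'.
  move=> xy xy'; have := bnd _ _ (lin (-1) _ _ _ _ xy' xy).
  rewrite !scaleN1r addNr hnorm2_0 mulr0 => le0; apply/eqP.
  rewrite -subr_eq0 addrC; apply/eqP/(@hnorm2_eq0 _ _ g)/eqP.
  by rewrite eq_le le0 hnorm2_ge0.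
pose F x := projT1 (cid (tot x)).
have TF x : T (x, F x) by rewrite /F; case: cid.
have linF : linear F.
  by move=> a x y; apply: uniq (TF _) _; exact: lin.
pose HF := GRing.isLinear.Build _ _ _ _ F linF.
pose LF : {linear U -> V} := HB.pack F HF.
have -> : T = [set p | p.2 = LF p.1].
  apply/seteqP; split=> -[x y] /=; first by move/uniq; apply; exact: TF.
  by move=> ->; exact: TF.
by apply: (@graph_bounded_operator _ M) => x; apply: bnd; exact: TF.
Qed.

End Bounded.

Section BoundedAlgebra.
Variables (R : realType) (U V W : lmodType R[i]).
Variables (f : {dot U for @Num.conj R[i]}) (g : {dot V for @Num.conj R[i]}).
Variables (h : {dot W for @Num.conj R[i]}).

Lemma bounded_operator_comp (S : operator V W) (T : operator U V) :
  bounded_operator g h S -> bounded_operator f g T ->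
  bounded_operator f h (op_comp S T).
Proof.
move=> /bounded_operator_sq[G -> [N N0 hN]] /bounded_operator_sq[F -> [M M0 hM]].
have -> : op_comp [set p | p.2 = G p.1] [set p | p.2 = F p.1] =
    [set p | p.2 = (G \o F) p.1].
  apply/seteqP; split=> -[x y] /=; first by move=> [z /= -> ->].
  by move=> ->; exists (F x).
apply: (@graph_bounded_operator _ _ _ _ _ _ (N * M)) => x /=.
by rewrite (le_trans (hN _))// -mulrA ler_wpM2l.
Qed.

Lemma bounded_operator_scale (a : R[i]) (T : operator U V) :
  bounded_operator f g T -> bounded_operator f g (op_scale a T).
Proof.
move=> /bounded_operator_sq[F -> [M M0 hM]].
have -> : op_scale a [set p | p.2 = F p.1] = [set p | p.2 = (a \*: F) p.1].
  apply/seteqP; split=> -[x y] /=; first by move=> [z /= -> ->].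
  by move=> ->; exists (F x).
apply: (@graph_bounded_operator _ _ _ _ _ _ ((Re a ^+ 2 + Im a ^+ 2) * M)) => x /=.
by rewrite hnorm2Z -mulrA ler_wpM2l// addr_ge0 ?sqr_ge0.
Qed.

Lemma bounded_operator_sub (S T : operator U V) :
  bounded_operator f g S -> bounded_operator f g T ->
  bounded_operator f g (op_sub S T).
Proof.
move=> /bounded_operator_sq[G -> [N N0 hN]] /bounded_operator_sq[F -> [M M0 hM]].
have -> : op_sub [set p | p.2 = G p.1] [set p | p.2 = F p.1] =
    [set p | p.2 = (G \- F) p.1].
  apply/seteqP; split=> -[x y] /=; first by move=> [z [w [/= -> -> ->]]].
  by move=> ->; exists (G x), (F x).
apply: (@graph_bounded_operator _ _ _ _ _ _ (3 * (N + M))) => x /=.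
rewrite (le_trans (hnorm2B_le _ _ _))// -mulrA ler_wpM2l// mulrDl.
by rewrite lerD.
Qed.

Lemma bounded_operator_functional (T : operator U V) x y y' :
  bounded_operator f g T -> T (x, y) -> T (x, y') -> y = y'.
Proof. by case=> F -> _ /= -> ->. Qed.

Lemma bounded_operator_total (T : operator U V) x :
  bounded_operator f g T -> exists y, T (x, y).
Proof. by case=> F -> _; exists (F x). Qed.

End BoundedAlgebra.

(** * Square-summable sequences and the functions zeta_n *)

Section SquareSums.
Variables (R : realType).
Implicit Types a : nat -> R.

Lemma nonneg_series_bounded_cvg a (K : R) : (forall n, 0 <= a n) ->
  (forall N, \sum_(i < N) a i <= K) -> cvgn (series a).
Proof.
move=> a0 aK; apply: nondecreasing_is_cvgn.
  by apply: nondecreasing_series => n _ _.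
by exists K => _ [n _ <-]; rewrite /series/= big_mkord.
Qed.

Lemma nonneg_series_partial a N : (forall n, 0 <= a n) -> cvgn (series a) ->
  \sum_(i < N) a i <= limn (series a).
Proof.
move=> a0 ca; have := nondecreasing_cvgn_le _ ca N.
rewrite /series/= big_mkord; apply.
by apply: nondecreasing_series => n _ _.
Qed.

Lemma nonneg_series_limit a (K : R) : (forall n, 0 <= a n) ->
  (forall N, \sum_(i < N) a i <= K) -> limn (series a) <= K.
Proof.
move=> a0 aK; apply: limr_le; first exact: nonneg_series_bounded_cvg aK.
by apply: nearW => n; rewrite /series/= big_mkord.
Qed.

(** The tail is written with an indicator inside ordinary finite sums because the errors caused by
    the cut-offs below come in this form. *)
Lemma series_tail_small a (e : R) : (forall n, 0 <= a n) -> cvgn (series a) ->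
  0 < e -> exists N0, forall N, (N0 <= N)%N -> forall M,
    \sum_(i < M) (if (N <= i)%N then a i else 0) <= e.
Proof.
move=> a0 ca e0; have /cvgrPdist_le/(_ _ e0)[N0 _ hN] := ca.
exists N0 => N /hN; rewrite /series/= big_mkord => h M.
have {}h : limn (series a) <= \sum_(i < N) a i + e.
  by rewrite -lerBlDl; apply: le_trans h; exact: ler_norm.
apply: (@le_trans _ _ (\sum_(i < N + M) (if (N <= i)%N then a i else 0))).
  rewrite addnC big_split_ord/= lerDl sumr_ge0// => i _.
  by case: ifP.
rewrite -(lerD2l (\sum_(i < N) a i)) (le_trans _ h)//.
rewrite (le_trans _ (nonneg_series_partial (N + M) a0 ca))//.
rewrite !big_split_ord/= lerD2l big1 ?add0r; last first.
  by move=> i _; rewrite leqNgt ltn_ord.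
by apply: ler_sum => i _; rewrite leq_addr.
Qed.

Variables (V : lmodType R[i]) (f : {dot V for @Num.conj R[i]}).

Lemma square_summable_bounded (u : nat -> V) (K : R) :
  (forall N, \sum_(i < N) hnorm2 f (u i) <= K) -> u \in square_summable f.
Proof.
move=> h; apply/square_summableP; apply: nonneg_series_bounded_cvg h => n.
exact: hnorm2_ge0.
Qed.

Lemma ell2_cvg (x : ell2 f) : cvgn (series (fun n => hnorm2 f (x n))).
Proof. by apply/square_summableP; exact: valP. Qed.

Lemma hnorm2_ell2 (x : ell2 f) :
  hnorm2 (@ell2_dot R V f) x = limn (series (fun n => hnorm2 f (x n))).
Proof. by []. Qed.

Lemma hnorm2_ell2_partial (x : ell2 f) N :
  \sum_(i < N) hnorm2 f (x i) <= hnorm2 (@ell2_dot R V f) x.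
Proof.
rewrite hnorm2_ell2; apply: nonneg_series_partial; last exact: ell2_cvg.
by move=> n; exact: hnorm2_ge0.
Qed.

Lemma hnorm2_ell2_le (x : ell2 f) K :
  (forall N, \sum_(i < N) hnorm2 f (x i) <= K) -> hnorm2 (@ell2_dot R V f) x <= K.
Proof.
by rewrite hnorm2_ell2; apply: nonneg_series_limit => n; exact: hnorm2_ge0.
Qed.

End SquareSums.

Section ComplexModulus.
Variable R : realType.
Local Notation C := R[i].
Implicit Types z w : C.

(** The squared modulus as an element of [R]: estimates remain polynomial in real and imaginary
    parts. *)
Definition cabs2 z : R := Re z ^+ 2 + Im z ^+ 2.

Lemma hnorm2_complex z : hnorm2 (@complex_dot R) z = cabs2 z.
Proof. by rewrite /hnorm2 /= /complex_dot cReM cReJ cImJ /cabs2; ring. Qed.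

Lemma cabs2_ge0 z : 0 <= cabs2 z.
Proof. by rewrite addr_ge0 ?sqr_ge0. Qed.

Lemma cabs2M z w : cabs2 (z * w) = cabs2 z * cabs2 w.
Proof. by rewrite /cabs2 cReM cImM; ring. Qed.

Lemma cabs2N z : cabs2 (- z) = cabs2 z.
Proof. by rewrite /cabs2 cReN cImN !sqrrN. Qed.

Lemma cabs2J z : cabs2 (Num.conj z) = cabs2 z.
Proof. by rewrite /cabs2 cReJ cImJ sqrrN. Qed.

Lemma cabs2_real (r : R) : cabs2 r%:C = r ^+ 2.
Proof. by rewrite /cabs2/= expr0n addr0. Qed.

Lemma cabs2_0 : cabs2 0 = 0.
Proof. by rewrite /cabs2/= !expr0n addr0. Qed.

Lemma cabs2_eq0 z : cabs2 z = 0 -> z = 0.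
Proof.
move=> /eqP; rewrite paddr_eq0 ?sqr_ge0// !sqrf_eq0 => /andP[/eqP r /eqP i].
exact: complex_eq.
Qed.

Lemma cabs2D_le z w : cabs2 (z + w) <= 2 * (cabs2 z + cabs2 w).
Proof.
rewrite -subr_ge0 /cabs2 cReD cImD.
rewrite (_ : _ - _ = (Re z - Re w) ^+ 2 + (Im z - Im w) ^+ 2); last by ring.
by rewrite addr_ge0 ?sqr_ge0.
Qed.

Lemma cabs2B_le z w : cabs2 (z - w) <= 2 * (cabs2 z + cabs2 w).
Proof. by rewrite -(cabs2N w) cabs2D_le. Qed.

End ComplexModulus.

Section ComplexSequences.
Variable R : realType.
Local Notation C := R[i].
Local Notation sqs := (square_summable (@complex_dot R)).
Implicit Types c G : nat -> C.

Lemma square_summable_cabs2 c : c \in sqs <-> cvgn (series (fun n => cabs2 (c n))).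
Proof.
rewrite square_summableP; suff -> : (fun n => hnorm2 (@complex_dot R) (c n)) =
  (fun n => cabs2 (c n)) by [].
by apply/funext => n; rewrite hnorm2_complex.
Qed.

Lemma square_summable_le c (a : nat -> R) (K : R) : (forall n, 0 <= a n) ->
  cvgn (series a) -> (forall n, cabs2 (c n) <= K * a n) -> c \in sqs.
Proof.
move=> a0 ca cK; apply: (@square_summable_bounded _ _ _ _ (`|K| * limn (series a))).
move=> N; rewrite (le_trans _ (ler_wpM2l _ (nonneg_series_partial N a0 ca)))//.
rewrite mulr_sumr; apply: ler_sum => i _; rewrite hnorm2_complex.
by rewrite (le_trans (cK _))// ler_wpM2r// ler_norm.
Qed.

End ComplexSequences.

Section Zeta.
Variables (R : realType) (L : R[i]).
Hypothesis hL : Im L != 0.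
Local Notation C := R[i].

Lemma sqr_zeta n : zeta n L ^+ 2 = n%:R + 2^-1 - L.
Proof. exact: sqr_sqrtc. Qed.

Lemma Re_zeta_ge0 n : 0 <= Re (zeta n L).
Proof. by rewrite /zeta /sqrtc; case: (_ - _) => a b /=; exact: sqrtr_ge0. Qed.

Lemma Re_natr n : Re (n%:R : C) = n%:R.
Proof. by rewrite -(rmorph_nat (real_complex R)). Qed.

Lemma Im_natr n : Im (n%:R : C) = 0.
Proof. by rewrite -(rmorph_nat (real_complex R)). Qed.

Lemma half_real : (2^-1 : C) = (2^-1)%:C.
Proof. by rewrite -(rmorph_nat (real_complex R) 2) -fmorphV. Qed.

Lemma zeta_Re n : Re (zeta n L) ^+ 2 - Im (zeta n L) ^+ 2 = n%:R + 2^-1 - Re L.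
Proof.
have /(congr1 (@Re R)) := sqr_zeta n.
by rewrite expr2 cReM !cReD cReN Re_natr half_real -!expr2.
Qed.

Lemma zeta_Im n : 2 * (Re (zeta n L) * Im (zeta n L)) = - Im L.
Proof.
have /(congr1 (@Im R)) := sqr_zeta n.
rewrite expr2 cImM !cImD cImN Im_natr half_real/= !add0r => <-; ring.
Qed.

(** A purely imaginary root would have a real square, against [Im L != 0]. *)
Lemma Re_zeta_gt0 n : 0 < Re (zeta n L).
Proof.
rewrite lt_neqAle Re_zeta_ge0 andbT eq_sym; apply/eqP => r0.
have := zeta_Im n; rewrite r0 mul0r mulr0 => /eqP.
by rewrite eq_sym oppr_eq0 (negPf hL).
Qed.

Lemma zeta_neq0 n : zeta n L != 0.
Proof.
by apply/eqP => z0; have := Re_zeta_gt0 n; rewrite z0 ltxx.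
Qed.

Lemma half_shift_gt0 n : 0 < n%:R + 2^-1 :> R.
Proof. by rewrite ltr_wpDl// invr_gt0. Qed.

(** With [a] and [b] the squares of the real and imaginary parts, [a - b = n + 1/2 - Re L] and
    [4 a b = (Im L)^2]. If [a <= 1] then [b <= 1 + r], so [a >= k0] in all cases. Moreover
    [n + 1/2 <= a + r <= a (1 + r / k0)], which is the claim for [k = k0 / (k0 + r)]. *)
Lemma Re_zeta_lower : exists2 k : R, 0 < k &
  forall n, k * (n%:R + 2^-1) <= Re (zeta n L) ^+ 2.
Proof.
pose r := `|Re L|; have r0 : 0 <= r by exact: normr_ge0.
pose k0 := Num.min 1 (Im L ^+ 2 / (4 * (1 + r))).
have r1 : 0 < 1 + r by rewrite ltr_wpDr.
have i0 : 0 < Im L ^+ 2 by rewrite exprn_even_gt0.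
have k00 : 0 < k0 by rewrite lt_min ltr01 divr_gt0// mulr_gt0.
have rL : Re L <= r by exact: ler_norm.
have ak n : k0 <= Re (zeta n L) ^+ 2.
  have h1 := zeta_Re n; have h2 := zeta_Im n; have n0 := half_shift_gt0 n.
  set a := Re (zeta n L) in h1 h2 *; set b := Im (zeta n L) in h1 h2.
  have h3 : 4 * a ^+ 2 * b ^+ 2 = Im L ^+ 2 by rewrite -[RHS]sqrrN -h2; ring.
  have a0 : 0 <= a ^+ 2 by exact: sqr_ge0.
  have b0 : 0 <= b ^+ 2 by exact: sqr_ge0.
  rewrite ge_min; have [//|a1/=] := leP 1 (a ^+ 2).
  rewrite ler_pdivrMr ?mulr_gt0// -h3.
  have h4 : b ^+ 2 <= 1 + r by lra.
  by have := ler_wpM2l a0 h4; lra.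
exists (k0 / (k0 + r)); first by rewrite divr_gt0// ltr_wpDr.
move=> n; have := ak n; have h1 := zeta_Re n.
have b0 : 0 <= Im (zeta n L) ^+ 2 by exact: sqr_ge0.
set a := Re _ ^+ 2 in h1 *; set b := Im _ ^+ 2 in h1 b0 * => ka.
rewrite mulrAC ler_pdivrMr ?ltr_wpDr//.
have -> : n%:R + 2^-1 = a - b + Re L by lra.
nra.
Qed.

(** [|zeta_n|^2 = |n + 1/2 - L| <= n + 1/2 + l], and [l <= 2 l (n + 1/2)]. The squares of both sides
    are compared to avoid a square root. *)
Lemma zeta_upper : exists2 K : R, 0 < K &
  forall n, cabs2 (zeta n L) <= K * (n%:R + 2^-1).
Proof.
pose l := `|Re L| + `|Im L|.
have l0 : 0 <= l by rewrite addr_ge0.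
exists (1 + 2 * l); first by rewrite ltr_wpDr// mulr_ge0.
move=> n; apply: (@le_trans _ _ (n%:R + 2^-1 + l)); last first.
  have : 0 <= n%:R :> R by []. 
  nra.
have n0 := half_shift_gt0 n.
rewrite -(ler_pXn2r (n := 2))// ?nnegrE ?cabs2_ge0 ?addr_ge0 ?(ltW n0)//.
have -> : cabs2 (zeta n L) ^+ 2 = (n%:R + 2^-1 - Re L) ^+ 2 + Im L ^+ 2.
  rewrite -zeta_Re -[Im L ^+ 2]sqrrN -(zeta_Im n) /cabs2; ring.
have h1 := real_normK (num_real (Re L)); have h2 := real_normK (num_real (Im L)).
have h3 : - Re L <= `|Re L| by rewrite -normrN ler_norm.
have := normr_ge0 (Im L); have := normr_ge0 (Re L).
rewrite /l -h2 => h4 h5; set s := n%:R + _ in n0 *.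
have h6 : 0 <= s * (`|Re L| + Re L) by apply: mulr_ge0; [exact: ltW | lra].
have h7 : 0 <= s * `|Im L| by apply: mulr_ge0 => //; exact: ltW.
have h8 : 0 <= `|Re L| * `|Im L| by rewrite mulr_ge0.
rewrite -subr_ge0 (_ : _ - _ = 2 * (s * (`|Re L| + Re L)) + 2 * (s * `|Im L|)
  + 2 * (`|Re L| * `|Im L|) + (`|Re L| ^+ 2 - Re L ^+ 2)); last by ring.
by rewrite h1 subrr addr0 !addr_ge0// mulr_ge0.
Qed.

(** [- Im L * Im zeta_n] equals [(Im L)^2 / (2 Re zeta_n)] and decays at most like
    [(n + 1/2)^(-1/2)]; the factor [(n + 1/2)^(1/2)] in [y_n] compensates this exactly. *)
Lemma Im_y_lower : exists2 d : R, 0 < d & forall n, d <= - Im L * Im (y_ n L).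
Proof.
have [K K0 hK] := zeta_upper.
have i0 : 0 < Im L ^+ 2 by rewrite exprn_even_gt0.
exists (Im L ^+ 2 / (2 * Num.sqrt K)); first by rewrite divr_gt0// mulr_gt0// sqrtr_gt0.
move=> n; rewrite /y_ cImM/= mul0r addr0 mulrCA.
have a0 := Re_zeta_gt0 n; have h2 := zeta_Im n.
have -> : - Im L * Im (zeta n L) = Im L ^+ 2 / (2 * Re (zeta n L)).
  apply: (@mulIf _ (2 * Re (zeta n L))); first by rewrite mulf_neq0 ?gt_eqF.
  by rewrite divfK ?mulf_neq0 ?gt_eqF// -[Im L ^+ 2]sqrrN -h2; ring.
rewrite mulrA [Num.sqrt _ * _]mulrC ler_pdivrMr ?mulr_gt0 ?sqrtr_gt0//.
rewrite mulrAC ler_pdivlMr ?mulr_gt0//.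
have : Re (zeta n L) <= Num.sqrt K * Num.sqrt (n%:R + 2^-1).
  rewrite -sqrtrM ?(ltW K0)// -[leLHS](gtr0_norm a0) -sqrtr_sqr ler_wsqrtr//.
  by apply: le_trans (hK n); rewrite lerDl sqr_ge0.
by move=> /(ler_wpM2l (ltW i0)); lra.
Qed.

End Zeta.

(** * Jacobi operators *)

Section YPerturbation.
Variables (R : realType) (L : R[i]).
Hypothesis hL : Im L != 0.

(* [(y_n - (n + 1/2)) (zeta_n + s) = - s Lambda] with [s = sqrt (n + 1/2)]. *)
Lemma y_perturbation n : cabs2 (y_ n L - (n%:R + 2^-1)) <= cabs2 L.
Proof.
have n0 := half_shift_gt0 R n.
pose s : R := Num.sqrt (n%:R + 2^-1).
have s0 : 0 < s by rewrite sqrtr_gt0.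
have sE : s ^+ 2 = n%:R + 2^-1 by rewrite sqr_sqrtr ?ltW.
have nE : n%:R + 2^-1 = s%:C ^+ 2 :> R[i].
  by rewrite -rmorphXn /= sE rmorphD /= rmorph_nat -half_real.
have e : (y_ n L - (n%:R + 2^-1)) * (zeta n L + s%:C) = - (s%:C * L).
  rewrite /y_ -/s.
  rewrite (_ : - _ = s%:C * ((n%:R + 2^-1 - L) - (n%:R + 2^-1))); last by ring.
  rewrite -sqr_zeta nE; ring.
have : cabs2 (y_ n L - (n%:R + 2^-1)) * cabs2 (zeta n L + s%:C) = s ^+ 2 * cabs2 L.
  by rewrite -cabs2M e cabs2N cabs2M cabs2_real.
have : s ^+ 2 <= cabs2 (zeta n L + s%:C).
  rewrite /cabs2 !cReD/=; have := Re_zeta_gt0 hL n => a0.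
  rewrite (@le_trans _ _ ((Re (zeta n L) + s) ^+ 2))// ?lerDl ?sqr_ge0//.
  by rewrite ler_sqr ?nnegrE ?addr_ge0 ?(ltW s0) ?(ltW a0)// lerDr (ltW a0).
move=> h1 h2; rewrite -(ler_pM2r (exprn_gt0 2 s0)) [leRHS]mulrC -h2.
by rewrite ler_wpM2l ?cabs2_ge0.
Qed.

Lemma y_lower : exists2 d : R, 0 < d & forall n, d <= cabs2 (y_ n L).
Proof.
have [d d0 hd] := Im_y_lower hL.
have i0 : 0 < Im L ^+ 2 by rewrite exprn_even_gt0.
exists (d ^+ 2 / Im L ^+ 2); first by rewrite divr_gt0// exprn_gt0.
move=> n; rewrite ler_pdivrMr//.
apply: (@le_trans _ _ ((- Im L * Im (y_ n L)) ^+ 2)).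
  by have h := hd n; rewrite ler_sqr ?nnegrE ?(ltW d0) ?(le_trans (ltW d0) h).
by rewrite exprMn sqrrN mulrC ler_wpM2r ?(ltW i0)// lerDr sqr_ge0.
Qed.

Lemma y_neq0 n : y_ n L != 0.
Proof.
have [d d0 hd] := y_lower; apply/eqP => y0.
by have := hd n; rewrite y0 cabs2_0 leNgt d0.
Qed.

End YPerturbation.

Section Jacobi.
Variable R : realType.
Local Notation C := R[i].
Local Notation l2 := (ell2 (@complex_dot R)).
Local Notation l2dot := (@ell2_dot R _ (@complex_dot R)).
Implicit Types (b c G : nat -> C).

Lemma d_ge0 n : 0 <= d_ R n.
Proof. by case: n => //= n; rewrite mulr_ge0 ?sqrtr_ge0 ?powR_ge0. Qed.

Lemma quarter_lt n : 0 < n.+1%:R ^+ 2 - 4^-1 :> R.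
Proof.
have : 1 <= n.+1%:R :> R by rewrite ler1n.
rewrite subr_gt0; set x := n.+1%:R => x1.
by apply: (@lt_le_trans _ _ 1); [lra|rewrite expr_ge1 ?(le_trans ler01)].
Qed.

Lemma d_gt0 n : 0 < d_ R n.+1.
Proof. by rewrite /= mulr_gt0 ?sqrtr_gt0 ?powR_gt0 ?quarter_lt. Qed.

Lemma d_le n : d_ R n <= n%:R.
Proof.
case: n => //= n; set x := n.+1%:R.
have x0 : 0 <= x by [].
have : (x ^+ 2 - 4^-1) `^ 4^-1 <= Num.sqrt x.
  have -> : Num.sqrt x = (x ^+ 2) `^ 4^-1.
    rewrite -powR_mulrn// -powRrM -powR12_sqrt//; congr (_ `^ _).
    lra.
  apply: ge0_ler_powR; rewrite ?invr_ge0// ?nnegrE ?sqr_ge0 ?ltW ?quarter_lt//.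
  by rewrite ltrBlDr ltrDl invr_gt0.
move=> h; rewrite -[leRHS]sqr_sqrtr// expr2.
by rewrite ler_wpM2l ?sqrtr_ge0.
Qed.

Lemma jacobiD b (a : C) c c' n :
  jacobi b (fun n => a * c n + c' n) n = a * jacobi b c n + jacobi b c' n.
Proof. rewrite /jacobi; ring. Qed.

(** Discrete Green formula: the off-diagonal entries are real and symmetric, so their contributions
    to the imaginary part telescope. The boundary term at 0 vanishes because [d_ R 0 = 0]. *)
Lemma jacobi_green b c N :
  Im (\sum_(n < N) jacobi b c n * Num.conj (c n)) =
  \sum_(n < N) Im (b n) * cabs2 (c n) + d_ R N * Im (c N * Num.conj (c N.-1)).
Proof.
elim: N => [|N IH]; first by rewrite !big_ord0 mul0r add0r.
have key (d1 d0 : R) (z w v a : C) :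
    Im ((d1%:C * v + a * z + d0%:C * w) * Num.conj z) =
    Im a * cabs2 z + d1 * Im (v * Num.conj z) - d0 * Im (z * Num.conj w).
  by rewrite /cabs2 !(cImM, cReM, cImD, cReD, cReJ, cImJ) /=; ring.
rewrite !big_ord_recr cImD IH.
rewrite -[RHS]/((\sum_(n < N) Im (b n) * cabs2 (c n)) + Im (b N) * cabs2 (c N)
  + d_ R N.+1 * Im (c N.+1 * Num.conj (c N))).
rewrite -[jacobi b c _ * _]/(jacobi b c N * Num.conj (c N)) /jacobi key; ring.
Qed.

Section Coercive.
Variables (b : nat -> C) (s d : R).
Hypotheses (d0 : 0 < d) (bs : forall n, d <= s * Im (b n)).

Let K := s ^+ 2 / d ^+ 2.

(** Pairing with [c] and applying the Young inequality absorbs half of [d |c|^2]; the difference is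
    the sum of two squares shown below. Only the entry at [N] has to vanish, so the estimate also
    covers solutions of the recurrence that are nonzero beyond [N]. *)
Lemma jacobi_coercive_finite c N : c N = 0 ->
  \sum_(n < N) cabs2 (c n) <= K * \sum_(n < N) cabs2 (jacobi b c n).
Proof.
move=> cN; have := jacobi_green b c N; rewrite cN mul0r mulr0 addr0.
move=> /(congr1 ( *%R s)); rewrite raddf_sum/= !mulr_sumr => e.
have : \sum_(n < N) d * cabs2 (c n) <= \sum_(n < N)
    (d / 2 * cabs2 (c n) + s ^+ 2 / (2 * d) * cabs2 (jacobi b c n)).
  apply: (@le_trans _ _ (\sum_(n < N) s * Im (jacobi b c n * Num.conj (c n)))).
    rewrite e; apply: ler_sum => n _.
    by rewrite mulrA ler_wpM2r// cabs2_ge0.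
  apply: ler_sum => n _; rewrite -subr_ge0 cImM cReJ cImJ /cabs2.
  set x := Re (c n); set y := Im (c n); set g := Re (jacobi _ _ _).
  set h := Im (jacobi _ _ _).
  rewrite (_ : _ - _ = ((d * x - s * h) ^+ 2 + (d * y + s * g) ^+ 2) / (2 * d)).
    by rewrite divr_ge0 ?addr_ge0 ?sqr_ge0// mulr_ge0 ?ltW.
  field; exact: lt0r_neq0.
rewrite big_split/= -!mulr_sumr.
set X := \sum_(i < N) _; set Y := \sum_(i < N) _.
rewrite -lerBlDl (_ : d * X - _ = d / 2 * X); last by lra.
have d2 : 0 < d / 2 by rewrite divr_gt0.
move=> h; rewrite -(ler_pM2l d2) (le_trans h)//.
rewrite le_eqVlt; apply/orP; left; apply/eqP; rewrite /K; field.
exact: lt0r_neq0.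
Qed.

End Coercive.

Definition cutoff N n : R := Num.max 0 (Num.min 1 (2 - n%:R / N%:R)).

Lemma cutoff01 N n : 0 <= cutoff N n <= 1.
Proof.
rewrite /cutoff le_max lexx/= ge_max ler01/= ge_min lexx//.
Qed.

Lemma cutoff_below N n : (0 < N)%N -> (n <= N)%N -> cutoff N n = 1.
Proof.
move=> N0 nN; rewrite /cutoff min_l ?max_r//.
have : n%:R / N%:R <= 1 :> R by rewrite ler_pdivrMr ?ltr0n// mul1r ler_nat.
lra.
Qed.

Lemma cutoff_above N n : (0 < N)%N -> (2 * N <= n)%N -> cutoff N n = 0.
Proof.
move=> N0 nN; rewrite /cutoff max_l// ge_min; apply/orP; right.
have : 2 <= n%:R / N%:R :> R by rewrite ler_pdivlMr ?ltr0n// -natrM ler_nat.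
lra.
Qed.

Lemma cutoff_step N n : (0 < N)%N -> `|cutoff N n.+1 - cutoff N n| <= N%:R^-1.
Proof.
move=> N0; rewrite /cutoff -[n.+1]addn1 natrD mulrDl mul1r.
have : 0 < N%:R^-1 :> R by rewrite invr_gt0 ltr0n.
set x : R := n%:R / _; set y : R := _^-1 => y0.
rewrite ler_norml; apply/andP.
case: (leP 1 (2 - (x + y))) => ?; case: (leP 1 (2 - x)) => ?;
  rewrite ?(max_r ler01); case: (leP 0 (2 - (x + y))) => ?;
  case: (leP 0 (2 - x)) => ?; split; lra.
Qed.

(** The cut-off varies only for [N <= n < 2 N]. There [d_ R n.+1 <= 2 N] while its steps are at most
    [1 / N], so the product is at most 2. *)
Lemma cutoff_commutator N n : (0 < N)%N ->
  (d_ R n.+1 * (cutoff N n.+1 - cutoff N n)) ^+ 2 <= if (N <= n)%N then 4 else 0.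
Proof.
move=> N0; case: leqP => [Nn|nN]; last first.
  by rewrite !cutoff_below ?subrr ?mulr0 ?expr0n// ltnW.
have [n2|n2] := leqP (2 * N) n.
  by rewrite !cutoff_above ?subrr ?mulr0 ?expr0n// (leq_trans n2).
rewrite -real_normK ?num_real// (_ : 4 = 2 ^+ 2); last by ring.
rewrite ler_sqr ?nnegrE// normrM (ger0_norm (d_ge0 _)).
apply: (@le_trans _ _ ((2 * N)%:R * N%:R^-1)); last first.
  by rewrite natrM mulfK// pnatr_eq0 -lt0n.
apply: ler_pM => //; [exact: d_ge0 | | exact: cutoff_step].
by rewrite (le_trans (d_le _))// ler_nat.
Qed.

Lemma jacobi_cutoff b c N n :
  jacobi b (fun n => (cutoff N n)%:C * c n) n - jacobi b c n =
  (cutoff N n - 1)%:C * jacobi b c n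
  + ((d_ R n.+1 * (cutoff N n.+1 - cutoff N n))%:C * c n.+1
  - (d_ R n * (cutoff N n - cutoff N n.-1))%:C * c n.-1).
Proof.
rewrite /jacobi !rmorphM !rmorphB /= rmorph1; ring.
Qed.

(* Graph density of finite sequences in the maximal domain: since [d_n <= n],
   the commutator of [jacobi b] with a linear cutoff on [N, 2N] is bounded
   uniformly in N and supported on [n >= N]. *)
Lemma jacobi_core b c (e : R) (N0 : nat) :
  cvgn (series (fun n => cabs2 (c n))) ->
  cvgn (series (fun n => cabs2 (jacobi b c n))) -> 0 < e ->
  exists c' N, [/\ forall n, (N <= n)%N -> c' n = 0, 
    forall n, (n < N0)%N -> c' n = c n,
    (forall M, \sum_(n < M) cabs2 (c' n - c n) <= e) &
    (forall M, \sum_(n < M) cabs2 (jacobi b c' n - jacobi b c n) <= e)].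
Proof.
move=> sc sj e0.
have c0 n : 0 <= cabs2 (c n) by exact: cabs2_ge0.
have j0 n : 0 <= cabs2 (jacobi b c n) by exact: cabs2_ge0.
(* The final estimate adds [2 + 16 + 16 = 34] tails of this size. *)
have e1 : 0 < e / 100 by rewrite divr_gt0.
have [N1 h1] := series_tail_small c0 sc e1.
have [N2 h2] := series_tail_small j0 sj e1.
(* Beyond [N0], the cut-off equals 1 at all indices below [N0], where [c'] and [c] then agree. *)
pose N := (maxn N0 (maxn N1 N2)).+1.
have NN0 : (N0 <= N)%N by rewrite leqW// leq_maxl.
have {h1}h1 := h1 N.-1 _; have {h2}h2 := h2 N _.
have {}h1 : forall M, \sum_(i < M) (if (N.-1 <= i)%N then cabs2 (c i) else 0) <= e / 100.
  by apply: h1; rewrite /= !leq_max leqnn orbT.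
have {}h2 : forall M, \sum_(i < M) (if (N <= i)%N then cabs2 (jacobi b c i) else 0) <= e / 100.
  by apply: h2; rewrite leqW// !leq_max leqnn !orbT.
have cut n : cabs2 (cutoff N n - 1)%:C <= if (N.-1 <= n)%N then 1 else 0.
  case: leqP => nN; last by rewrite cutoff_below// ?subrr ?cabs2_0// ltnW// (leq_trans nN)// leq_pred.
  by rewrite cabs2_real; have /andP[] := cutoff01 N n; nra.
have cut' n : cabs2 (cutoff N n - 1)%:C <= if (N <= n)%N then 1 else 0.
  case: (leqP N n) => nN; last by rewrite cutoff_below ?(ltnW nN)// subrr cabs2_0.
  by rewrite cabs2_real; have /andP[] := cutoff01 N n; nra.
exists (fun n => (cutoff N n)%:C * c n), (2 * N)%N; split.
- by move=> n nN; rewrite cutoff_above// mul0r.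
- by move=> n nN; rewrite cutoff_below ?mul1r// ltnW// (leq_trans nN).
- move=> M; apply: (@le_trans _ _ (e / 100)); last by lra.
  apply: le_trans (h1 M); apply: ler_sum => n _.
  have -> : (cutoff N n)%:C * c n - c n = (cutoff N n - 1)%:C * c n.
    by rewrite rmorphB rmorph1; ring.
  rewrite cabs2M (le_trans (ler_wpM2r (c0 n) (cut n)))//.
  by case: ifP => _; rewrite ?mul1r ?mul0r.
move=> M; pose a1 i := if (N.-1 <= i)%N then cabs2 (c i) else 0.
have a10 i : 0 <= a1 i by rewrite /a1; case: ifP.
(* The shift of [a1] that bounds the term with [c n.-1]; the value 0 at index 0 is correct because
   [d_ R 0 = 0]. *)
pose a3 (i : nat) : R := if i is m.+1 then a1 m else 0.
pose a2 i := if (N <= i)%N then cabs2 (jacobi b c i) else 0.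
have bnd n : cabs2 (jacobi b (fun n => (cutoff N n)%:C * c n) n - jacobi b c n)
    <= 2 * a2 n + 16 * (a1 n.+1 + a3 n).
  rewrite jacobi_cutoff (le_trans (cabs2D_le _ _))// mulrDr lerD//.
    rewrite ler_pM2l// cabs2M (le_trans (ler_wpM2r (j0 n) (cut' n)))//.
    by rewrite /a2; case: ifP => _; rewrite ?mul1r ?mul0r.
  apply: (@le_trans _ _ (2 * (2 * (4 * a1 n.+1 + 4 * a3 n))));
    last by lra.
  rewrite ler_pM2l// (le_trans (cabs2B_le _ _))// ler_pM2l// lerD//.
    rewrite cabs2M cabs2_real (le_trans (ler_wpM2r (c0 _) (cutoff_commutator n (ltn0Sn _))))//.
    rewrite -/N /a1; case: (leqP N n) => [nN|_]; last by rewrite mul0r mulr_ge0//; case: ifP.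
    by rewrite ifT// (leq_trans (leq_pred N))// leqW.
  case: n => [|m]; first by rewrite mul0r cabs2M cabs2_0 mul0r mulr0.
  rewrite cabs2M cabs2_real (le_trans (ler_wpM2r (c0 _) (cutoff_commutator m (ltn0Sn _))))//.
  rewrite -/N -[a3 m.+1]/(a1 m) /a1; case: (leqP N m) => [nN|_]; last by rewrite mul0r mulr_ge0//; case: ifP.
  by rewrite ifT// (leq_trans (leq_pred N)).
apply: (@le_trans _ _ (\sum_(n < M) (2 * a2 n + 16 * (a1 n.+1 + a3 n)))).
  by apply: ler_sum => n _; exact: bnd.
rewrite big_split/= -!mulr_sumr big_split/=.
have s1 : \sum_(i < M) a1 i.+1 <= e / 100.
  apply: le_trans (h1 M.+1); rewrite big_ord_recl/=.
  by rewrite lerDr; exact: a10.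
have s2 K : \sum_(i < K) a3 i <= e / 100.
  apply: le_trans (h1 K); case: K => [|K]; first by rewrite !big_ord0.
  by rewrite big_ord_recl/= add0r big_ord_recr/= lerDl; exact: a10.
have {}s2 := s2 M.
have s3 : \sum_(i < M) a2 i <= e / 100 by exact: h2.
lra.
Qed.

End Jacobi.

(** * Solvability of the Jacobi equation in l^2 *)

Section JacobiSolution.
Variable R : realType.
Local Notation C := R[i].
Variables (b : nat -> C) (s d : R).
Hypotheses (d0 : 0 < d) (bs : forall n, d <= s * Im (b n)).
Implicit Types c G : nat -> C.

Let K := s ^+ 2 / d ^+ 2.

Let K0 : 0 <= K.
Proof. by rewrite /K divr_ge0 ?sqr_ge0. Qed.

(** The finite estimate for a truncation of [c]. The factor 2 comes from splitting [jacobi b c']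
    into [jacobi b c] and a small error. *)
Lemma jacobi_coercive c N :
  cvgn (series (fun n => cabs2 (c n))) ->
  cvgn (series (fun n => cabs2 (jacobi b c n))) ->
  \sum_(n < N) cabs2 (c n) <=
  2 * K * limn (series (fun n => cabs2 (jacobi b c n))).
Proof.
move=> sc sj; apply/ler_addgt0Pr => e e0.
have K1 : 0 < 2 * K + 1 by rewrite ltr_wpDl// mulr_ge0.
(* The error [e / (2 K + 1)] gets multiplied by [2 K] and so stays below [e], also when [K = 0]. *)
have [c' [M [c'0 c'c _ hJ]]] := jacobi_core N sc sj (divr_gt0 e0 K1).
set S : R := limn _.
have -> : \sum_(n < N) cabs2 (c n) = \sum_(n < N) cabs2 (c' n).
  by apply: eq_bigr => n _; rewrite c'c.
apply: (@le_trans _ _ (\sum_(n < N + M) cabs2 (c' n))).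
  by rewrite big_split_ord/= lerDl sumr_ge0// => i _; exact: cabs2_ge0.
have := jacobi_coercive_finite d0 bs (c'0 _ (leq_addl N M)) => /le_trans; apply.
rewrite -/K; apply: (@le_trans _ _ (K * (2 * (S + e / (2 * K + 1))))).
  rewrite ler_wpM2l//; apply: (@le_trans _ _ (\sum_(n < N + M)
      2 * (cabs2 (jacobi b c n) + cabs2 (jacobi b c' n - jacobi b c n)))).
    apply: ler_sum => n _; rewrite -[in leLHS](subrK (jacobi b c n) (jacobi b c' n)).
    by rewrite addrC cabs2D_le.
  rewrite -mulr_sumr big_split/= ler_pM2l//; apply: lerD; last exact: hJ.
  by apply: nonneg_series_partial => // n; exact: cabs2_ge0.
have alg (k x y z : R) : k * (2 * (x + y / z)) = 2 * k * x + y * (2 * k / z) by ring.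
rewrite alg lerD2l ler_piMr ?ltW//.
by rewrite ltr_pdivrMr// mul1r ltrDl.
Qed.

(** Forward solution of the three-term recurrence with entry [t] at index 0. The pair holds the
    entries [n] and [n - 1], with 0 in place of the missing entry [-1], whose coefficient is
    [d_ R 0 = 0]. *)
Definition jacobi_pair G (t : C) (n : nat) : C * C :=
  nat_rect (fun _ => (C * C)%type) (t, 0)
    (fun n p => ((G n - b n * p.1 - (d_ R n)%:C * p.2) / (d_ R n.+1)%:C, p.1)) n.

Definition jacobi_seq G t n := (jacobi_pair G t n).1.

Lemma jacobi_seqE G t n : jacobi b (jacobi_seq G t) n = G n.
Proof.
have dn : (d_ R n.+1)%:C != 0 :> C by rewrite fmorph_eq0 gt_eqF// d_gt0.
rewrite /jacobi {1}/jacobi_seq /jacobi_pair [nat_rect _ _ _ n.+1]/=.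
rewrite -/(jacobi_pair G t n) -/(jacobi_seq G t n).
rewrite (_ : (jacobi_pair G t n).2 = if n is m.+1 then jacobi_seq G t m else 0); last first.
  by case: n {dn}.
rewrite mulrC divfK//; case: n {dn} => [|n] /=; last by ring.
by rewrite mul0r mul0r subr0 addr0 subrK.
Qed.

(** The solutions of the recurrence are [t * q + p]. The choice [t N = - p N / q N] makes entry [N]
    vanish, that is, it solves the finite section of size [N], for which coercivity gives a bound
    independent of [N]. A cluster point of the parameters [t N] inherits the bound for every partial
    sum. *)
Lemma jacobi_solution G : cvgn (series (fun n => cabs2 (G n))) ->
  exists2 c, (forall n, jacobi b c n = G n) &
    forall N, \sum_(n < N) cabs2 (c n) <= K * limn (series (fun n => cabs2 (G n))).
Proof.
move=> sG; set S : R := limn _.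
pose p := jacobi_seq G 0; pose q := jacobi_seq (fun=> 0) 1.
have pE n : jacobi b p n = G n by exact: jacobi_seqE.
have qE n : jacobi b q n = 0 by rewrite jacobi_seqE.
have pqE t n : jacobi b (fun n => t * q n + p n) n = G n.
  by rewrite jacobiD pE qE mulr0 add0r.
(* A zero of [q] would produce a kernel vector of a finite section, and coercivity would force its
   entry 0, which is 1, to vanish. *)
have q0 n : q n != 0.
  case: n => [|n]; first by rewrite /q /jacobi_seq /= oner_eq0.
  apply/eqP => qn; have := jacobi_coercive_finite d0 bs qn.
  rewrite [X in _ * X]big1 ?mulr0 => [|i _]; last by rewrite qE cabs2_0.
  rewrite big_ord_recl/= {1}/q /jacobi_seq/= /cabs2/= expr1n expr0n addr0.
  rewrite leNgt ltr_wpDr// sumr_ge0// => i _; exact: cabs2_ge0.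
pose t N := - p N / q N.
have tN N : \sum_(n < N) cabs2 (t N * q n + p n) <= K * S.
  pose c n := t N * q n + p n.
  have cN : c N = 0 by rewrite /c /t divfK// addNr.
  have /= := jacobi_coercive_finite d0 bs cN => /le_trans; apply.
  rewrite -/K.
  rewrite ler_wpM2l// (eq_bigr (fun n : 'I_N => cabs2 (G n))); last first.
    by move=> n _; rewrite /c pqE.
  exact: (@nonneg_series_partial _ (fun n => cabs2 (G n)) N (fun n => cabs2_ge0 _) sG).
have S0 : 0 <= K * S by have := tN 0%N; rewrite big_ord0.
(* [x ^+ 2 <= K * S] implies [|x| <= K * S + 1], which spares a square root. *)
pose r := K * S + 1.
(* Since [q 0 = 1] and [p 0 = 0], entry 0 of the solution is the parameter itself; the index [N.+1]
   ensures that it occurs in the bounded sum. *)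
have tr N : Re (t N.+1) \in `[- r, r] /\ Im (t N.+1) \in `[- r, r].
  have : cabs2 (t N.+1) <= K * S.
    apply: le_trans (tN N.+1); rewrite big_ord_recl/= /q /p /jacobi_seq/=.
    by rewrite mulr1 addr0 lerDl sumr_ge0// => i _; exact: cabs2_ge0.
  rewrite /cabs2 !in_itv/= -!ler_norml => h.
  have aux (x : R) : x ^+ 2 <= K * S -> `|x| <= r.
    rewrite -(real_normK (num_real x)); have := normr_ge0 x; rewrite /r; nra.
  by split; apply: aux; apply: le_trans h; rewrite ?lerDl ?lerDr sqr_ge0.
pose u N : R * R := (Re (t N.+1), Im (t N.+1)).
have cpt : compact (`[- r, r]%classic `*` `[- r, r]%classic : set (R * R)).
  by apply: compact_setX; exact: segment_compact.
have uA : (u @ \oo) (`[- r, r]%classic `*` `[- r, r]%classic).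
  by exists 0%N => // N _; have [h1 h2] := tr N; split.
have [[x y] [_ xy]] := cpt _ _ uA.
exists (fun n => (x +i* y) * q n + p n) => // N.
pose F M (z : R * R) : R := \sum_(n < M) cabs2 ((z.1 +i* z.2) * q n + p n).
have cF M : continuous (F M).
  elim: M => [|M IH].
    rewrite (_ : F 0%N = cst 0); first exact: cst_continuous.
    by apply/funext => z; rewrite /F big_ord0.
  have aux (a a' a'' : R) : continuous (fun z : R * R => (z.1 * a + z.2 * a' + a'') ^+ 2).
    move=> z; have c1 : {for z, continuous (fun z : R * R => z.1)} by exact: cvg_fst.
    have c2 : {for z, continuous (fun z : R * R => z.2)} by exact: cvg_snd.
    have h : {for z, continuous (fun z : R * R => z.1 * a + z.2 * a' + a'')}.
      apply: continuousD; last exact: cst_continuous.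
      by apply: continuousD; apply: continuousM => //; exact: cst_continuous.
    exact: (continuousM h h).
  rewrite (_ : F M.+1 = (fun z : R * R => F M z
      + ((z.1 * Re (q M) + z.2 * (- Im (q M)) + Re (p M)) ^+ 2
      + (z.1 * Im (q M) + z.2 * Re (q M) + Im (p M)) ^+ 2))).
    by move=> z; do 2 (apply: continuousD; first by [exact: IH|exact: aux]); exact: aux.
  apply/funext => z; rewrite /F big_ord_recr/=; congr (_ + _).
  by rewrite /cabs2 !cReD !cImD !cReM !cImM /=; ring.
(* For fixed [N] the bound is a closed condition on the parameter that all [t M.+1] with [M >= N]
   satisfy, so it passes to the cluster point. *)
have clF : closed [set z | F N z <= K * S].
  by apply: (preimage_closed _ (@closed_le _ (K * S))) => z _; exact: cF.
have FN : (u @ \oo) [set z | F N z <= K * S].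
  exists N => // M /= NM; rewrite /F/=; apply: le_trans (tN M.+1).
  have -> : M.+1 = (N + (M.+1 - N))%N by rewrite subnKC// leqW.
  rewrite big_split_ord/= -[X in X <= _]addr0 lerD//; last first.
    by rewrite sumr_ge0// => i _; exact: cabs2_ge0.
  apply: ler_sum => n _; rewrite subnKC ?leqW//.
  by rewrite (_ : _ +i* _ = t M.+1)//; case: (t M.+1).
have := xy; rewrite clusterE => /(_ _ FN).
by move/closure_id : clF => <-.
Qed.

End JacobiSolution.

Section JacobiOperator.
Variable R : realType.
Local Notation C := R[i].
Local Notation l2 := (ell2 (@complex_dot R)).
Local Notation l2dot := (@ell2_dot R _ (@complex_dot R)).
Local Notation sqs := (square_summable (@complex_dot R)).

Lemma ell2_cabs2_cvg (x : l2) : cvgn (series (fun n => cabs2 (x n))).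
Proof. by apply/square_summable_cabs2; exact: valP. Qed.

Lemma hnorm2_l2 (x : l2) : hnorm2 l2dot x = limn (series (fun n => cabs2 (x n))).
Proof.
rewrite hnorm2_ell2; congr (limn (series _)); apply/funext => n.
by rewrite hnorm2_complex.
Qed.

Lemma hnorm2_l2_le (x : l2) K :
  (forall N, \sum_(i < N) cabs2 (x i) <= K) -> hnorm2 l2dot x <= K.
Proof.
move=> h; apply: hnorm2_ell2_le => N; rewrite (le_trans _ (h N))//.
by apply: ler_sum => i _; rewrite hnorm2_complex.
Qed.

Lemma square_summable_finite (c : nat -> C) N :
  (forall n, (N <= n)%N -> c n = 0) -> c \in sqs.
Proof.
move=> c0; apply: (@square_summable_bounded _ _ _ _ (\sum_(i < N) cabs2 (c i))) => M.
apply: (@le_trans _ _ (\sum_(i < N + M) cabs2 (c i))).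
  rewrite addnC big_split_ord/= (eq_bigr (fun i : 'I_M => cabs2 (c i))).
    by rewrite lerDl sumr_ge0// => i _; exact: cabs2_ge0.
  by move=> i _; rewrite hnorm2_complex.
rewrite big_split_ord/= [X in _ + X]big1 ?addr0// => i _.
by rewrite c0 ?leq_addr// cabs2_0.
Qed.

Lemma jacobi_finite (b c : nat -> C) N : (forall n, (N <= n)%N -> c n = 0) ->
  forall n, (N.+1 <= n)%N -> jacobi b c n = 0.
Proof.
move=> c0 [|n]// Nn; rewrite /jacobi !c0 ?mulr0 ?addr0//.
  by rewrite ltnW.
by rewrite 2?ltnW.
Qed.

Lemma ell2B (x y : l2) n : (x - y) n = x n - y n.
Proof. by []. Qed.

(** The truncations of [jacobi_core] converge to [X] in the graph norm. Half of [e ^+ 2] is used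
    because the closure asks for strict inequalities. *)
Lemma jacobi_maximal_domain (mu : R) (X Y : l2) :
  (forall n, Y n = jacobi (fun n => ((2 * n + 1)%N%:R * mu)%:C) X n) ->
  opJ0 mu (X, Y).
Proof.
move=> YX e e0; set b := fun n => _ in YX.
have e2 : 0 < e ^+ 2 / 2 by rewrite divr_gt0// exprn_gt0.
have sX := @ell2_cabs2_cvg X.
have sJ : cvgn (series (fun n => cabs2 (jacobi b X n))).
  have := @ell2_cabs2_cvg Y; rewrite (_ : (fun n => cabs2 (Y n)) =
    (fun n => cabs2 (jacobi b X n)))//.
  by apply/funext => n; rewrite YX.
have [c [N [c0 _ h1 h2]]] := jacobi_core 0 sX sJ e2.
exists (Ell2 (square_summable_finite c0)).
exists (Ell2 (square_summable_finite (jacobi_finite b c0))); split.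
- by split=> //=; exists N.
- rewrite hnorm_lt//; apply: (@le_lt_trans _ _ (e ^+ 2 / 2)).
    by apply: hnorm2_l2_le => M; exact: h1.
  by rewrite ltr_pdivrMr// ltr_pMr ?exprn_gt0// ltr1n.
- rewrite hnorm_lt//; apply: (@le_lt_trans _ _ (e ^+ 2 / 2)).
    apply: hnorm2_l2_le => M; rewrite (le_trans _ (h2 M))//.
    by apply: ler_sum => i _; rewrite ell2B/= YX.
  by rewrite ltr_pdivrMr// ltr_pMr ?exprn_gt0// ltr1n.
Qed.

Variables (L : C) (mu : R).
Hypotheses (hL : Im L != 0) (mu0 : 0 < mu).

Let b n := (2 * mu)%:C * y_ n L.

(** The domain condition is automatic. By [y_perturbation] the diagonals of the two Jacobi matrices
    differ by a bounded sequence, so if one of them maps [X] into l^2 then so does the other, and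
    the domain of [opJ0] is maximal. *)
Lemma opJE (X G : l2) : opJ L mu (X, G) <-> forall n, G n = jacobi b X n.
Proof.
split=> [[_]//|GX]; split=> //=.
pose b0 n : C := ((2 * n + 1)%N%:R * mu)%:C.
have hb n : cabs2 (b0 n - b n) <= 4 * mu ^+ 2 * cabs2 L.
  have -> : b0 n - b n = (2 * mu)%:C * - (y_ n L - (n%:R + 2^-1)).
    rewrite /b0 /b opprB mulrBr; congr (_ - _).
    rewrite (_ : n%:R + 2^-1 = (n%:R + 2^-1)%:C); last first.
      by rewrite rmorphD /= rmorph_nat -half_real.
    rewrite -rmorphM; congr (_ %:C); by rewrite natrD natrM; field.
  rewrite cabs2M cabs2N cabs2_real exprMn -natrX ler_wpM2l ?y_perturbation//.
  by rewrite mulr_ge0// sqr_ge0.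
have jE n : jacobi b0 X n = G n + (b0 n - b n) * X n.
  by rewrite GX /jacobi; ring.
have h : jacobi b0 X \in sqs.
  rewrite (_ : jacobi b0 X = (fun n => 1 * G n + (b0 n - b n) * X n)); last first.
    by apply/funext => n; rewrite mul1r jE.
  have h : ((fun n => (b0 n - b n) * X n) : nat -> C) \in sqs.
    apply: (@square_summable_le _ _ (fun n => cabs2 (X n)) (4 * mu ^+ 2 * cabs2 L)).
    - by move=> n; exact: cabs2_ge0.
    - exact: ell2_cabs2_cvg.
    - by move=> n; rewrite cabs2M ler_wpM2r// cabs2_ge0.
  have [_ clos] := square_summable_submod_closed (@complex_dot R).
  by apply: (clos 1 _ _ _ h); exact: valP.
by exists (Ell2 h); exact: jacobi_maximal_domain.
Qed.

Lemma opJ_inverse_bounded : bounded_operator l2dot l2dot (op_inv (opJ L mu)).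
Proof.
have [d d0 hd] := Im_y_lower hL.
have d20 : 0 < 2 * mu * d by rewrite !mulr_gt0.
have hb n : 2 * mu * d <= - Im L * Im (b n).
  by rewrite /b cImM/= mul0r addr0 mulrCA ler_pM2l ?mulr_gt0.
apply: (@linear_relation_bounded_operator _ _ _ _ _ _
  (2 * ((- Im L) ^+ 2 / (2 * mu * d) ^+ 2))).
- move=> G; have [c cG cb] := jacobi_solution d20 hb (@ell2_cabs2_cvg G).
  have cs : c \in sqs.
    apply: (@square_summable_bounded _ _ _ _ ((- Im L) ^+ 2 / (2 * mu * d) ^+ 2
      * limn (series (fun n => cabs2 (G n))))) => N.
    by rewrite (le_trans _ (cb N))//; apply: ler_sum => i _; rewrite hnorm2_complex.
  by exists (Ell2 cs); apply/opJE => n; rewrite cG.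
- move=> a x y x' y' /opJE/= h /opJE/= h'; apply/opJE => n /=.
  have e := jacobiD b a y y' n; rewrite -h -h' in e.
  by rewrite [RHS]e.
- move=> G X /opJE h; apply: hnorm2_l2_le => N; rewrite hnorm2_l2.
  have e : (fun n => cabs2 (G n)) = (fun n => cabs2 (jacobi b X n)).
    by apply/funext => n; rewrite h.
  rewrite e; apply: (jacobi_coercive d20 hb); first exact: ell2_cabs2_cvg.
  by rewrite -e; exact: ell2_cabs2_cvg.
Qed.

Lemma opY_inverseE (x y : l2) : op_inv (op_scale 2 (opY L)) (x, y) <->
  forall n, y n = x n / (2 * y_ n L).
Proof.
have y0 n : 2 * y_ n L != 0 by rewrite mulf_neq0 ?y_neq0.
split=> [[z /= zy ->] n|h].
  have -> : (2 *: z) n = 2 * z n by [].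
  rewrite (zy n) mulrA mulrC mulKf//.
exists (2^-1 *: x) => /= [n|].
  have -> : (2^-1 *: x) n = 2^-1 * x n by [].
  by rewrite h invfM mulrCA [y_ n L * _]mulrCA mulfV ?y_neq0// mulr1 mulrC.
by rewrite scalerA mulfV ?scale1r.
Qed.

Lemma opY_inverse_bounded :
  bounded_operator l2dot l2dot (op_inv (op_scale 2 (opY L))).
Proof.
have [d d0 hd] := y_lower hL.
have hb (x : C) n : cabs2 (x / (2 * y_ n L)) <= d^-1 * cabs2 x.
  rewrite ler_pdivlMl//; have y0 : y_ n L != 0 by exact: y_neq0.
  apply: (@le_trans _ _ (cabs2 (2 * y_ n L) * cabs2 (x / (2 * y_ n L)))); last first.
    by rewrite -cabs2M [_ * (x / _)]mulrC divfK// mulf_neq0.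
  rewrite ler_wpM2r ?cabs2_ge0// cabs2M (le_trans (hd n))//.
  rewrite ler_peMl ?cabs2_ge0// /cabs2 Re_natr Im_natr; lra.
apply: (@linear_relation_bounded_operator _ _ _ _ _ _ d^-1).
- move=> x.
  have cs : ((fun n => x n / (2 * y_ n L)) : nat -> C) \in sqs.
    apply: (@square_summable_le _ _ (fun n => cabs2 (x n)) d^-1); last by move=> n; exact: hb.
      by move=> n; exact: cabs2_ge0.
    exact: ell2_cabs2_cvg.
  by exists (Ell2 cs); apply/opY_inverseE.
- move=> a x y x' y' /opY_inverseE/= h /opY_inverseE/= h'; apply/opY_inverseE => n.
  have -> : (a *: y + y') n = a * y n + y' n by [].
  have -> : (a *: x + x') n = a * x n + x' n by [].
  by rewrite h h' [RHS]mulrDl mulrA.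
- move=> x y /opY_inverseE h; apply: hnorm2_l2_le => N; rewrite hnorm2_l2.
  apply: (@le_trans _ _ (d^-1 * \sum_(i < N) cabs2 (x i))).
    by rewrite mulr_sumr; apply: ler_sum => n _; rewrite h hb.
  rewrite ler_wpM2l ?invr_ge0 ?(ltW d0)//.
  exact: (@nonneg_series_partial _ _ N (fun n => cabs2_ge0 _) (@ell2_cabs2_cvg x)).
Qed.

End JacobiOperator.

(** * Weak derivatives on the line *)

Section WeakDerivative.
Variable R : realType.
Local Notation leb := (@lebesgue_measure R).
Implicit Types (D : set R) (p q e phi : R -> R).

Definition segment_integrable D p : Prop :=
  forall a b, [set` `[a, b]] `<=` D -> leb.-integrable `[a, b] (EFin \o p).

(** Local integrability replaces square integrability here, because products with growing
    exponentials have to be differentiated. *)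
Definition real_weak_derivative D p q : Prop :=
  [/\ segment_integrable D p, segment_integrable D q & forall phi, C1c D phi ->
    \int[leb]_(x in D) (p x * derive1 phi x) = - \int[leb]_(x in D) (q x * phi x)].

Lemma Rintegral_support D (a b : R) p : [set` `[a, b]] `<=` D ->
  (forall x, x \notin `[a, b] -> p x = 0) ->
  \int[leb]_(x in D) p x = \int[leb]_(x in `[a, b]) p x.
Proof.
move=> abD p0; rewrite Rintegral_mkcond [RHS]Rintegral_mkcond.
congr (Rintegral _ _ _); apply/funext => x; rewrite !patchE !mem_setE.
have [xab|xab] := boolP (x \in `[a, b]).
  by rewrite mem_set//; apply: abD.
by rewrite p0//; case: ifP.
Qed.

Lemma C1c_support D phi : C1c D phi -> exists a b, [/\ [set` `[a, b]] `<=` D,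
  forall x, x \notin `[a, b] -> phi x = 0 &
  forall x, x \notin `[a, b] -> derive1 phi x = 0].
Proof.
move=> [dphi cphi [a [b [abD phi0]]]]; exists a, b; split=> // x xab.
rewrite derive1E; transitivity ('D_1 (cst 0 : R -> R) x); last exact: derive_cst.
apply: near_eq_derive.
have : open (~` [set` `[a, b]]).
  by apply: closed_openC; exact: interval_closed.
rewrite openE => /(_ x) h; have {h} : nbhs x (~` [set` `[a, b]]).
  by apply: h => /=; exact/negP.
by apply: filterS => y /= /negP; exact: phi0.
Qed.

Lemma C1c_continuous D phi : C1c D phi -> continuous phi.
Proof. by move=> [d _ _] x; exact/differentiable_continuous/derivable1_diffP. Qed.

Lemma continuous_segment_integrable D p : continuous p -> segment_integrable D p.
Proof.
move=> cp a b _; apply: continuous_compact_integrable.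
  exact: segment_compact.
exact: continuous_subspaceT.
Qed.

Lemma integrable_segment_mul (a b : R) p e :
  leb.-integrable `[a, b] (EFin \o p) -> continuous e ->
  leb.-integrable `[a, b] (EFin \o (fun x => p x * e x)).
Proof.
move=> ip ce.
rewrite (_ : _ \o _ = ((EFin \o p) \* (EFin \o e))%E) //.
apply: integrableMl => //.
  exact: measurable_funTS (continuous_measurable_fun _).
have : compact (e @` `[a, b]).
  apply: continuous_compact; last exact: segment_compact.
  exact: continuous_subspaceT.
move=> /compact_bounded[M [Mr hM]]; exists M; split=> // x Mx y yab /=.
by apply: hM Mx _ _; exists y.
Qed.

Lemma segment_integrable_mul D p e : segment_integrable D p -> continuous e ->
  segment_integrable D (fun x => p x * e x).
Proof. by move=> ip ce a b abD; apply: integrable_segment_mul => //; exact: ip. Qed.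

Lemma integrable_segmentZ (a b : R) p (s : R) :
  leb.-integrable `[a, b] (EFin \o p) ->
  leb.-integrable `[a, b] (EFin \o (fun x => s * p x)).
Proof.
move=> ip; rewrite (_ : _ \o _ = (fun x => (s%:E * (EFin \o p) x)%E)) //.
exact: integrableZl.
Qed.

Lemma integrable_segmentD (a b : R) p q :
  leb.-integrable `[a, b] (EFin \o p) -> leb.-integrable `[a, b] (EFin \o q) ->
  leb.-integrable `[a, b] (EFin \o (fun x => p x + q x)).
Proof.
move=> ip iq; rewrite (_ : _ \o _ = ((EFin \o p) \+ (EFin \o q))%E) //.
exact: integrableD.
Qed.

Lemma segment_integrable_lin D p q (s t : R) :
  segment_integrable D p -> segment_integrable D q ->
  segment_integrable D (fun x => s * p x + t * q x).
Proof.
move=> ip iq a b abD; apply: integrable_segmentD; apply: integrable_segmentZ.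
  exact: ip.
exact: iq.
Qed.

Lemma Rintegral_lin (a b : R) p q (s t : R) :
  leb.-integrable `[a, b] (EFin \o p) -> leb.-integrable `[a, b] (EFin \o q) ->
  \int[leb]_(x in `[a, b]) (s * p x + t * q x) =
  s * (\int[leb]_(x in `[a, b]) p x) + t * (\int[leb]_(x in `[a, b]) q x).
Proof.
move=> ip iq; rewrite RintegralD ?RintegralZl//; exact: integrable_segmentZ.
Qed.

Lemma real_weak_derivativeE D p q phi (a b : R) : real_weak_derivative D p q ->
  C1c D phi -> [set` `[a, b]] `<=` D ->
  (forall x, x \notin `[a, b] -> phi x = 0) ->
  (forall x, x \notin `[a, b] -> derive1 phi x = 0) ->
  \int[leb]_(x in `[a, b]) (p x * derive1 phi x) =
  - \int[leb]_(x in `[a, b]) (q x * phi x).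
Proof.
move=> [_ _ h] Cphi abD p0 p'0; have := h _ Cphi.
by rewrite !(@Rintegral_support D a b)// => x xab; rewrite ?p0 ?p'0// mulr0.
Qed.

Lemma real_weak_derivative_lin D p q p' q' (s t : R) :
  real_weak_derivative D p q -> real_weak_derivative D p' q' ->
  real_weak_derivative D (fun x => s * p x + t * p' x) (fun x => s * q x + t * q' x).
Proof.
move=> wp wp'; have [ip iq _] := wp; have [ip' iq' _] := wp'.
split=> [||phi Cphi]; [exact: segment_integrable_lin..|].
have cphi := C1c_continuous Cphi; have [_ c'phi _] := Cphi.
have [a [b [abD phi0 phi'0]]] := C1c_support Cphi.
rewrite !(@Rintegral_support D a b)//; last 2 first.
- by move=> x xab; rewrite phi0// mulr0.
- by move=> x xab; rewrite phi'0// mulr0.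
under eq_Rintegral do rewrite mulrDl -!mulrA.
under [in RHS]eq_Rintegral do rewrite mulrDl -!mulrA.
have I p0 e : segment_integrable D p0 -> continuous e ->
    leb.-integrable `[a, b] (EFin \o (fun x => p0 x * e x)).
  by move=> i ce; apply: integrable_segment_mul => //; exact: i.
rewrite !Rintegral_lin; [|exact: I..].
rewrite (real_weak_derivativeE wp Cphi abD)// (real_weak_derivativeE wp' Cphi abD)//.
by rewrite opprD !mulrN.
Qed.

Lemma C1c_mul D phi e : C1c D phi -> (forall x, derivable e x 1) ->
  continuous (derive1 e) -> C1c D (e * phi) /\
  derive1 (e * phi) = (fun x => e x * derive1 phi x + derive1 e x * phi x).
Proof.
move=> Cphi de ce'; have cphi := C1c_continuous Cphi.
have [dphi c'phi [a [b [abD phi0]]]] := Cphi.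
have ce : continuous e by move=> x; exact/differentiable_continuous/derivable1_diffP.
have E : derive1 (e * phi) = (fun x => e x * derive1 phi x + derive1 e x * phi x).
  apply/funext => x; rewrite derive1E deriveM//.
  by rewrite -!derive1E; congr (_ + _); exact: mulrC.
split; last exact: E.
split.
- by move=> x; exact: derivableM.
- rewrite E => x; apply: cvgD.
    by apply: cvgM; [exact: ce|exact: c'phi].
  by apply: cvgM; [exact: ce'|exact: cphi].
- exists a, b; split=> // x xab; rewrite -[LHS]/(e x * phi x).
  by rewrite phi0// mulr0.
Qed.

(** The weak identity for [p] is tested with [e * phi], which is again admissible, and the term with
    [derive1 e] is moved to the other side. *)
Lemma real_weak_derivative_mul D p q e : real_weak_derivative D p q ->
  (forall x, derivable e x 1) -> continuous (derive1 e) ->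
  real_weak_derivative D (fun x => p x * e x) (fun x => q x * e x + p x * derive1 e x).
Proof.
move=> wp de ce'; have [ip iq _] := wp.
have ce : continuous e by move=> x; exact/differentiable_continuous/derivable1_diffP.
have I p0 e0 : segment_integrable D p0 -> continuous e0 ->
    segment_integrable D (fun x => p0 x * e0 x) by exact: segment_integrable_mul.
have i2 : segment_integrable D (fun x => q x * e x + p x * derive1 e x).
  have := segment_integrable_lin 1 1 (I _ _ iq ce) (I _ _ ip ce') => h a b /h.
  by apply: eq_integrable => // x _ /=; rewrite !mul1r.
split=> [||phi Cphi]; [exact: I|exact: i2|].
have cphi := C1c_continuous Cphi; have [_ c'phi _] := Cphi.
have [a [b [abD phi0 phi'0]]] := C1c_support Cphi.
have [Cephi Eephi] := C1c_mul Cphi de ce'.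
rewrite !(@Rintegral_support D a b)//; last 2 first.
- by move=> x xab; rewrite phi0// mulr0.
- by move=> x xab; rewrite phi'0// mulr0.
have := real_weak_derivativeE wp Cephi abD.
rewrite Eephi => h0.
have {h0}h : \int[leb]_(x in `[a, b]) (p x * (e x * derive1 phi x + derive1 e x * phi x)) =
    - \int[leb]_(x in `[a, b]) (q x * (e x * phi x)).
  apply: h0 => x xab; last by rewrite phi0// phi'0// !mulr0 addr0.
  by rewrite -[LHS]/(e x * phi x) phi0// mulr0.

have e1 : \int[leb]_(x in `[a, b]) (p x * (e x * derive1 phi x + derive1 e x * phi x)) =
    \int[leb]_(x in `[a, b]) (p x * e x * derive1 phi x) +
    \int[leb]_(x in `[a, b]) (p x * derive1 e x * phi x).
  rewrite -RintegralD//; last 2 first.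
  - exact: (I _ _ (I _ _ ip ce) c'phi).
  - exact: (I _ _ (I _ _ ip ce') cphi).
  by apply: eq_Rintegral => x _; ring.
have e2 : \int[leb]_(x in `[a, b]) ((q x * e x + p x * derive1 e x) * phi x) =
    \int[leb]_(x in `[a, b]) (q x * (e x * phi x)) +
    \int[leb]_(x in `[a, b]) (p x * derive1 e x * phi x).
  rewrite -RintegralD//; last 2 first.
  - have := I _ _ (I _ _ iq ce) cphi _ _ abD.
    by apply: eq_integrable => // x _ /=; rewrite mulrA.
  - exact: (I _ _ (I _ _ ip ce') cphi).
  by apply: eq_Rintegral => x _; ring.
rewrite e2 opprD; rewrite -h e1; ring.
Qed.

End WeakDerivative.

Section Primitives.
Variable R : realType.
Local Notation leb := (@lebesgue_measure R).
Implicit Types (D : set R) (p q e phi k P : R -> R).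

Lemma C1_FTC2 phi (a b : R) : (forall x, derivable phi x 1) ->
  continuous (derive1 phi) -> a <= b ->
  \int[leb]_(x in `[a, b]) derive1 phi x = phi b - phi a.
Proof.
move=> dphi c'phi; rewrite le_eqVlt => /predU1P[<-|ab].
  by rewrite set_itv1 Rintegral_set1 subrr.
have cphi : continuous phi by move=> x; exact/differentiable_continuous/derivable1_diffP.
rewrite /Rintegral (@continuous_FTC2 _ _ phi _ _ ab).
- exact: erefl.
- exact: continuous_subspaceT.
- split; first by move=> x _; exact: dphi.
    by apply: cvg_at_right_filter; exact: cphi.
  by apply: cvg_at_left_filter; exact: cphi.
- by move=> x _.
Qed.

(** The support condition is silent at the end points themselves; there the value is a limit of
    zeros taken from outside. *)
Lemma C1c_end0 phi (a b : R) : continuous phi ->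
  (forall x, x \notin `[a, b] -> phi x = 0) -> a <= b -> phi a = 0 /\ phi b = 0.
Proof.
move=> cphi phi0 ab.
have key (x : R) : (forall r : R, 0 < r -> exists2 y, `|x - y| < r & phi y = 0) ->
    phi x = 0.
  move=> h; apply/eqP/negPn/negP => nx.
  have /cvgrPdist_lt/(_ _ _)/nbhs_ballP := cphi x.
  move=> /(_ `|phi x|); rewrite normr_gt0 => /(_ nx)[d /= d0 hd].
  have [y xy y0] := h _ d0.
  by have := hd y xy; rewrite /= y0 subr0 ltxx.
split; apply: key => r r0.
  exists (a - r / 2); first by rewrite opprB addrCA subrr addr0 gtr0_norm; lra.
  by apply: phi0; rewrite in_itv/= negb_and -ltNge; apply/orP; left; lra.
exists (b + r / 2); first by rewrite opprD addNKr normrN gtr0_norm; lra.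
by apply: phi0; rewrite in_itv/= negb_and -!ltNge; apply/orP; right; lra.
Qed.

Lemma C1c_integral0 D phi (a b : R) : C1c D phi ->
  (forall x, x \notin `[a, b] -> phi x = 0) ->
  \int[leb]_(x in `[a, b]) derive1 phi x = 0.
Proof.
move=> Cphi phi0; have cphi := C1c_continuous Cphi; have [dphi c'phi _] := Cphi.
have [ab|ba] := leP a b; last by rewrite set_itv_ge ?Rintegral_set0// bnd_simp -ltNge.
rewrite C1_FTC2//; have [-> ->] := C1c_end0 cphi phi0 ab; exact: subrr.
Qed.

Lemma real_weak_derivative_cst D (c : R) : real_weak_derivative D (cst c) (cst 0).
Proof.
split; [exact/continuous_segment_integrable/cst_continuous..|].
move=> phi Cphi; have [a [b [abD phi0 phi'0]]] := C1c_support Cphi.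
rewrite !(@Rintegral_support _ D a b)//; last 2 first.
- by move=> x _; rewrite mul0r.
- by move=> x xab; rewrite phi'0// mulr0.
have [_ c'phi _] := Cphi.
rewrite RintegralZl//; last first.
  by apply: (@continuous_segment_integrable _ setT); [exact: c'phi|exact: subsetT].
rewrite (C1c_integral0 Cphi)// mulr0.
by under eq_Rintegral do rewrite mul0r; rewrite Rintegral_cst// mul0r oppr0.
Qed.

Lemma integrable_patch (a b : R) p : leb.-integrable `[a, b] (EFin \o p) ->
  leb.-integrable setT (EFin \o (p \_ `[a, b])).
Proof.
move=> ip; rewrite -restrict_EFin.
exact: (proj1 (@integrable_mkcond _ _ _ leb `[a, b]%classic (EFin \o p) (measurable_itv _)) ip).
Qed.

Lemma integral_EFin_Rintegral (D : set R) p : measurable D ->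
  leb.-integrable D (EFin \o p) ->
  (\int[leb]_(x in D) (p x)%:E = (\int[leb]_(x in D) p x)%:E)%E.
Proof. by move=> mD ip; rewrite /Rintegral fineK// integrable_fin_num. Qed.

(* Fubini on the triangle [a <= y <= x <= b]. *)
Lemma Rintegral_triangle (a b : R) k psi : a <= b ->
  leb.-integrable `[a, b] (EFin \o k) -> leb.-integrable `[a, b] (EFin \o psi) ->
  \int[leb]_(x in `[a, b]) (psi x * \int[leb]_(y in `[a, x]) k y) =
  \int[leb]_(y in `[a, b]) (k y * \int[leb]_(x in `[y, b]) psi x).
Proof.
move=> ab ik ipsi.
set k' := k \_ `[a, b]; set psi' := psi \_ `[a, b].
have ik' : leb.-integrable setT (EFin \o k') by exact: integrable_patch.
have ipsi' : leb.-integrable setT (EFin \o psi') by exact: integrable_patch.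
have mk' : measurable_fun setT k'.
  by apply/measurable_EFinP; exact: measurable_int ik'.
have mpsi' : measurable_fun setT psi'.
  by apply/measurable_EFinP; exact: measurable_int ipsi'.
pose F (z : R * R) : R := if z.2 <= z.1 then psi' z.1 * k' z.2 else 0.
have mF : measurable_fun setT (EFin \o F : _ * _ -> _).
  apply/measurable_EFinP; apply: measurable_fun_ifT.
  - exact: measurable_fun_ler measurable_snd measurable_fst.
  - apply: measurable_funM; first exact: measurableT_comp mpsi' measurable_fst.
    exact: measurableT_comp mk' measurable_snd.
  - exact: measurable_cst.
(* On the whole square the integrand is a product of two integrable functions; it dominates [F], its
   restriction to the triangle. *)
have iG : (leb \x leb)%E.-integrable setT (EFin \o (fun z => psi' z.1 * k' z.2)).
  apply/integrable12ltyP.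
    apply/measurable_EFinP; apply: measurable_funM.
      exact: measurableT_comp mpsi' measurable_fst.
    exact: measurableT_comp mk' measurable_snd.
  have [_ ck] := integrableP _ _ _ ik'; have [_ cpsi] := integrableP _ _ _ ipsi'.
  rewrite [X in (X < _)%E](_ : _ = (\int[leb]_x ((\int[leb]_y `|(EFin \o k') y|) * `|(EFin \o psi') x|))%E).
    rewrite ge0_integralZl//.
    - by rewrite lte_mul_pinfty// ?integral_ge0// ge0_fin_numE// integral_ge0.
    - by apply: measurableT_comp => //; exact/measurable_EFinP.
    - by apply: integral_ge0.
  apply: eq_integral => x _; rewrite muleC -ge0_integralZl//.
  - by apply: eq_integral => y _; rewrite /= normrM EFinM.
  - by apply: measurableT_comp => //; exact/measurable_EFinP.
have iF : (leb \x leb)%E.-integrable setT (EFin \o F).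
  apply: le_integrable iG => // z _ /=; rewrite lee_fin /F.
  by case: ifP => // _; rewrite normr0.
have Fx x : x \in `[a, b] -> forall y, F (x, y) = psi x * (k \_ `[a, x]) y.
  move=> xab y; rewrite /F /= /psi' /k' !patchE mem_set//.
  have /andP[ax xb] : a <= x <= b by rewrite in_itv in xab.
  case: ifPn => yx; rewrite !mem_setE !in_itv/= ?yx ?(negbTE yx) ?andbT ?andbF ?mulr0//.
  by rewrite (le_trans yx xb) andbT.
have Fy y : y \in `[a, b] -> forall x, F (x, y) = k y * (psi \_ `[y, b]) x.
  move=> yab x; rewrite /F /= /psi' /k' !patchE [y \in _]mem_set//.
  have /andP[ay yb] : a <= y <= b by rewrite in_itv in yab.
  case: ifPn => yx; rewrite !mem_setE !in_itv/= ?yx ?(negbTE yx) ?mulr0//.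
  by rewrite (le_trans ay yx) /= mulrC.
have sub x y : a <= x -> y <= b -> `[x, y] `<=` `[a, b].
  by move=> ax yb; apply: subset_itv; rewrite bnd_simp.
have := Fubini iF.
have -> : (\int[leb]_x \int[leb]_y (EFin \o F) (x, y) =
    \int[leb]_x (((fun x => (psi x * \int[leb]_(y in `[a, x]) k y)%R%:E) \_ `[a, b]) x))%E.
  apply: eq_integral => x _; rewrite patchE mem_setE.
  case: ifPn => xab; last first.
    rewrite integral0_eq// => y _; rewrite /F/= /psi' patchE mem_setE (negbTE xab).
    by rewrite mul0r; case: ifP.
  have ikx : leb.-integrable `[a, x] (EFin \o k).
    by apply: integrableS ik => //; apply: sub => //; rewrite (itvP xab).
  under eq_integral do rewrite /= Fx//.
  rewrite integral_EFin_Rintegral//.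
    by rewrite RintegralZl// -?Rintegral_mkcond//; exact: integrable_patch.
  have := integrableZl measurableT (psi x) (integrable_patch ikx).
  by apply: eq_integrable => // y _ /=; rewrite EFinM.
have -> : (\int[leb]_y \int[leb]_x (EFin \o F) (x, y) =
    \int[leb]_y (((fun y => (k y * \int[leb]_(x in `[y, b]) psi x)%R%:E) \_ `[a, b]) y))%E.
  apply: eq_integral => y _; rewrite patchE mem_setE.
  case: ifPn => yab; last first.
    rewrite integral0_eq// => x _; rewrite /F/= /k' [X in _ * X]patchE mem_setE (negbTE yab).
    by rewrite mulr0; case: ifP.
  have ipy : leb.-integrable `[y, b] (EFin \o psi).
    by apply: integrableS ipsi => //; apply: sub => //; rewrite (itvP yab).
  under eq_integral do rewrite /= Fy//.
  rewrite integral_EFin_Rintegral//.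
    by rewrite RintegralZl// -?Rintegral_mkcond//; exact: integrable_patch.
  have := integrableZl measurableT (k y) (integrable_patch ipy).
  by apply: eq_integrable => // x _ /=; rewrite EFinM.
by rewrite -!integral_mkcond /Rintegral => ->.
Qed.

(** Integration by parts for a merely integrable [k]: write [P x] as [P a] plus the integral of [k]
    and exchange the integrals, so that the inner one is [- phi y]. The constant [P a] drops out
    because [derive1 phi] has integral 0. *)
Lemma real_weak_derivative_primitive D P k : continuous P ->
  segment_integrable D k ->
  (forall a b, a <= b -> [set` `[a, b]] `<=` D ->
    P b - P a = \int[leb]_(x in `[a, b]) k x) ->
  real_weak_derivative D P k.
Proof.
move=> cP ik PE; split=> // [|phi Cphi]; first exact: continuous_segment_integrable.
have cphi := C1c_continuous Cphi; have [dphi c'phi _] := Cphi.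
have [a [b [abD phi0 phi'0]]] := C1c_support Cphi.
rewrite !(@Rintegral_support _ D a b)//; last 2 first.
- by move=> x xab; rewrite phi0// mulr0.
- by move=> x xab; rewrite phi'0// mulr0.
have [ab|ba] := leP a b; last first.
  by rewrite set_itv_ge ?Rintegral_set0 ?oppr0// bnd_simp -ltNge.
have [_ phib] := C1c_end0 cphi phi0 ab.
have i' : leb.-integrable `[a, b] (EFin \o derive1 phi).
  by apply: (@continuous_segment_integrable _ setT); [exact: c'phi|exact: subsetT].
have iP : leb.-integrable `[a, b] (EFin \o (fun x => (P x) * derive1 phi x)).
  apply: integrable_segment_mul => //.
  by apply: (@continuous_segment_integrable _ setT); [exact: cP|exact: subsetT].
have E : \int[leb]_(x in `[a, b]) (P x * derive1 phi x) =
    \int[leb]_(x in `[a, b]) (derive1 phi x * \int[leb]_(y in `[a, x]) k y).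
  transitivity (\int[leb]_(x in `[a, b]) (1 * (P x * derive1 phi x) + (- P a) * derive1 phi x)).
    by rewrite Rintegral_lin// (C1c_integral0 Cphi)// mulr0 addr0 mul1r.
  apply: eq_Rintegral => x; rewrite mem_setE => xab.
  rewrite -PE; first by ring.
    by rewrite (itvP xab).
  by apply: subset_trans abD; apply: subset_itvl; rewrite bnd_simp (itvP xab).
rewrite E Rintegral_triangle//; last exact: ik.
rewrite -mulN1r -RintegralZl//; last by apply: integrable_segment_mul => //; exact: ik.
apply: eq_Rintegral => y; rewrite mem_setE => yab.
by rewrite C1_FTC2// ?(itvP yab)// phib sub0r mulrN mulN1r.
Qed.

End Primitives.

Section DuBoisReymond.
Variable R : realType.
Local Notation leb := (@lebesgue_measure R).
Implicit Types (D : set R) (p q phi psi : R -> R).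

Lemma integrable_support psi (a b : R) : continuous psi ->
  (forall x, x \notin `[a, b] -> psi x = 0) ->
  leb.-integrable setT (EFin \o psi).
Proof.
move=> cpsi psi0; rewrite (_ : psi = psi \_ `[a, b]).
  apply: integrable_patch.
  by apply: (@continuous_segment_integrable _ setT); [exact: cpsi|exact: subsetT].
apply/funext => x; rewrite patchE mem_setE; case: ifPn => // xab.
by rewrite psi0.
Qed.

(** Integration from minus infinity gives one formula that can be differentiated at every point of
    the line. *)
Lemma compact_antiderivative psi (a b : R) : continuous psi ->
  (forall x, x \notin `[a, b] -> psi x = 0) ->
  let phi x := \int[leb]_(t in [set` `]-oo, x]]) psi t in
  (forall x, derivable phi x 1) /\ derive1 phi = psi.
Proof.
move=> cpsi psi0 phi; have ipsi := integrable_support cpsi psi0.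
have dphi x : derivable phi x 1 /\ derive1 phi x = psi x.
  have := @continuous_FTC1 R psi -oo%O x (x + 1).
  rewrite ltrDl ltr01 => /(_ isT); apply; last exact: cpsi.
    exact: integrableS ipsi.
  by rewrite ltNyr.
by split=> [x|]; [|apply/funext => x]; have [] := dphi x.
Qed.

(** The vanishing mean is what makes the antiderivative vanish again to the right of [b]. *)
Lemma C1c_primitive D psi (a b : R) : continuous psi -> [set` `[a, b]] `<=` D ->
  (forall x, x \notin `[a, b] -> psi x = 0) ->
  \int[leb]_(x in `[a, b]) psi x = 0 ->
  exists2 phi, C1c D phi & derive1 phi = psi.
Proof.
move=> cpsi abD psi0 int0; have [] := compact_antiderivative cpsi psi0.
set phi := (X in derive1 X) => dphi E.
exists phi; last exact: E.
split; [exact: dphi|by rewrite E|].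
exists a, b; split=> // x; rewrite in_itv/= negb_and -!ltNge => xab.
rewrite /phi; have [xa|ax] := ltP x a.
  under eq_Rintegral.
    move=> t; rewrite mem_setE in_itv/= => tx; rewrite psi0; last first.
      by rewrite in_itv/= negb_and -ltNge (le_lt_trans tx xa).
    over.
  by rewrite /Rintegral integral0.
move: xab; rewrite ltNge ax/= => bx.
rewrite (@Rintegral_support _ _ a b)//.
by move=> t /=; rewrite !in_itv/= => /andP[_ tb]; rewrite (le_trans tb)// ltW.
Qed.

(** Continuous approximations, with slope [n], of the indicator of []a, b[]. The case [n = 1] later
    serves as a plateau function. *)
Definition trapezoid (a b : R) (n : nat) (x : R) : R :=
  Num.min 1 (n%:R * Num.max 0 (Num.min (x - a) (b - x))).

Lemma trapezoid_continuous a b n : continuous (trapezoid a b n).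
Proof.
move=> x; rewrite /trapezoid.
have c1 : {for x, continuous (fun x : R => x - a)} by apply: cvgB => //; exact: cvg_cst.
have c2 : {for x, continuous (fun x : R => b - x)} by apply: cvgB => //; exact: cvg_cst.
have c3 : {for x, continuous ((fun x : R => x - a) \min (fun x : R => b - x))}.
  exact: continuous_min.
have c4 : {for x, continuous ((cst 0 : R -> R) \max
    ((fun x : R => x - a) \min (fun x : R => b - x)))}.
  by apply: continuous_max => //; exact: cvg_cst.
have c5 : {for x, continuous (fun y => n%:R * ((cst 0 : R -> R) \max
    ((fun x : R => x - a) \min (fun x : R => b - x))) y)}.
  by apply: cvgM => //; exact: cvg_cst.
have c6 : {for x, continuous (cst 1 : R -> R)} by exact: cvg_cst.
exact: (continuous_min c6 c5).
Qed.

Lemma trapezoid_support a b n x : x \notin `[a, b] -> trapezoid a b n x = 0.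
Proof.
rewrite in_itv/= negb_and -!ltNge => xab.
have h : Num.min (x - a) (b - x) <= 0.
  by rewrite ge_min !subr_le0; case/orP: xab => /ltW ->; rewrite ?orbT.
by rewrite /trapezoid (max_l h) mulr0 min_r.
Qed.

Lemma trapezoid01 a b n x : 0 <= trapezoid a b n x <= 1.
Proof.
by rewrite /trapezoid le_min ler01 ge_min lexx/= mulr_ge0// le_max lexx.
Qed.

Lemma trapezoid_cvg a b x : x \in `]a, b[ -> trapezoid a b n x @[n --> \oo] --> (1 : R).
Proof.
rewrite in_itv/= => /andP[ax xb]; apply: cvg_near_cst.
set m := Num.max 0 (Num.min (x - a) (b - x)).
have m0 : 0 < m by rewrite lt_max lt_min !subr_gt0 ax xb orbT.
exists (Num.truncn m^-1).+1 => // n /= hn; rewrite /trapezoid min_l//.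
rewrite -/m -ler_pdivrMr// div1r; apply: (@le_trans _ _ (Num.truncn m^-1).+1%:R).
  by rewrite ltW// truncnS_gt.
by rewrite ler_nat.
Qed.

(** Dominated convergence for [psi = trapezoid a b n]. The open interval is used because the
    trapezoids vanish at the end points. *)
Lemma segment_integral0 q (a b : R) : leb.-integrable `[a, b] (EFin \o q) ->
  (forall psi, continuous psi -> (forall x, x \notin `[a, b] -> psi x = 0) ->
    \int[leb]_(x in `[a, b]) (q x * psi x) = 0) ->
  \int[leb]_(x in `[a, b]) q x = 0.
Proof.
move=> iq h.
have iq' : leb.-integrable `]a, b[ (EFin \o q).
  by apply: integrableS iq => //; exact: subset_itv_oo_cc.
have mq : measurable_fun `]a, b[ q.
  by apply/measurable_EFinP; exact: measurable_int iq'.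
have h' psi : continuous psi -> (forall x, x \notin `[a, b] -> psi x = 0) ->
    (\int[leb]_(x in `]a, b[) (q x * psi x)%:E = 0)%E.
  move=> cpsi psi0; have i1 := integrable_segment_mul iq cpsi.
  rewrite -(@integral_itv_bndoo _ _ _ _ true false)/=.
    by rewrite integral_EFin_Rintegral// h.
  apply: (@measurable_int _ _ _ leb).
  by apply: integrableS i1 => //; exact: subset_itv_oo_cc.
have [_ _ cv] : [/\ leb.-integrable `]a, b[ (EFin \o q),
    [sequence \int[leb]_(x in `]a, b[) `|(q x * trapezoid a b n x)%:E - (q x)%:E| ]_n @ \oo --> 0 &
    [sequence \int[leb]_(x in `]a, b[) (q x * trapezoid a b n x)%:E]_n @ \oo -->
      \int[leb]_(x in `]a, b[) (q x)%:E]%E.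
  apply: (@dominated_convergence _ _ R leb `]a, b[ _ _ _ (abse \o (EFin \o q))) => //.
  - move=> n; apply/measurable_EFinP; apply: measurable_funM => //.
    apply: measurable_funTS; apply: continuous_measurable_fun.
    exact: trapezoid_continuous.
  - exact/measurable_EFinP.
  - apply: ae_all => x xab; apply: cvg_EFin; first exact: nearW.
    rewrite -[X in _ --> X]mulr1; apply: cvgM; first exact: cvg_cst.
    exact: trapezoid_cvg.
  - exact: integrable_abse.
  - apply: ae_all => x n _ /=; rewrite lee_fin normrM.
    have /andP[t0 t1] := trapezoid01 a b n x.
    by rewrite (ger0_norm t0) ler_piMr.
have e0 : (\int[leb]_(x in `]a, b[) (q x)%:E = 0)%E.
  apply: (@cvg_unique _ (@ereal_hausdorff R) _ _ _ _ cv).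
  rewrite (_ : [sequence _]_n = cst 0%E); first exact: cvg_cst.
  apply/funext => n /=; apply: h'; first exact: trapezoid_continuous.
  by move=> x; exact: trapezoid_support.
rewrite /Rintegral (@integral_itv_bndoo _ _ _ _ true false) ?e0//.
exact/measurable_EFinP.
Qed.

(** On a segment in [D] the primitive of [q] is locally zero, and by Lebesgue differentiation its
    derivative is [q] almost everywhere. Countably many segments with rational ends suffice to cover
    [D]. *)
Lemma ae_zero_open D q : open D -> segment_integrable D q ->
  (forall a b, [set` `[a, b]] `<=` D -> \int[leb]_(x in `[a, b]) q x = 0) ->
  {ae leb, forall x, D x -> q x = 0}.
Proof.
move=> oD iq q0.
have key (a b : R) : [set` `[a, b]] `<=` D -> {ae leb, forall x, x \in `]a, b[ -> q x = 0}.
  move=> abD; pose r := q \_ `[a, b].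
  have ir : leb.-integrable setT (EFin \o r) by apply: integrable_patch; exact: iq.
  have locr : locally_integrable setT r.
    by apply: integrable_locally => //; exact: iq.
  have := @FTC1 R r (BLeft a) _ locr.
  have hr y : leb.-integrable [set` Interval (BLeft a) (BRight y)] (EFin \o r).
    exact: integrableS ir.
  move=> /(_ hr) /= H; apply: (ae_impl2 _ H H) => x Hx _ xab.
  have /andP[ax xb] : a < x < b by rewrite in_itv in xab.
  have [|_] := Hx _; first by rewrite lte_fin.
  set F := (X in (derive1 X x = _) -> _) => Fx.
  have : derive1 F x = 0.
    rewrite derive1E; transitivity ('D_1 (cst 0 : R -> R) x); last exact: derive_cst.
    apply: near_eq_derive; near=> y.
    have yab : y \in `]a, b[ by near: y; exact: near_in_itvoo.
    rewrite /F /= /r; transitivity (\int[leb]_(t in `[a, y]) q t).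
      apply: eq_Rintegral => t; rewrite mem_setE in_itv/= => /andP[at_ ty].
      rewrite patchE mem_setE in_itv/= at_ /= ifT// (le_trans ty)//.
      by rewrite (itvP yab).
    apply: q0; apply: subset_trans abD; apply: subset_itvl.
    by rewrite bnd_simp (itvP yab).
  rewrite Fx /r patchE mem_setE ifT//.
  by rewrite in_itv/= !ltW.
(* Pairs of rationals are enumerated by [unpickle], so that the exceptional null sets are indexed by
   [nat] and can be united. *)
pose P n x := if unpickle n is Some (s, t) then
  [set` `[ratr s : R, ratr t : R]] `<=` D -> x \in `]ratr s, ratr t[ -> q x = 0 else True.
have : forall n, {ae leb, forall x, P n x}.
  move=> n; rewrite /P; case: (unpickle n : option (rat * rat)) => [[s t]|]; last exact: ae_all.
  have [h|h] := pselect ([set` `[ratr s : R, ratr t : R]] `<=` D); last exact: ae_all.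
  by have k := key _ _ h; apply: (ae_impl2 _ k k) => x hx _ _.
move=> /ae_foralln H; apply: (ae_impl2 _ H H) => x {}H _ Dx.
have : nbhs x D by exact: open_nbhs_nbhs.
move=> /nbhs_ballP[e /= e0 he].
have [s] : exists s : rat, ratr s \in `](x - e), x[ by apply: rat_in_itvoo; lra.
have [t] : exists t : rat, ratr t \in `]x, (x + e)[ by apply: rat_in_itvoo; lra.
rewrite !in_itv/= => /andP[xt te] /andP[es sx].
have := H (pickle (s, t)); rewrite /P pickleK; apply; last by rewrite in_itv/= sx xt.
move=> y /=; rewrite in_itv/= => /andP[sy yt]; apply: he.
by rewrite /ball/= ltr_distlC; apply/andP; split; lra.
Unshelve. all: by end_near. Qed.

(** Fix [psi0] with integral 1. For every continuous compactly supported [psi], the function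
    [psi - s psi0] with [s] the integral of [psi] has mean zero, hence is the derivative of a test
    function. So [p - c] annihilates [psi], where [c] is the integral of [p psi0]. *)
Lemma du_bois_reymond D p : open D -> is_interval D -> D !=set0 ->
  real_weak_derivative D p (cst 0) -> exists c, {ae leb, forall x, D x -> p x = c}.
Proof.
move=> oD iD [x0 Dx0] wp; have [ip _ _] := wp.
have : nbhs x0 D by exact: open_nbhs_nbhs.
move=> /nbhs_ballP[e /= e0 he].
pose a0 := x0 - e / 2; pose b0 := x0 + e / 2.
have ab0 : a0 < b0 by rewrite /a0 /b0; lra.
have abD0 : [set` `[a0, b0]] `<=` D.
  move=> y /=; rewrite in_itv/= /a0 /b0 => /andP[ay yb]; apply: he.
  by rewrite /ball/= ltr_distlC; apply/andP; split; lra.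
have int1 (a b : R) psi : continuous psi -> leb.-integrable `[a, b] (EFin \o psi).
  by move=> h; apply: (@continuous_segment_integrable _ setT); [exact: h|exact: subsetT].
(* If every such function had integral 0, [segment_integral0] for the constant 1 would make the
   length of the segment vanish. *)
have [psi1 [cpsi1 psi10 m0]] : exists psi1, [/\ continuous psi1,
    (forall x, x \notin `[a0, b0] -> psi1 x = 0) &
    \int[leb]_(x in `[a0, b0]) psi1 x != 0].
  apply: contrapT => /forallNP h.
  have : \int[leb]_(x in `[a0, b0]) (cst 1 : R -> R) x = 0.
    apply: segment_integral0; first by apply: int1; exact: cst_continuous.
    move=> psi cpsi psi0; apply/eqP/negPn/negP => n0; apply: (h psi); split=> //.
    by move: n0; under eq_Rintegral do rewrite mul1r.
  rewrite Rintegral_cst//= mul1r lebesgue_measure_itv/= lte_fin ab0 -EFinD/= => /eqP.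
  by rewrite subr_eq0 gt_eqF.
set m := \int[leb]_(x in _) _ in m0.
pose psi0 x := m^-1 * psi1 x.
have cpsi0 : continuous psi0.
  by move=> x; apply: cvgM; [exact: cvg_cst|exact: cpsi1].
have psi00 x : x \notin `[a0, b0] -> psi0 x = 0.
  by move=> xab; rewrite /psi0 psi10// mulr0.
have ipsi0 : \int[leb]_(x in `[a0, b0]) psi0 x = 1.
  by rewrite /psi0 RintegralZl ?mulVf//; exact: int1.
pose c := \int[leb]_(x in `[a0, b0]) (p x * psi0 x).
exists c; suff : {ae leb, forall x, D x -> p x - c = 0}.
  move=> H; apply: (ae_impl2 _ H H) => x + _ Dx => /(_ Dx) /eqP.
  by rewrite subr_eq0 => /eqP.
have ipc : segment_integrable D (fun x => p x - c).
  have c1 : continuous (cst 1 : R -> R) by exact: cst_continuous.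
  have := segment_integrable_lin 1 (- c) ip
    (@continuous_segment_integrable _ D _ c1) => h a b /h.
  by apply: eq_integrable => // x _ /=; rewrite mul1r mulr1.
apply: ae_zero_open => // a b abD.
have [ab|ba] := leP a b; last by rewrite set_itv_ge ?Rintegral_set0// bnd_simp -ltNge.
apply: segment_integral0 => [|psi cpsi psi_0]; first exact: ipc.
(* The hull of both supports; it lies in [D] because [D] is an interval. *)
pose A := Num.min a a0; pose B := Num.max b b0.
have abAB : [set` `[a, b]] `<=` `[A, B].
  by apply: subset_itv; rewrite bnd_simp ?ge_min ?le_max lexx.
have abAB0 : [set` `[a0, b0]] `<=` `[A, B].
  by apply: subset_itv; rewrite bnd_simp ?ge_min ?le_max lexx orbT.
have ABD : [set` `[A, B]] `<=` D.
  have DA : D A.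
    by rewrite /A; case: leP => _; [apply: abD|apply: abD0]; rewrite /= in_itv/= lexx// ltW.
  have DB : D B.
    by rewrite /B; case: leP => _; [apply: abD0|apply: abD]; rewrite /= in_itv/= lexx ?andbT// ltW.
  by move=> y /=; rewrite in_itv/=; exact: iD.
pose s := \int[leb]_(x in `[a, b]) psi x.
pose chi x := 1 * psi x + (- s) * psi0 x.
have cchi : continuous chi.
  by move=> x; apply: cvgD; apply: cvgM; first [exact: cvg_cst|exact: cpsi|exact: cpsi0].
have outside x : x \notin `[A, B] -> psi x = 0 /\ psi0 x = 0.
  move=> xAB; split; [apply: psi_0|apply: psi00]; apply: contra xAB => h.
    exact: abAB.
  exact: abAB0.
have chi0 x : x \notin `[A, B] -> chi x = 0.
  by move=> /outside[h1 h2]; rewrite /chi h1 h2 !mulr0 addr0.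
have intAB psi' : (forall x, x \notin `[a, b] -> psi' x = 0) ->
    \int[leb]_(x in `[A, B]) psi' x = \int[leb]_(x in `[a, b]) psi' x.
  exact: Rintegral_support.
have intAB0 psi' : (forall x, x \notin `[a0, b0] -> psi' x = 0) ->
    \int[leb]_(x in `[A, B]) psi' x = \int[leb]_(x in `[a0, b0]) psi' x.
  exact: Rintegral_support.
have int_chi : \int[leb]_(x in `[A, B]) chi x = 0.
  rewrite Rintegral_lin; [|exact: int1..].
  by rewrite intAB// intAB0// ipsi0 mul1r mulr1 subrr.
have [phi Cphi phi'] := C1c_primitive cchi ABD chi0 int_chi.
have [_ _ /(_ _ Cphi)] := wp; rewrite phi'.
under [X in _ = - X]eq_Rintegral do rewrite mul0r.
rewrite [X in _ = - X]/Rintegral integral0 oppr0.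
rewrite (@Rintegral_support _ D A B)//; last by move=> x xAB; rewrite chi0// mulr0.
have I psi' : continuous psi' ->
    leb.-integrable `[A, B] (EFin \o (fun x => p x * psi' x)).
  by move=> h; apply: integrable_segment_mul => //; exact: ip.
rewrite (_ : \int[leb]_(x in `[A, B]) (p x * chi x) =
    \int[leb]_(x in `[A, B]) (1 * (p x * psi x) + - s * (p x * psi0 x))); last first.
  by apply: eq_Rintegral => x _; rewrite /chi; ring.
rewrite Rintegral_lin; [|exact: I..].
rewrite intAB; last by move=> x xab; rewrite psi_0// mulr0.
rewrite intAB0; last by move=> x xab; rewrite psi00// mulr0.
rewrite -/c mul1r => e1.
have -> : \int[leb]_(x in `[a, b]) ((p x - c) * psi x) =
    \int[leb]_(x in `[a, b]) (1 * (p x * psi x) + (- c) * psi x).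
  by apply: eq_Rintegral => x _; ring.
rewrite Rintegral_lin; last 2 first.
- by apply: integrable_segment_mul => //; exact: ip.
- exact: int1.
by rewrite -e1 -/s; ring.
Qed.

End DuBoisReymond.

(** * Square-integrable complex functions *)

Section SquareIntegrable.
Variable R : realType.
Local Notation leb := (@lebesgue_measure R).
Local Notation C := R[i].
Implicit Types (D : set R) (p : R -> R) (u v : R -> C).

Lemma Lfun2P p : p \in Lfun leb 2%:E <->
  measurable_fun setT p /\ leb.-integrable setT (EFin \o (fun x => p x ^+ 2)).
Proof.
split=> [hp|[mp ip]].
  split; last exact: Lfun2_integrable_sqr.
  by move: hp; rewrite inE => /andP[/[!inE]/=].
rewrite inE; apply/andP; split; rewrite inE//= /finite_norm unlock/=.
apply: poweR_lty; have /integrableP[_] := ip; congr (_ < _)%E.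
apply: eq_integral => x _ /=; congr EFin.
by rewrite powR_mulrn// ger0_norm ?sqr_ge0// real_normK ?num_real.
Qed.

Lemma square_integrableP u : u \in @square_integrable R <->
  [/\ measurable_fun setT (fun x => Re (u x)), measurable_fun setT (fun x => Im (u x)) &
      leb.-integrable setT (EFin \o (fun x => cabs2 (u x)))].
Proof.
split=> [/andP[/Lfun2P[mr ir] /Lfun2P[mi ii]]|[mr mi iu]].
  by split=> //; have := rintegrableD ir ii.
apply/andP; split; apply/Lfun2P; split=> //; apply: le_integrable iu => //.
- by apply/measurable_EFinP; exact: measurable_funX.
- by move=> x _ /=; rewrite lee_fin !ger0_norm ?cabs2_ge0 ?sqr_ge0// lerDl sqr_ge0.
- by apply/measurable_EFinP; exact: measurable_funX.
- by move=> x _ /=; rewrite lee_fin !ger0_norm ?cabs2_ge0 ?sqr_ge0// lerDr sqr_ge0.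
Qed.

Lemma square_integrable_on_lin D u v (a : C) : square_integrable_on D u ->
  square_integrable_on D v -> square_integrable_on D (fun x => a * u x + v x).
Proof.
move=> hu hv; have [_ h] := square_integrable_submod_closed R.
rewrite /square_integrable_on (_ : patch _ _ _ =
  a *: patch (cst 0) D u + patch (cst 0) D v); first exact: h.
apply/funext => x; rewrite -[RHS]/(a * patch _ D u x + patch _ D v x) /patch.
by case: ifP => // _; rewrite mulr0 addr0.
Qed.

Lemma square_integrable_onT u : square_integrable_on setT u <-> u \in @square_integrable R.
Proof.
by rewrite /square_integrable_on (_ : patch _ _ _ = u)//; apply/funext => x; rewrite /patch in_setT.
Qed.

Lemma square_integrable_onW D u : measurable D -> u \in @square_integrable R ->
  square_integrable_on D u.
Proof.
move=> mD /square_integrableP[mr mi iu]; apply/square_integrableP; split.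
- rewrite (_ : (fun x => _) = (fun x => Re (u x)) \_ D).
    by apply/(measurable_restrictT _ mD); exact: measurable_funTS.
  by apply/funext => x; rewrite /patch; case: ifP.
- rewrite (_ : (fun x => _) = (fun x => Im (u x)) \_ D).
    by apply/(measurable_restrictT _ mD); exact: measurable_funTS.
  by apply/funext => x; rewrite /patch; case: ifP.
- rewrite (_ : _ \o _ = (EFin \o (fun x => cabs2 (u x))) \_ D).
    have iD : leb.-integrable D (EFin \o (fun x => cabs2 (u x))) by exact: integrableS iu.
    exact: (proj1 (@integrable_mkcond _ _ _ leb D (EFin \o (fun x => cabs2 (u x))) mD) iD).
  apply/funext => x; rewrite /= /patch; case: ifP => // _.
  by rewrite /cabs2/= expr0n addr0.
Qed.

Lemma square_integrable_on_segment D u : square_integrable_on D u ->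
  segment_integrable D (fun x => Re (u x)) /\ segment_integrable D (fun x => Im (u x)).
Proof.
move=> /andP[/Lfun2P[mr ir] /Lfun2P[mi ii]].
have key (p : R -> R) : measurable_fun setT p ->
    leb.-integrable setT (EFin \o (fun x => p x ^+ 2)) ->
    forall a b : R, leb.-integrable `[a, b] (EFin \o p).
  move=> mp ip a b.
  have c1 : continuous (cst 1 : R -> R) by exact: cst_continuous.
  have ip' : leb.-integrable `[a, b] (EFin \o (fun x => p x ^+ 2)).
    by apply: integrableS ip => //; exact: subsetT.
  (* [|p| <= 1 + p ^+ 2], and the constant 1 is integrable on a segment. *)
  have := integrable_segmentD (@continuous_segment_integrable _ setT _ c1 a b (@subsetT _ _)) ip'.
  apply: le_integrable => //.
    by apply/measurable_EFinP; exact: measurable_funTS.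
  move=> x _ /=; rewrite lee_fin [leRHS]ger0_norm ?addr_ge0 ?sqr_ge0//.
  by rewrite -(real_normK (num_real (p x))); have := normr_ge0 (p x); nra.
split=> a b abD.
  apply: eq_integrable (key _ mr ir a b) => // x.
  by rewrite mem_setE => xab /=; rewrite /patch mem_set//; exact: abD.
apply: eq_integrable (key _ mi ii a b) => // x.
by rewrite mem_setE => xab /=; rewrite /patch mem_set//; exact: abD.
Qed.

(** The tool that excludes growing exponentials: a positive lower bound on a set of infinite measure
    has infinite integral. *)
Lemma square_integrable_on_bounded_below D (S : set R) u (c : R) :
  measurable S -> leb S = +oo%E -> S `<=` D -> 0 <= c ->
  {ae leb, forall x, S x -> c <= cabs2 (u x)} ->
  square_integrable_on D u -> c = 0.
Proof.
move=> mS S8 SD c0 cu /square_integrableP[_ _ iu].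
apply/eqP/negPn/negP => cn0; have cp : 0 < c by rewrite lt_neqAle eq_sym cn0.
have mu' := measurable_int _ iu.
have /integrableP[_] := iu; apply/negP; rewrite -leNgt.
set f := (EFin \o _) in mu' *.
have f0 x : (0 <= f x)%E by rewrite lee_fin cabs2_ge0.
apply: (@le_trans _ _ (\int[leb]_(x in S) (cst c%:E x))%E).
  by rewrite integral_cst// (_ : _ S = +oo%E)// mulr_infty gtr0_sg// mul1e.
apply: (@le_trans _ _ (\int[leb]_(x in S) `|f x|)%E).
  apply: ae_ge0_le_integral => //.
  - by apply: measurable_funTS; exact: measurableT_comp.
  - have H := cu; apply: (ae_impl2 _ H H) => x + _ Sx => /(_ Sx) h.
    by rewrite gee0_abs// lee_fin /patch mem_set//; exact: SD.
apply: ge0_subset_integral => //.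
exact: measurableT_comp.
Qed.

End SquareIntegrable.

(** * Exponentials and equations with constant coefficients *)

Section ComplexExponential.
Variable R : realType.
Local Notation C := R[i].
Implicit Types (a b z : C) (x : R).

Definition cwave a x : C := cexp (a * x%:C).

Lemma cexpD z a : cexp (z + a) = cexp z * cexp a.
Proof.
rewrite /cexp cReD cImD expRD cosD sinD.
apply: complex_eq; rewrite !(cReM, cImM) /=; ring.
Qed.

Lemma cexp0 : cexp 0 = 1 :> C.
Proof. by rewrite /cexp /= expR0 cos0 sin0 mul1r. Qed.

Lemma cwaveD a b x : cwave (a + b) x = cwave a x * cwave b x.
Proof. by rewrite /cwave mulrDl cexpD. Qed.

Lemma cwaveN a x : cwave (- a) x * cwave a x = 1.
Proof. by rewrite -cwaveD addNr /cwave mul0r cexp0. Qed.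

Lemma cwave0 a : cwave a 0 = 1.
Proof. by rewrite /cwave mulr0 cexp0. Qed.

Lemma Re_cwave a x : Re (cwave a x) = expR (Re a * x) * cos (Im a * x).
Proof. by rewrite /cwave /cexp !(cReM, cImM) /= !mulr0 !mul0r ?subr0 ?add0r ?addr0. Qed.

Lemma Im_cwave a x : Im (cwave a x) = expR (Re a * x) * sin (Im a * x).
Proof. by rewrite /cwave /cexp !(cReM, cImM) /= !mulr0 !mul0r ?subr0 ?add0r ?addr0. Qed.

Lemma cabs2_cwave a x : cabs2 (cwave a x) = expR (2 * Re a * x).
Proof.
rewrite /cabs2 Re_cwave Im_cwave !exprMn -mulrDr cos2Dsin2 mulr1.
by rewrite -expRM_natl mulrA.
Qed.

Lemma is_derive_linear (k x : R) : is_derive x 1 (fun y : R => k * y) k.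
Proof.
have -> : (fun y : R => k * y) = k *: (id : R -> R) by [].
by have := is_deriveZ k (is_derive_id x 1); rewrite -[X in is_derive _ _ _ X]/(k * 1) mulr1.
Qed.

Lemma is_derive_Re_cwave a x : is_derive x 1 (fun y => Re (cwave a y)) (Re (a * cwave a x)).
Proof.
rewrite (_ : (fun y => _) = (expR \o (fun y => Re a * y)) * (cos \o (fun y => Im a * y))); last first.
  by apply/funext => y; rewrite Re_cwave.
have h1 := is_derive1_comp (is_derive_expR (Re a * x)) (is_derive_linear (Re a) x).
have h2 := is_derive1_comp (is_derive_cos (Im a * x)) (is_derive_linear (Im a) x).
have h := is_deriveM h1 h2.
apply: is_derive_eq h _; rewrite cReM Re_cwave Im_cwave /=.
rewrite -[_ *: _]/(_ * _) -[X in _ + X]/(_ * _); ring.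
Qed.

Lemma is_derive_Im_cwave a x : is_derive x 1 (fun y => Im (cwave a y)) (Im (a * cwave a x)).
Proof.
rewrite (_ : (fun y => _) = (expR \o (fun y => Re a * y)) * (sin \o (fun y => Im a * y))); last first.
  by apply/funext => y; rewrite Im_cwave.
have h1 := is_derive1_comp (is_derive_expR (Re a * x)) (is_derive_linear (Re a) x).
have h2 := is_derive1_comp (is_derive_sin (Im a * x)) (is_derive_linear (Im a) x).
have h := is_deriveM h1 h2.
apply: is_derive_eq h _; rewrite cImM Re_cwave Im_cwave /=.
rewrite -[_ *: _]/(_ * _) -[X in _ + X]/(_ * _); ring.
Qed.

Lemma cwave_continuous a : continuous (fun x => Re (cwave a x)) /\
  continuous (fun x => Im (cwave a x)).
Proof.
split=> x; apply/differentiable_continuous/derivable1_diffP.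
  by have [] := is_derive_Re_cwave a x.
by have [] := is_derive_Im_cwave a x.
Qed.

End ComplexExponential.

Section ComplexWeakDerivative.
Variable R : realType.
Local Notation leb := (@lebesgue_measure R).
Local Notation C := R[i].
Implicit Types (D : set R) (u v w : R -> C) (a b c : C).

Definition complex_weak_derivative D u v : Prop :=
  real_weak_derivative D (fun x => Re (u x)) (fun x => Re (v x)) /\
  real_weak_derivative D (fun x => Im (u x)) (fun x => Im (v x)).

Lemma Re_cintegral D u : Re (cintegral D u) = \int[leb]_(x in D) Re (u x).
Proof. by []. Qed.

Lemma Im_cintegral D u : Im (cintegral D u) = \int[leb]_(x in D) Im (u x).
Proof. by []. Qed.

Lemma weak_derivativeP D u v : weak_derivative D u v <->
  [/\ square_integrable_on D u, square_integrable_on D v & complex_weak_derivative D u v].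
Proof.
have E (z : C) (r : R) : Re (z * r%:C) = Re z * r by rewrite cReM/= mulr0 subr0.
have E' (z : C) (r : R) : Im (z * r%:C) = Im z * r by rewrite cImM/= mulr0 add0r.
split=> [[hu hv h]|[hu hv [[_ _ hr] [_ _ hi]]]].
  have [ur ui] := square_integrable_on_segment hu.
  have [vr vi] := square_integrable_on_segment hv.
  split=> //; split; split=> // phi /h.
    move=> /(congr1 (@Re R)); rewrite cReN !Re_cintegral.
    by under eq_Rintegral do rewrite E; under [in X in _ = - X -> _]eq_Rintegral do rewrite E.
  move=> /(congr1 (@Im R)); rewrite cImN !Im_cintegral.
  by under eq_Rintegral do rewrite E'; under [in X in _ = - X -> _]eq_Rintegral do rewrite E'.
split=> // phi Cphi; apply: complex_eq.
  rewrite cReN !Re_cintegral.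
  under eq_Rintegral do rewrite E; under [in RHS]eq_Rintegral do rewrite E.
  exact: hr.
rewrite cImN !Im_cintegral.
under eq_Rintegral do rewrite E'; under [in RHS]eq_Rintegral do rewrite E'.
exact: hi.
Qed.

Lemma real_weak_derivative_ext D (p q p' q' : R -> R) :
  p =1 p' -> q =1 q' -> real_weak_derivative D p q -> real_weak_derivative D p' q'.
Proof. by move=> /funext-> /funext->. Qed.

Lemma real_weak_derivative_ae D (p q q' : R -> R) :
  real_weak_derivative D p q -> segment_integrable D q' ->
  {ae leb, forall x, D x -> q x = q' x} -> real_weak_derivative D p q'.
Proof.
move=> wp iq' qq'; have [ip iq h] := wp; split=> // phi Cphi.
rewrite h//; congr (- _).
have [a [b [abD phi0 phi'0]]] := C1c_support Cphi.
have cphi := C1c_continuous Cphi.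
rewrite !(@Rintegral_support _ D a b)//; [|by move=> x xab; rewrite phi0// mulr0..].
congr fine; apply: ae_eq_integral => //.
- by apply: (measurable_int leb); apply: integrable_segment_mul => //; exact: iq.
- by apply: (measurable_int leb); apply: integrable_segment_mul => //; exact: iq'.
- apply: (ae_impl2 _ qq' qq') => x + _ xab => /(_ (abD _ xab)) -> //.
Qed.

Lemma complex_weak_derivative_lin D u v u' v' a b :
  complex_weak_derivative D u v -> complex_weak_derivative D u' v' ->
  complex_weak_derivative D (fun x => a * u x + b * u' x) (fun x => a * v x + b * v' x).
Proof.
move=> [ur ui] [ur' ui']; split.
  have h1 := real_weak_derivative_lin (Re a) (- Im a) ur ui.
  have h2 := real_weak_derivative_lin (Re b) (- Im b) ur' ui'.
  have := real_weak_derivative_lin 1 1 h1 h2.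
  by apply: real_weak_derivative_ext => x; rewrite cReD !cReM; ring.
have h1 := real_weak_derivative_lin (Re a) (Im a) ui ur.
have h2 := real_weak_derivative_lin (Re b) (Im b) ui' ur'.
have := real_weak_derivative_lin 1 1 h1 h2.
by apply: real_weak_derivative_ext => x; rewrite cImD !cImM; ring.
Qed.

Lemma complex_weak_derivative_ext D u v u' v' : u =1 u' -> v =1 v' ->
  complex_weak_derivative D u v -> complex_weak_derivative D u' v'.
Proof. by move=> /funext-> /funext->. Qed.

Lemma complex_weak_derivative_ae D u v v' w : complex_weak_derivative D u v ->
  complex_weak_derivative D v' w ->
  {ae leb, forall x, D x -> v x = v' x} -> complex_weak_derivative D u v'.
Proof.
move=> [ur ui] [[ir _ _] [ii _ _]] vv'; split.
  by apply: real_weak_derivative_ae ur ir _; apply: (ae_impl2 _ vv' vv') => x + _ Dx => ->.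
by apply: real_weak_derivative_ae ui ii _; apply: (ae_impl2 _ vv' vv') => x + _ Dx => ->.
Qed.

Lemma complex_weak_derivative_cwave_mul D u v a : complex_weak_derivative D u v ->
  complex_weak_derivative D (fun x => cwave a x * u x)
    (fun x => cwave a x * v x + a * cwave a x * u x).
Proof.
have dr x := is_derive_Re_cwave a x; have di x := is_derive_Im_cwave a x.
have [cr ci] := cwave_continuous a.
have dr1 x : derivable (fun x => Re (cwave a x)) x 1 by have [] := dr x.
have di1 x : derivable (fun x => Im (cwave a x)) x 1 by have [] := di x.
have Er : derive1 (fun x => Re (cwave a x)) = (fun x => Re (a * cwave a x)).
  by apply/funext => x; rewrite derive1E; exact: derive_val.
have Ei : derive1 (fun x => Im (cwave a x)) = (fun x => Im (a * cwave a x)).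
  by apply/funext => x; rewrite derive1E; exact: derive_val.
have cr' : continuous (derive1 (fun x => Re (cwave a x))).
  rewrite Er (_ : (fun x => _) = (fun x => Re a * Re (cwave a x) - Im a * Im (cwave a x))).
    by move=> x; apply: cvgB; (apply: cvgM; [exact: cvg_cst|first [exact: cr|exact: ci]]).
  by apply/funext => x; rewrite cReM.
have ci' : continuous (derive1 (fun x => Im (cwave a x))).
  rewrite Ei (_ : (fun x => _) = (fun x => Re a * Im (cwave a x) + Im a * Re (cwave a x))).
    by move=> x; apply: cvgD; (apply: cvgM; [exact: cvg_cst|first [exact: cr|exact: ci]]).
  by apply/funext => x; rewrite cImM.
move=> [ur ui].
have rr := real_weak_derivative_mul ur dr1 cr'.
have ri := real_weak_derivative_mul ur di1 ci'.
have ir := real_weak_derivative_mul ui dr1 cr'.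
have ii := real_weak_derivative_mul ui di1 ci'.
rewrite Er in rr ir; rewrite Ei in ri ii; split.
  have := real_weak_derivative_lin 1 (-1) rr ii.
  by apply: real_weak_derivative_ext => x; rewrite ?cReD !(cReM, cImM); ring.
have := real_weak_derivative_lin 1 1 ri ir.
by apply: real_weak_derivative_ext => x; rewrite ?cImD !(cReM, cImM); ring.
Qed.

Lemma complex_du_bois_reymond D u : open D -> is_interval D -> D !=set0 ->
  complex_weak_derivative D u (cst 0) ->
  exists c, {ae leb, forall x, D x -> u x = c}.
Proof.
move=> oD iD D0 [ur ui].
have [k hk] := du_bois_reymond oD iD D0 ur.
have [l hl] := du_bois_reymond oD iD D0 ui.
exists (k +i* l); apply: (ae_impl2 _ hk hl) => x h1 h2 Dx.
by apply: complex_eq; [exact: h1|exact: h2].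
Qed.

(** Integrating factor: [cwave (- a) * g] has weak derivative 0, hence is constant. *)
Lemma first_order_solution D g v a : open D -> is_interval D -> D !=set0 ->
  complex_weak_derivative D g v -> {ae leb, forall x, D x -> v x = a * g x} ->
  exists k, {ae leb, forall x, D x -> g x = k * cwave a x}.
Proof.
move=> oD iD D0 gv vg.
have gag : complex_weak_derivative D g (fun x => a * g x).
  have h : complex_weak_derivative D (fun x => a * g x) (fun x => a * v x).
    by apply: complex_weak_derivative_ext (complex_weak_derivative_lin a 0 gv gv) => x; ring.
  exact: complex_weak_derivative_ae gv h vg.
have := complex_weak_derivative_cwave_mul (- a) gag => h.
have {}h : complex_weak_derivative D (fun x => cwave (- a) x * g x) (cst 0).
  by apply: complex_weak_derivative_ext h => x //=; ring.
have [k hk] := complex_du_bois_reymond oD iD D0 h.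
exists k; apply: (ae_impl2 _ hk hk) => x + _ Dx => /(_ Dx) <-.
by rewrite mulrAC cwaveN mul1r.
Qed.

Lemma openRpos : open (@Rpos R). Proof. exact: interval_open. Qed.
Lemma openRneg : open (@Rneg R). Proof. exact: interval_open. Qed.

Lemma itvRpos : is_interval (@Rpos R). Proof. exact: interval_is_interval. Qed.
Lemma itvRneg : is_interval (@Rneg R). Proof. exact: interval_is_interval. Qed.

Lemma Rpos_neq0 : @Rpos R !=set0. Proof. by exists 1; rewrite /Rpos/= in_itv/= ltr01. Qed.
Lemma Rneg_neq0 : @Rneg R !=set0. Proof. by exists (-1); rewrite /Rneg/= in_itv/= ltrN10. Qed.

Lemma lebRpos : leb (@Rpos R) = +oo%E.
Proof. by rewrite /Rpos lebesgue_measure_itv/= ltry. Qed.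

Lemma lebRneg : leb (@Rneg R) = +oo%E.
Proof. by rewrite /Rneg lebesgue_measure_itv/= ltNyr. Qed.

(** On the half-line of growth the modulus of the wave is at least 1, so [cabs2 k] is a lower bound
    there. *)
Lemma growing_wave_pos D g a k : @Rpos R `<=` D -> 0 < Re a ->
  square_integrable_on D g -> {ae leb, forall x, D x -> g x = k * cwave a x} -> k = 0.
Proof.
move=> sD a0 hg gk; apply: cabs2_eq0.
apply: (@square_integrable_on_bounded_below _ D (@Rpos R) g) => //.
- exact: measurable_itv.
- exact: lebRpos.
- exact: cabs2_ge0.
- apply: (ae_impl2 _ gk gk) => x + _ xpos => ->; last exact: sD.
  move: xpos; rewrite /Rpos /= in_itv/= andbT => x0.
  rewrite cabs2M cabs2_cwave ler_peMr ?cabs2_ge0//.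
  by rewrite (le_trans _ (expR_ge1Dx _))// lerDl !mulr_ge0// ltW.
Qed.

Lemma growing_wave_neg D g a k : @Rneg R `<=` D -> Re a < 0 ->
  square_integrable_on D g -> {ae leb, forall x, D x -> g x = k * cwave a x} -> k = 0.
Proof.
move=> sD a0 hg gk; apply: cabs2_eq0.
apply: (@square_integrable_on_bounded_below _ D (@Rneg R) g) => //.
- exact: measurable_itv.
- exact: lebRneg.
- exact: cabs2_ge0.
- apply: (ae_impl2 _ gk gk) => x + _ xneg => ->; last exact: sD.
  move: xneg; rewrite /Rneg /= in_itv/= => x0.
  rewrite cabs2M cabs2_cwave ler_peMr ?cabs2_ge0//.
  rewrite (le_trans _ (expR_ge1Dx _))// lerDl -mulrA mulr_ge0//.
  by rewrite mulr_le0// ltW.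
Qed.

(* [h'' = z^2 h] factors as [(d/dx - z)(h' + z h) = 0]; square integrability on
   a half-line kills the growing factor. *)
Lemma decaying_solution D h w z : open D -> is_interval D ->
  @Rpos R `<=` D -> 0 < Re z -> H2_derivative2 D h w ->
  {ae leb, forall x, D x -> w x = z ^+ 2 * h x} ->
  exists k, {ae leb, forall x, D x -> h x = k * cwave (- z) x}.
Proof.
move=> oD iD sD z0 [v [/weak_derivativeP[sh sv hv] /weak_derivativeP[_ sw vw]]] wh.
have D0 : D !=set0 by have [x hx] := Rpos_neq0; exists x; exact: sD.
have gw := complex_weak_derivative_lin 1 z vw hv.
have [|k hk] := first_order_solution (a := z) oD iD D0 gw.
  by apply: (ae_impl2 _ wh wh) => x + _ Dx => ->//; ring.
have k0 : k = 0.
  apply: growing_wave_pos sD z0 _ hk.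
  have := square_integrable_on_lin z sh sv; congr square_integrable_on.
  by apply/funext => x; rewrite mul1r addrC.
apply: first_order_solution oD iD D0 hv _.
apply: (ae_impl2 _ hk hk) => x + _ Dx => /(_ Dx).
rewrite k0 mul0r mul1r => /eqP; rewrite addr_eq0 => /eqP ->; by rewrite mulNr.
Qed.

Lemma decaying_solution_neg D h w z : open D -> is_interval D ->
  @Rneg R `<=` D -> 0 < Re z -> H2_derivative2 D h w ->
  {ae leb, forall x, D x -> w x = z ^+ 2 * h x} ->
  exists k, {ae leb, forall x, D x -> h x = k * cwave z x}.
Proof.
move=> oD iD sD z0 [v [/weak_derivativeP[sh sv hv] /weak_derivativeP[_ sw vw]]] wh.
have D0 : D !=set0 by have [x hx] := Rneg_neq0; exists x; exact: sD.
have gw := complex_weak_derivative_lin 1 (- z) vw hv.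
have [|k hk] := first_order_solution (a := - z) oD iD D0 gw.
  by apply: (ae_impl2 _ wh wh) => x + _ Dx => ->//; ring.
have k0 : k = 0.
  apply: growing_wave_neg sD _ _ hk; first by rewrite cReN oppr_lt0.
  have := square_integrable_on_lin (- z) sh sv; congr square_integrable_on.
  by apply/funext => x; rewrite mul1r addrC.
apply: first_order_solution oD iD D0 hv _.
apply: (ae_impl2 _ hk hk) => x + _ Dx => /(_ Dx).
by rewrite k0 mul0r mul1r mulNr => /eqP; rewrite subr_eq0 => /eqP.
Qed.

(** The solution [exp (- z x)] that survives at plus infinity grows at minus infinity, so both
    exponentials are excluded. *)
Lemma full_line_solution h w z : 0 < Re z -> H2_derivative2 setT h w ->
  {ae leb, forall x, w x = z ^+ 2 * h x} -> {ae leb, forall x, h x = 0}.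
Proof.
move=> z0 hw wh.
have [||k hk] := decaying_solution openT _ (@subsetT _ _) z0 hw.
- by move=> x y _ _ t _.
- by apply: (ae_impl2 _ wh wh) => x.
have [v [/weak_derivativeP[sh _ _] _]] := hw.
have k0 : k = 0.
  by apply: growing_wave_neg (@subsetT _ _) _ sh hk; rewrite cReN oppr_lt0.
by apply: (ae_impl2 _ hk hk) => x + _ => /(_ I) ->; rewrite k0 mul0r.
Qed.

End ComplexWeakDerivative.

(** * The free resolvent *)

Section ExponentialKernel.
Variable R : realType.
Local Notation leb := (@lebesgue_measure R).
Implicit Types (s t x y : R).

Lemma ge0_integrable (f : R -> R) : measurable_fun setT f -> (forall x, 0 <= f x) ->
  (\int[leb]_x (f x)%:E < +oo)%E -> leb.-integrable setT (EFin \o f).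
Proof.
move=> mf f0 fi; apply/integrableP; split; first exact/measurable_EFinP.
move: fi; congr (_ < _)%E; apply: eq_integral => x _ /=.
by rewrite ger0_norm.
Qed.

(** For [s = Re z] this is the modulus of [exp (- z |x - y|)], the Green function of the line up to
    the factor [1 / (2 z)]. *)
Definition ekernel s x y : R := expR (- s * `|x - y|).

Lemma ekernel_gt0 s x y : 0 < ekernel s x y. Proof. exact: expR_gt0. Qed.

Lemma ekernel_sym s x y : ekernel s x y = ekernel s y x.
Proof. by rewrite /ekernel distrC. Qed.

Lemma ekernel_continuous s x : continuous (ekernel s x).
Proof.
move=> y; apply: (@continuous_comp _ _ _ (fun y : R => - s * `|x - y|) expR); last first.
  exact: continuous_expR.
apply: cvgM; first exact: cvg_cst.
apply: cvg_norm; apply: cvgB => //; exact: cvg_cst.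
Qed.

(** By symmetry the integral is twice that over the half-line, where [s exp (- s x)] is the
    exponential density of total mass 1. *)
Lemma integral_ekernel0 s : 0 < s -> (\int[leb]_x (expR (- s * `|x|))%:E = (2 / s)%:E)%E.
Proof.
move=> s0; rewrite ge0_symfun_integralT; last 3 first.
- by move=> x; exact: expR_ge0.
- move=> y; apply: (@continuous_comp _ _ _ (fun y : R => - s * `|y|) expR); last first.
    exact: continuous_expR.
  by apply: cvgM; [exact: cvg_cst|exact: cvg_norm].
- by move=> x /=; rewrite normrN.
have mE : measurable_fun (`[0, +oo[ : set R) (fun x : R => (expR (- s * `|x|))%:E).
  apply/measurable_EFinP; apply: measurable_funTS; apply: continuous_measurable_fun.
  move=> y; apply: (@continuous_comp _ _ _ (fun y : R => - s * `|y|) expR); last first.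
    exact: continuous_expR.
  by apply: cvgM; [exact: cvg_cst|exact: cvg_norm].
have H := @integral_exponential_pdf R s s0.
have {H} : (\int[leb]_x (((fun x : R => (s%:E * (expR (- s * `|x|))%:E)%E) \_ `[0%R, +oo[) x) = 1)%E.
  rewrite -H; apply: eq_integral => x _.
  rewrite /exponential_pdf !patchE mem_setE in_itv/= andbT; case: ifPn => // x0.
  by rewrite (ger0_norm x0) EFinM.
rewrite -integral_mkcond ge0_integralZl//; last by rewrite lee_fin ltW.
rewrite -set_itvcy; set I := (\int[_]_(x in _) _)%E => sI.
have : (s^-1%:E * (s%:E * I) = (s^-1)%:E)%E by rewrite [(s%:E * I)%E]sI mule1.
by rewrite muleA -EFinM mulVf ?gt_eqF// mul1e => ->; rewrite -EFinM.
Qed.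

Lemma integral_ekernel s x : 0 < s -> (\int[leb]_y (ekernel s x y)%:E = (2 / s)%:E)%E.
Proof.
move=> s0; rewrite -integral_ekernel0//.
pose F y : R := y - x.
have dF y : is_derive y 1 F 1.
  have := is_deriveB (is_derive_id y 1) (is_derive_cst x y 1).
  by rewrite subr0.
have F' : derive1 F = cst 1 by apply/funext => y; rewrite derive1E; exact: derive_val.
rewrite (@increasing_ge0_integration_by_substitutionT _ F (fun y => expR (- s * `|y|))).
- apply: eq_integral => y _; rewrite F'; congr EFin.
  by rewrite -[RHS]/(expR _ * 1) mulr1 /ekernel distrC.
- by move=> y z yz; rewrite ltrD2r.
- by rewrite F'; exact: cst_continuous.
- by rewrite F'; exact: is_cvg_cst.
- by rewrite F'; exact: is_cvg_cst.
- by move=> y; have [] := dF y.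
- by rewrite (_ : F = (fun y => - x + y)); [exact: cvg_addrl_Ny|apply/funext => y; exact: addrC].
- by rewrite (_ : F = (fun y => - x + y)); [exact: cvg_addrl|apply/funext => y; exact: addrC].
- move=> y; apply: (@continuous_comp _ _ _ (fun y : R => - s * `|y|) expR); last first.
    exact: continuous_expR.
  by apply: cvgM; [exact: cvg_cst|exact: cvg_norm].
- by move=> y; exact: expR_ge0.
Qed.

Lemma integrable_ekernel s x : 0 < s -> leb.-integrable setT (EFin \o ekernel s x).
Proof.
move=> s0; apply: ge0_integrable.
- by apply: continuous_measurable_fun; exact: ekernel_continuous.
- by move=> y; rewrite ltW// ekernel_gt0.
- by rewrite integral_ekernel// ltry.
Qed.

Variables (n : R -> R) (s : R).
Hypotheses (s0 : 0 < s) (n0 : forall y, 0 <= n y)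
  (ni : leb.-integrable setT (EFin \o n)).

Definition ekernel_conv x : R := \int[leb]_y (ekernel s x y * n y).

Lemma ekernel_le1 x y : ekernel s x y <= 1.
Proof. by rewrite -expR0 ler_expR mulNr oppr_le0 mulr_ge0// ltW. Qed.

Let mn : measurable_fun setT n.
Proof. by apply/measurable_EFinP; exact: measurable_int ni. Qed.

Lemma integrable_ekernelM x : leb.-integrable setT (EFin \o (fun y => ekernel s x y * n y)).
Proof.
apply: le_integrable ni => //.
  apply/measurable_EFinP; apply: measurable_funM => //.
  apply: continuous_measurable_fun; exact: ekernel_continuous.
move=> y _ /=; rewrite lee_fin !ger0_norm ?mulr_ge0 ?expR_ge0//.
by rewrite ler_piMl// ekernel_le1.
Qed.

Lemma ekernel_conv_ge0 x : 0 <= ekernel_conv x.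
Proof. by apply: Rintegral_ge0 => y _; rewrite mulr_ge0// ltW// ekernel_gt0. Qed.

(** Tonelli: integrating in [x] first gives the mass [2 / s] of the kernel for every [y]. *)
Lemma ekernel_conv_integral : leb.-integrable setT (EFin \o ekernel_conv) /\
  \int[leb]_x ekernel_conv x = 2 / s * \int[leb]_x n x.
Proof.
pose F (z : R * R) : R := ekernel s z.1 z.2 * n z.2.
have F0 z : 0 <= F z by rewrite mulr_ge0// ltW// ekernel_gt0.
have mF : measurable_fun setT (EFin \o F : _ * _ -> _).
  apply/measurable_EFinP; apply: measurable_funM; last first.
    exact: measurableT_comp mn measurable_snd.
  apply: measurableT_comp => //; apply: measurable_funM; first exact: measurable_cst.
  apply: measurableT_comp => //; apply: measurable_funB.
    exact: measurable_fst.
  exact: measurable_snd.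
have E x : (ekernel_conv x)%:E = (\int[leb]_y (EFin \o F) (x, y))%E.
  by rewrite /ekernel_conv -integral_EFin_Rintegral//; exact: integrable_ekernelM.
have T : (\int[leb]_x (ekernel_conv x)%:E = (2 / s * \int[leb]_x n x)%:E)%E.
  transitivity (\int[leb]_x \int[leb]_y (EFin \o F) (x, y))%E.
    by apply: eq_integral => x _; exact: E.
  transitivity (\int[leb]_y \int[leb]_x (EFin \o F) (x, y))%E.
    have := @fubini_tonelli _ _ _ _ R leb leb (EFin \o F) mF.
    by apply => z; rewrite lee_fin; exact: F0.
  transitivity (\int[leb]_y ((2 / s)%:E * (n y)%:E))%E.
    apply: eq_integral => y _.
    transitivity ((n y)%:E * \int[leb]_x (ekernel s y x)%:E)%E; last first.
      by rewrite integral_ekernel// muleC.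
    rewrite -ge0_integralZl//.
    - by apply: eq_integral => x _; rewrite /= /F /= mulrC EFinM ekernel_sym.
    - apply/measurable_EFinP; apply: continuous_measurable_fun; exact: ekernel_continuous.
    - by move=> x _; rewrite lee_fin ltW// ekernel_gt0.
    - by rewrite lee_fin.
  rewrite ge0_integralZl//.
  - by rewrite integral_EFin_Rintegral.
  - exact/measurable_EFinP.
  - by move=> x _; rewrite lee_fin.
  - by rewrite lee_fin divr_ge0// ltW.
split; last by rewrite /Rintegral T.
apply: ge0_integrable; last by rewrite T ltry.
- apply/measurable_EFinP; rewrite (_ : _ \o _ = (fun x => \int[leb]_y (EFin \o F) (x, y))%E).
    by apply: measurable_fun_fubini_tonelli_F => // z; rewrite lee_fin.
  by apply/funext => x; exact: E.
- exact: ekernel_conv_ge0.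
Qed.

End ExponentialKernel.

(** * From weak to classical derivatives *)

Section ClassicalDerivative.
Variable R : realType.
Local Notation leb := (@lebesgue_measure R).
Implicit Types (D : set R) (p q k P Q : R -> R).

(** By continuity the set where the functions differ is open in [D]; if it were nonempty it would
    contain a ball, which has positive measure. *)
Lemma ae_eq_open D p q : open D -> (forall x, D x -> {for x, continuous p}) ->
  (forall x, D x -> {for x, continuous q}) ->
  {ae leb, forall x, D x -> p x = q x} -> forall x, D x -> p x = q x.
Proof.
move=> oD cp cq pq x Dx; apply/eqP/negPn/negP => nx.
have : nbhs x [set y | p y - q y != 0].
  have cpq : {for x, continuous (fun y => p y - q y)}.
    by apply: cvgB; [exact: cp|exact: cq].
  apply: (cpq [set t | t != 0]); apply: open_nbhs_nbhs; split; first exact: open_neq.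
  by rewrite /= subr_eq0.
move=> /filterI/(_ (open_nbhs_nbhs (conj oD Dx))) /nbhs_ballP[e /= e0 he].
have [N [mN N0 hN]] := pq.
have : (leb (ball x e) <= leb N)%E.
  apply: le_measure; rewrite ?inE//; first exact: measurable_ball.
  move=> y /he[/= ny Dy]; apply: hN => /(_ Dy) /eqP.
  by rewrite -subr_eq0 (negPf ny).
by rewrite N0 lebesgue_measure_ball ?(ltW e0)// lee_fin leNgt mulrn_wgt0.
Qed.

Lemma real_weak_derivative_sub D D' p q : D' `<=` D ->
  real_weak_derivative D p q -> real_weak_derivative D' p q.
Proof.
move=> sD wp; have [ip iq h] := wp.
split=> [a b abD|a b abD|phi Cphi].
- by apply: ip; exact: subset_trans sD.
- by apply: iq; exact: subset_trans sD.
have [a [b [abD phi0 phi'0]]] := C1c_support Cphi.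
rewrite !(@Rintegral_support _ D' a b)//; last 2 first.
- by move=> x xab; rewrite phi0// mulr0.
- by move=> x xab; rewrite phi'0// mulr0.
apply: (real_weak_derivativeE wp) => //; last exact: subset_trans sD.
have [dphi c'phi _] := Cphi; split=> //; exists a, b; split=> //.
exact: subset_trans sD.
Qed.

Lemma real_weak_derivative_C1 D Q : (forall x, derivable Q x 1) ->
  continuous (derive1 Q) -> real_weak_derivative D Q (derive1 Q).
Proof.
move=> dQ cQ.
apply: real_weak_derivative_ext (real_weak_derivative_mul (real_weak_derivative_cst D 1) dQ cQ).
  by move=> x; rewrite mul1r.
by move=> x; rewrite mul0r add0r mul1r.
Qed.

(** Near [x0] compare [p] with a C^1 antiderivative of [q] times a plateau function. The difference
    has weak derivative 0, so it is constant almost everywhere, and everywhere nearby by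
    continuity. *)
Lemma weak_to_classical p q : continuous p -> continuous q ->
  real_weak_derivative setT p q -> forall x, derivable p x 1 /\ derive1 p x = q x.
Proof.
move=> cp cq wp x0.
(* With slope 1 this equals 1 at distance at most 1 from [x0]. *)
pose chi := trapezoid (x0 - 2) (x0 + 2) 1.
pose psi x := q x * chi x.
have cpsi : continuous psi.
  by move=> x; apply: cvgM; [exact: cq|exact: trapezoid_continuous].
have psi0 x : x \notin `[x0 - 2, x0 + 2] -> psi x = 0.
  by move=> h; rewrite /psi /chi trapezoid_support// mulr0.
have [] := compact_antiderivative cpsi psi0.
set Q := (X in derive1 X) => dQ Q'.
pose D : set R := `]x0 - 1, x0 + 1[%classic.
have oD : open D by exact: interval_open.
have Dx0 : D x0 by rewrite /D /= in_itv/=; apply/andP; split; lra.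
have psiq x : D x -> psi x = q x.
  rewrite /D /= in_itv/= => /andP[h1 h2]; rewrite /psi /chi /trapezoid.
  rewrite min_l ?mulr1// mul1r le_max le_min; apply/orP; right.
  by apply/andP; split; lra.
have cQ : continuous (derive1 Q) by rewrite Q'.
have wQ := real_weak_derivative_C1 D dQ cQ; rewrite Q' in wQ.
have := real_weak_derivative_lin 1 (-1) (real_weak_derivative_sub (@subsetT _ D) wp) wQ.
move=> /(@real_weak_derivative_ae _ _ _ _ (cst 0)) h.
have [c hc] : exists c, {ae leb, forall x, D x -> 1 * p x + -1 * Q x = c}.
  apply: du_bois_reymond => //.
  - exact: interval_is_interval.
  - by exists x0.
  - apply: h; first exact/continuous_segment_integrable/cst_continuous.
    by apply: ae_all => x Dx; rewrite psiq// mul1r mulN1r subrr.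
have cQ0 : continuous Q by move=> x; exact/differentiable_continuous/derivable1_diffP.
have pQ x : D x -> p x = Q x + c.
  apply: (@ae_eq_open D p (fun x => Q x + c) oD) => [y _|y _|].
  - exact: cp.
  - by apply: cvgD; [exact: cQ0|exact: cvg_cst].
  - by apply: (ae_impl2 _ hc hc) => y + _ Dy => /(_ Dy) <-; ring.
have nearpQ : \forall x \near x0, Q x + c = p x.
  by apply: filterS (open_nbhs_nbhs (conj oD Dx0)) => x Dx; rewrite pQ.
have dQc : is_derive x0 1 (fun x => Q x + c) (psi x0).
  have h1 : is_derive x0 1 Q (psi x0).
    by apply: DeriveDef => //; rewrite -derive1E Q'.
  by have := is_deriveD h1 (is_derive_cst c x0 1); rewrite addr0.
have [dp ep] := near_eq_is_derive nearpQ dQc.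
by split=> //; rewrite derive1E ep psiq.
Qed.

Lemma primitive_continuous P k : segment_integrable setT k ->
  (forall a b, a <= b -> P b - P a = \int[leb]_(x in `[a, b]) k x) -> continuous P.
Proof.
move=> ik PE x.
have ab : x - 1 <= x + 1 by lra.
have := parameterized_integral_continuous ab (ik (x - 1) (x + 1) (@subsetT _ _)).
move=> /continuous_within_itvP.
have ab' : x - 1 < x + 1 by lra.
move=> /(_ ab')[+ _ _]; move=> /(_ x) /=.
rewrite in_itv/=; have -> : x - 1 < x < x + 1 by apply/andP; split; lra.
move=> /(_ isT) h.
have e y : x - 1 <= y -> parameterized_integral leb (x - 1) y k + P (x - 1) = P y.
  by move=> xy; rewrite /parameterized_integral -PE// subrK.
have {}h : parameterized_integral leb (x - 1) y k + P (x - 1) @[y --> x] --> P x.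
  have <- : parameterized_integral leb (x - 1) x k + P (x - 1) = P x by apply: e; lra.
  by apply: cvgD; [exact: h|exact: cvg_cst].
apply: cvg_trans h; apply: near_eq_cvg; near=> y.
have yx : y \in `]x - 1, x + 1[.
  by near: y; apply: near_in_itvoo; rewrite in_itv/=; apply/andP; split; lra.
by rewrite e// ltW// (itvP yx).
Unshelve. all: by end_near. Qed.

End ClassicalDerivative.

Section FreeSolution.
Variable R : realType.
Local Notation leb := (@lebesgue_measure R).
Local Notation C := R[i].
Variables (z : C) (f : R -> C).
Hypotheses (z0 : 0 < Re z) (f2 : f \in @square_integrable R).
Implicit Types (D : set R) (x y : R) (w c : C).

Let s := Re z.
Let n y := cabs2 (f y).
Let S := ekernel_conv n s.

Let n0 y : 0 <= n y. Proof. exact: cabs2_ge0. Qed.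

Let ni : leb.-integrable setT (EFin \o n).
Proof. by have /square_integrableP[] := f2. Qed.

Let mRe : measurable_fun setT (fun y => Re (f y)).
Proof. by have /square_integrableP[] := f2. Qed.

Let mIm : measurable_fun setT (fun y => Im (f y)).
Proof. by have /square_integrableP[] := f2. Qed.

Lemma integrable_EFin_lin D (p q : R -> R) (k l : R) : measurable D ->
  leb.-integrable D (EFin \o p) -> leb.-integrable D (EFin \o q) ->
  leb.-integrable D (EFin \o (fun x => k * p x + l * q x)).
Proof.
move=> mD ip iq.
rewrite (_ : _ \o _ = ((fun x => k%:E * (EFin \o p) x) \+ (fun x => l%:E * (EFin \o q) x))%E) //.
by apply: integrableD => //; exact: integrableZl.
Qed.

Lemma Rintegral_EFin_lin D (p q : R -> R) (k l : R) : measurable D ->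
  leb.-integrable D (EFin \o p) -> leb.-integrable D (EFin \o q) ->
  \int[leb]_(x in D) (k * p x + l * q x) =
  k * \int[leb]_(x in D) p x + l * \int[leb]_(x in D) q x.
Proof.
move=> mD ip iq; rewrite RintegralD ?RintegralZl//.
  by rewrite (_ : _ \o _ = (fun x => k%:E * (EFin \o p) x)%E) //; exact: integrableZl.
by rewrite (_ : _ \o _ = (fun x => l%:E * (EFin \o q) x)%E) //; exact: integrableZl.
Qed.

Lemma Re_le_cabs2M (c w : C) : `|Re (c * w)| <= cabs2 c + cabs2 w.
Proof.
rewrite cReM ler_norml /cabs2; have := sqr_ge0 (Re c - Re w); have := sqr_ge0 (Re c + Re w).
have := sqr_ge0 (Im c - Im w); have := sqr_ge0 (Im c + Im w).
have := sqr_ge0 (Re c); have := sqr_ge0 (Im c); have := sqr_ge0 (Re w).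
by have := sqr_ge0 (Im w) => *; apply/andP; split; lra.
Qed.

Lemma Im_le_cabs2M (c w : C) : `|Im (c * w)| <= cabs2 c + cabs2 w.
Proof.
rewrite cImM ler_norml /cabs2; have := sqr_ge0 (Re c - Im w); have := sqr_ge0 (Re c + Im w).
have := sqr_ge0 (Im c - Re w); have := sqr_ge0 (Im c + Re w).
have := sqr_ge0 (Re c); have := sqr_ge0 (Im c); have := sqr_ge0 (Re w).
by have := sqr_ge0 (Im w) => *; apply/andP; split; lra.
Qed.

(* Cauchy-Schwarz with respect to the kernel, by optimizing over [t] the bound
   [|g| <= ekernel * (t + n / t) / 2]. *)
Lemma ekernel_cauchy_schwarz D g x : measurable D ->
  leb.-integrable D (EFin \o g) ->
  (forall y, D y -> g y ^+ 2 <= ekernel s x y ^+ 2 * n y) ->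
  (\int[leb]_(y in D) g y) ^+ 2 <= 2 / s * S x.
Proof.
move=> mD ig gn.
have iS := integrable_ekernelM z0 n0 ni x; rewrite -/s in iS.
have iK := integrable_ekernel x z0; rewrite -/s in iK.
have S0 : 0 <= S x by exact: ekernel_conv_ge0.
have s20 : 0 < 2 / s by rewrite divr_gt0.
pose X := `|\int[leb]_(y in D) g y|.
have key t : 0 < t -> X <= t / 2 * (2 / s) + (2 * t)^-1 * S x.
  move=> t0.
  have i1 : leb.-integrable setT (EFin \o (fun y => t / 2 * ekernel s x y)).
    exact: (@rintegrableZ _ (t / 2) _ iK).
  have i2 : leb.-integrable setT (EFin \o (fun y => (2 * t)^-1 * (ekernel s x y * n y))).
    exact: (@rintegrableZ _ (2 * t)^-1 _ iS).
  have <- : \int[leb]_y (t / 2 * ekernel s x y + (2 * t)^-1 * (ekernel s x y * n y)) =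
      t / 2 * (2 / s) + (2 * t)^-1 * S x.
    rewrite RintegralD// !RintegralZl//; congr (_ * _ + _).
    by rewrite /Rintegral integral_ekernel.
  apply: (@le_trans _ _ (\int[leb]_(y in D) `|g y|)); first exact: le_normr_Rintegral.
  rewrite Rintegral_mkcond; apply: le_Rintegral => //.
  - have ig' : leb.-integrable D (EFin \o (fun y => `|g y|)) by exact: integrable_norm.
    rewrite -restrict_EFin.
    exact: (proj1 (@integrable_mkcond _ _ _ leb D (EFin \o (fun y => `|g y|)) mD) ig').
  - exact: (rintegrableD i1 i2).
  - move=> y _; have E0 := ekernel_gt0 s x y.
    have t20 : 0 <= t / 2 by lra.
    have t21 : 0 <= (2 * t)^-1 by rewrite invr_ge0; lra.
    have nt0 : 0 <= n y / t by apply: divr_ge0 => //; exact: ltW.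
    rewrite patchE; case: ifPn => [/set_mem Dy|_]; last first.
      by apply: addr_ge0; apply: mulr_ge0 => //; [exact: ltW|apply: mulr_ge0 => //; exact: ltW].
    have -> : t / 2 * ekernel s x y + (2 * t)^-1 * (ekernel s x y * n y) =
        ekernel s x y * ((t + n y / t) / 2).
      by field; rewrite gt_eqF.
    have tn0 : 0 <= (t + n y / t) / 2 by apply: divr_ge0 => //; lra.
    have E1 : 0 <= ekernel s x y * ((t + n y / t) / 2) by apply: mulr_ge0 => //; exact: ltW.
    rewrite -(ler_pXn2r (n := 2))// ?nnegrE// real_normK ?num_real//.
    rewrite (le_trans (gn _ Dy))// exprMn ler_wpM2l ?sqr_ge0// -subr_ge0.
    rewrite (_ : _ - _ = ((t - n y / t) / 2) ^+ 2) ?sqr_ge0//.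
    by field; rewrite gt_eqF.
have X0 : 0 <= X by exact: normr_ge0.
rewrite -real_normK ?num_real// -/X.
have [->|Xn0] := eqVneq X 0; first by rewrite expr0n mulr_ge0// ltW.
have Xp : 0 < X by rewrite lt_neqAle eq_sym Xn0.
(* For [t = s X / 2] the first term of the bound is [X / 2], which the left-hand side absorbs. *)
have /key : 0 < s * X / 2 by rewrite divr_gt0// mulr_gt0.
have -> : s * X / 2 / 2 * (2 / s) = X / 2 by field; rewrite gt_eqF.
have -> : (2 * (s * X / 2))^-1 * S x = S x / s / X by field; rewrite !gt_eqF.
rewrite -lerBlDl (_ : X - X / 2 = X / 2); last by lra.
rewrite ler_pdivlMr// => h.
by rewrite (_ : 2 / s * S x = 2 * (S x / s)); [lra|field; rewrite gt_eqF].
Qed.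

Lemma measurable_cwave_mul w : measurable_fun setT (fun y => Re (cwave w y * f y)) /\
  measurable_fun setT (fun y => Im (cwave w y * f y)).
Proof.
have [cr ci] := cwave_continuous w.
have mr := continuous_measurable_fun cr; have mi := continuous_measurable_fun ci.
split.
  rewrite (_ : (fun y => _) = (fun y => Re (cwave w y) * Re (f y) - Im (cwave w y) * Im (f y))).
    by apply: measurable_funB; apply: measurable_funM.
  by apply/funext => y; rewrite cReM.
rewrite (_ : (fun y => _) = (fun y => Re (cwave w y) * Im (f y) + Im (cwave w y) * Re (f y))).
  by apply: measurable_funD; apply: measurable_funM.
by apply/funext => y; rewrite cImM.
Qed.

(** The abstract [D] serves both half-lines cut at [x]: there [|exp (w y)|] is the kernel at
    [(x, y)] times a factor depending on [x] only. Integrability follows from bounding a product by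
    the sum of the squared moduli. *)
Lemma cwave_mul_integrable D w x (K : R) : measurable D ->
  (forall y, D y -> cabs2 (cwave w y) = K * ekernel s x y ^+ 2) ->
  leb.-integrable D (EFin \o (fun y => Re (cwave w y * f y))) /\
  leb.-integrable D (EFin \o (fun y => Im (cwave w y * f y))).
Proof.
move=> mD wK; have [mr mi] := measurable_cwave_mul w.
have iB : leb.-integrable D (EFin \o (fun y => `|K| * ekernel s x y + n y)).
  apply: (@integrableS _ _ _ leb setT) => //.
  exact: rintegrableD (@rintegrableZ _ `|K| _ (integrable_ekernel x z0)) ni.
have le y : D y -> cabs2 (cwave w y) <= `|K| * ekernel s x y.
  move=> /wK ->; have E0 := ekernel_gt0 s x y; have E1 := ekernel_le1 z0 x y.
  apply: (@le_trans _ _ (`|K| * ekernel s x y ^+ 2)).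
    by rewrite ler_wpM2r ?sqr_ge0// ler_norm.
  by rewrite ler_wpM2l// expr2 ler_piMr// ltW.
split; apply: le_integrable iB => //.
- by apply/measurable_EFinP; exact: measurable_funTS.
- move=> y Dy /=; rewrite lee_fin [leRHS]ger0_norm; last first.
    by rewrite addr_ge0// mulr_ge0// ltW// ekernel_gt0.
  by rewrite (le_trans (Re_le_cabs2M _ _))// lerD2r le.
- by apply/measurable_EFinP; exact: measurable_funTS.
- move=> y Dy /=; rewrite lee_fin [leRHS]ger0_norm; last first.
    by rewrite addr_ge0// mulr_ge0// ltW// ekernel_gt0.
  by rewrite (le_trans (Im_le_cabs2M _ _))// lerD2r le.
Qed.

(** The prefactor [c] cancels the weight [K]. The constant 4 is twice the 2 of
    [ekernel_cauchy_schwarz], which is applied to the real and the imaginary part. *)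
Lemma cwave_mul_bound D w c x (K : R) : measurable D ->
  (forall y, D y -> cabs2 (cwave w y) = K * ekernel s x y ^+ 2) ->
  cabs2 c * K = 1 ->
  cabs2 (c * cintegral D (fun y => cwave w y * f y)) <= 4 / s * S x.
Proof.
move=> mD wK cK; have [ir ii] := cwave_mul_integrable mD wK.
have bnd y : D y -> cabs2 (c * (cwave w y * f y)) = ekernel s x y ^+ 2 * n y.
  by move=> /wK h; rewrite cabs2M (cabs2M (cwave w y)) h !mulrA cK mul1r.
have lin (k l : R) : leb.-integrable D (EFin \o (fun y =>
    k * Re (cwave w y * f y) + l * Im (cwave w y * f y))).
  exact: integrable_EFin_lin.
have int (k l : R) : \int[leb]_(y in D) (k * Re (cwave w y * f y) + l * Im (cwave w y * f y)) =
    k * \int[leb]_(y in D) Re (cwave w y * f y) + l * \int[leb]_(y in D) Im (cwave w y * f y).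
  exact: Rintegral_EFin_lin.
have eR : Re (c * cintegral D (fun y => cwave w y * f y)) =
    \int[leb]_(y in D) Re (c * (cwave w y * f y)).
  under [RHS]eq_Rintegral do rewrite cReM -mulNr.
  by rewrite int cReM -mulNr.
have eI : Im (c * cintegral D (fun y => cwave w y * f y)) =
    \int[leb]_(y in D) Im (c * (cwave w y * f y)).
  under [RHS]eq_Rintegral do rewrite cImM addrC.
  by rewrite int cImM addrC.
rewrite /cabs2 eR eI (_ : 4 / s * S x = 2 / s * S x + 2 / s * S x); last first.
  by field; rewrite gt_eqF.
apply: lerD; apply: ekernel_cauchy_schwarz => //.
- have := lin (Re c) (- Im c); apply: eq_integrable => // y _ /=.
  by congr EFin; rewrite [RHS]cReM mulNr.
- by move=> y /bnd <-; rewrite lerDl sqr_ge0.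
- have := lin (Im c) (Re c); apply: eq_integrable => // y _ /=.
  by congr EFin; rewrite [RHS]cImM addrC.
- by move=> y /bnd <-; rewrite lerDr sqr_ge0.
Qed.

End FreeSolution.

Section ComplexContinuity.
Variable R : realType.
Local Notation C := R[i].
Implicit Types (u v : R -> C).

Definition complex_continuous u : Prop :=
  continuous (fun x => Re (u x)) /\ continuous (fun x => Im (u x)).

Lemma complex_continuousM u v : complex_continuous u -> complex_continuous v ->
  complex_continuous (fun x => u x * v x).
Proof.
move=> [ur ui] [vr vi]; split => x.
  rewrite (_ : (fun _ => _) = (fun x => Re (u x) * Re (v x) - Im (u x) * Im (v x))).
    by apply: cvgB; apply: cvgM; [exact: ur|exact: vr|exact: ui|exact: vi].
  by apply/funext => t; rewrite cReM.
rewrite (_ : (fun _ => _) = (fun x => Re (u x) * Im (v x) + Im (u x) * Re (v x))).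
  by apply: cvgD; apply: cvgM; [exact: ur|exact: vi|exact: ui|exact: vr].
by apply/funext => t; rewrite cImM.
Qed.

Lemma complex_continuousD u v : complex_continuous u -> complex_continuous v ->
  complex_continuous (fun x => u x + v x).
Proof.
move=> [ur ui] [vr vi]; split => x.
  rewrite (_ : (fun _ => _) = (fun x => Re (u x) + Re (v x))).
    by apply: cvgD; [exact: ur|exact: vr].
  by apply/funext => t; rewrite cReD.
rewrite (_ : (fun _ => _) = (fun x => Im (u x) + Im (v x))).
  by apply: cvgD; [exact: ui|exact: vi].
by apply/funext => t; rewrite cImD.
Qed.

Lemma complex_continuous_cst (c : C) : complex_continuous (fun=> c).
Proof. by split=> x; exact: cvg_cst. Qed.

End ComplexContinuity.

Section FreeSolution.
Variable R : realType.
Local Notation leb := (@lebesgue_measure R).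
Local Notation C := R[i].
Variables (z : C) (f : R -> C).
Hypotheses (z0 : 0 < Re z) (f2 : f \in @square_integrable R).
Implicit Types (x y : R).

Let s := Re z.
Let S := ekernel_conv (fun y => cabs2 (f y)) s.

(** Cutting the convolution with [exp (- z |x - y|)] at [y = x] leaves exponentials in [x] times two
    one-sided integrals, both of which are primitives. *)
Definition left_part x : C := cintegral `]-oo, x] (fun y => cwave z y * f y).
Definition right_part x : C := cintegral `[x, +oo[ (fun y => cwave (- z) y * f y).

(* The solution of [- u'' + z^2 u = f] on the line, and its derivative. *)
Definition free_sol x : C := (cwave (- z) x * left_part x + cwave z x * right_part x) / (2 * z).
Definition free_der x : C := (cwave z x * right_part x - cwave (- z) x * left_part x) / 2.

Lemma zneq0 : z != 0.
Proof. by apply/eqP => e; move: z0; rewrite e ltxx. Qed.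

Lemma left_weight x y : `]-oo, x]%classic y ->
  cabs2 (cwave z y) = expR (2 * s * x) * ekernel s x y ^+ 2.
Proof.
rewrite /= in_itv/= => yx; rewrite cabs2_cwave /ekernel -expRM_natl -expRD.
by rewrite ger0_norm ?subr_ge0//; congr expR; rewrite /s; ring.
Qed.

Lemma right_weight x y : `[x, +oo[%classic y ->
  cabs2 (cwave (- z) y) = expR (- (2 * s * x)) * ekernel s x y ^+ 2.
Proof.
rewrite /= in_itv/= andbT => xy; rewrite cabs2_cwave /ekernel -expRM_natl -expRD.
by rewrite distrC ger0_norm ?subr_ge0//; congr expR; rewrite cReN /s; ring.
Qed.

Lemma left_integrable x :
  leb.-integrable `]-oo, x] (EFin \o (fun y => Re (cwave z y * f y))) /\
  leb.-integrable `]-oo, x] (EFin \o (fun y => Im (cwave z y * f y))).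
Proof. by apply: (cwave_mul_integrable z0 f2 _ (left_weight (x := x))). Qed.

Lemma right_integrable x :
  leb.-integrable `[x, +oo[ (EFin \o (fun y => Re (cwave (- z) y * f y))) /\
  leb.-integrable `[x, +oo[ (EFin \o (fun y => Im (cwave (- z) y * f y))).
Proof. by apply: (cwave_mul_integrable z0 f2 _ (right_weight (x := x))). Qed.

Lemma left_bound x : cabs2 (cwave (- z) x * left_part x) <= 4 / s * S x.
Proof.
apply: (cwave_mul_bound z0 f2 _ (left_weight (x := x))) => //.
by rewrite cabs2_cwave cReN -expRD -expR0; congr expR; rewrite /s; ring.
Qed.

Lemma right_bound x : cabs2 (cwave z x * right_part x) <= 4 / s * S x.
Proof.
apply: (cwave_mul_bound z0 f2 _ (right_weight (x := x))) => //.
by rewrite cabs2_cwave -expRD -expR0; congr expR; rewrite /s; ring.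
Qed.

Lemma left_primitive (g : R -> R) : (forall x, leb.-integrable `]-oo, x] (EFin \o g)) ->
  forall a b : R, a <= b ->
  \int[leb]_(y in `]-oo, b]) g y - \int[leb]_(y in `]-oo, a]) g y = \int[leb]_(y in `[a, b]) g y.
Proof.
move=> ig a b ab; rewrite (@Rintegral_itvB _ g -oo%O (BRight b) a (ig b))//.
apply: Rintegral_itv_obnd_cbnd; apply: integrableS (ig b) => //.
by apply: subset_itvr; rewrite bnd_simp.
Qed.

Lemma right_primitive (g : R -> R) : (forall x, leb.-integrable `[x, +oo[ (EFin \o g)) ->
  forall a b : R, a <= b ->
  \int[leb]_(y in `[b, +oo[) g y - \int[leb]_(y in `[a, +oo[) g y = - \int[leb]_(y in `[a, b]) g y.
Proof.
move=> ig a b ab; have := @Rintegral_itvB _ g (BLeft a) +oo%O b (ig a).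
rewrite bnd_simp => /(_ ab isT) e.
rewrite -Rintegral_itv_obnd_cbnd -?e; first by ring.
by apply: integrableS (ig b) => //; apply: subset_itvr; rewrite bnd_simp.
Qed.

Lemma left_segment : segment_integrable setT (fun y => Re (cwave z y * f y)) /\
  segment_integrable setT (fun y => Im (cwave z y * f y)).
Proof.
by split=> a b _; have [h1 h2] := left_integrable b; [apply: integrableS h1|apply: integrableS h2];
  rewrite //; apply: subset_itvr; rewrite bnd_simp.
Qed.

Lemma right_segment : segment_integrable setT (fun y => Re (cwave (- z) y * f y)) /\
  segment_integrable setT (fun y => Im (cwave (- z) y * f y)).
Proof.
by split=> a b _; have [h1 h2] := right_integrable a; [apply: integrableS h1|apply: integrableS h2];
  rewrite //; apply: subset_itvl; rewrite bnd_simp.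
Qed.

Lemma left_continuous : complex_continuous left_part.
Proof.
have [i1 i2] := left_segment; split.
  by apply: primitive_continuous i1 _; apply: left_primitive => x; have [] := left_integrable x.
by apply: primitive_continuous i2 _; apply: left_primitive => x; have [] := left_integrable x.
Qed.

Lemma real_segment_integrableN (D : set R) (p : R -> R) : segment_integrable D p ->
  segment_integrable D (fun x => - p x).
Proof.
move=> ip a b abD; have := integrable_segmentZ (-1) (ip a b abD).
by apply: eq_integrable => // x _ /=; rewrite mulN1r.
Qed.

Lemma right_primitiveN (g : R -> R) : (forall x, leb.-integrable `[x, +oo[ (EFin \o g)) ->
  forall a b : R, a <= b ->
  \int[leb]_(y in `[b, +oo[) g y - \int[leb]_(y in `[a, +oo[) g y =
  \int[leb]_(y in `[a, b]) (- g y).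
Proof.
move=> ig a b ab; rewrite right_primitive//.
under [RHS]eq_Rintegral do rewrite -mulN1r.
rewrite RintegralZl ?mulN1r//.
by apply: integrableS (ig a) => //; apply: subset_itvl; rewrite bnd_simp.
Qed.

Lemma right_continuous : complex_continuous right_part.
Proof.
have [i1 i2] := right_segment; split.
  apply: primitive_continuous (real_segment_integrableN i1) _.
  by apply: right_primitiveN => x; have [] := right_integrable x.
apply: primitive_continuous (real_segment_integrableN i2) _.
by apply: right_primitiveN => x; have [] := right_integrable x.
Qed.

Lemma left_weak : complex_weak_derivative setT left_part (fun y => cwave z y * f y).
Proof.
have [i1 i2] := left_segment; have [c1 c2] := left_continuous; split.
  apply: real_weak_derivative_primitive => // a b ab _.
  by apply: left_primitive => // x; have [] := left_integrable x.
apply: real_weak_derivative_primitive => // a b ab _.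
by apply: left_primitive => // x; have [] := left_integrable x.
Qed.

Lemma right_weak : complex_weak_derivative setT right_part (fun y => - (cwave (- z) y * f y)).
Proof.
have [i1 i2] := right_segment; have [c1 c2] := right_continuous; split.
  apply: (@real_weak_derivative_ext _ _ (fun x => Re (right_part x)) (fun y => - Re (cwave (- z) y * f y))) => //.
    by move=> x; rewrite cReN.
  apply: real_weak_derivative_primitive => // [|a b ab _]; first exact: real_segment_integrableN.
  by apply: right_primitiveN => // x; have [] := right_integrable x.
apply: (@real_weak_derivative_ext _ _ (fun x => Im (right_part x)) (fun y => - Im (cwave (- z) y * f y))) => //.
  by move=> x; rewrite cImN.
apply: real_weak_derivative_primitive => // [|a b ab _]; first exact: real_segment_integrableN.
by apply: right_primitiveN => // x; have [] := right_integrable x.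
Qed.

Lemma free_sol_continuous : complex_continuous free_sol.
Proof.
apply: complex_continuousM; last exact: complex_continuous_cst.
apply: complex_continuousD.
  exact: complex_continuousM (cwave_continuous (- z)) left_continuous.
exact: complex_continuousM (cwave_continuous z) right_continuous.
Qed.

Lemma free_der_continuous : complex_continuous free_der.
Proof.
rewrite /free_der (_ : (fun x => _) = (fun x => (cwave z x * right_part x
    + (- 1) * (cwave (- z) x * left_part x)) / 2)); last first.
  by apply/funext => x; rewrite mulN1r.
apply: complex_continuousM; last exact: complex_continuous_cst.
apply: complex_continuousD.
  exact: complex_continuousM (cwave_continuous z) right_continuous.
apply: complex_continuousM; first exact: complex_continuous_cst.
exact: complex_continuousM (cwave_continuous (- z)) left_continuous.
Qed.

Let a x := cwave (- z) x * left_part x.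
Let b x := cwave z x * right_part x.

(** The two halves satisfy first-order equations, [a' + z a = f] and [b' - z b = - f]; the
    second-order equation for their sum follows linearly. *)
Let aW : complex_weak_derivative setT a (fun x => f x - z * a x).
Proof.
have := complex_weak_derivative_cwave_mul (- z) left_weak.
by apply: complex_weak_derivative_ext => x //; rewrite mulrA cwaveN mul1r /a; ring.
Qed.

Let bW : complex_weak_derivative setT b (fun x => - f x + z * b x).
Proof.
have := complex_weak_derivative_cwave_mul z right_weak.
apply: complex_weak_derivative_ext => x //; rewrite mulrN mulrA.
by rewrite [cwave z x * _]mulrC cwaveN mul1r /b; ring.
Qed.

Lemma free_sol_weak : complex_weak_derivative setT free_sol free_der.
Proof.
have zn0 := zneq0.
have := complex_weak_derivative_lin (2 * z)^-1 (2 * z)^-1 aW bW.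
apply: complex_weak_derivative_ext => x; first by rewrite /free_sol -/(a x) -/(b x) [RHS]mulrC mulrDr.
rewrite /free_der -/(a x) -/(b x); field.
by rewrite ?zn0 ?pnatr_eq0.
Qed.

Lemma free_der_weak : complex_weak_derivative setT free_der (fun x => z ^+ 2 * free_sol x - f x).
Proof.
have zn0 := zneq0.
have := complex_weak_derivative_lin (2^-1) (- 2^-1) bW aW.
apply: complex_weak_derivative_ext => x; rewrite /free_der /free_sol -/(a x) -/(b x); field.
  by rewrite ?pnatr_eq0.
by rewrite ?zn0 ?pnatr_eq0.
Qed.

Lemma cabs2_natr (k : nat) : cabs2 (k%:R : C) = k%:R ^+ 2.
Proof. by rewrite /cabs2 Re_natr Im_natr expr0n addr0. Qed.

Lemma cabs2V (c : C) : cabs2 c^-1 = (cabs2 c)^-1.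
Proof.
have [->|c0] := eqVneq c 0; first by rewrite invr0 cabs2_0 invr0.
have cn0 : cabs2 c != 0 by apply: contra c0 => /eqP/cabs2_eq0 ->.
by apply: (mulfI cn0); rewrite -cabs2M !mulfV// (cabs2_natr 1) expr1n.
Qed.

Lemma cabs2z_gt0 : 0 < cabs2 z.
Proof. by rewrite /cabs2 ltr_wpDr ?sqr_ge0// exprn_gt0. Qed.

(** Domination by the convolution of [|f|^2] with the kernel gives square integrability and, with
    the known integral of [S], the norm bound at once. *)
Lemma free_sol_pointwise x : cabs2 (free_sol x) <= 4 / (s * cabs2 z) * S x.
Proof.
rewrite /free_sol -/(a x) -/(b x) cabs2M cabs2V cabs2M cabs2_natr.
rewrite ler_pdivrMr; last by rewrite mulr_gt0 ?cabs2z_gt0.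
rewrite (le_trans (cabs2D_le _ _))//.
have -> : 4 / (s * cabs2 z) * S x * (2 ^+ 2 * cabs2 z) = 2 * (4 / s * S x + 4 / s * S x).
  by field; rewrite !gt_eqF// cabs2z_gt0.
by rewrite ler_pM2l//; apply: lerD; [exact: left_bound|exact: right_bound].
Qed.

Lemma free_der_pointwise x : cabs2 (free_der x) <= 4 / s * S x.
Proof.
rewrite /free_der -/(a x) -/(b x) cabs2M cabs2V cabs2_natr.
rewrite ler_pdivrMr// (le_trans (cabs2B_le _ _))//.
have -> : 4 / s * S x * 2 ^+ 2 = 2 * (4 / s * S x + 4 / s * S x) by ring.
by rewrite ler_pM2l//; apply: lerD; [exact: right_bound|exact: left_bound].
Qed.

Let f2' := f2.

Lemma integrable_S : leb.-integrable setT (EFin \o S) /\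
  \int[leb]_x S x = 2 / s * \int[leb]_x cabs2 (f x).
Proof.
have /square_integrableP[_ _ h] := f2'.
by apply: ekernel_conv_integral => // y; exact: cabs2_ge0.
Qed.

Lemma square_integrable_dominated (u : R -> C) (K : R) : complex_continuous u ->
  (forall x, cabs2 (u x) <= K * S x) -> u \in @square_integrable R.
Proof.
move=> [ur ui] uK; have [iS _] := integrable_S.
have mr := continuous_measurable_fun ur; have mi := continuous_measurable_fun ui.
apply/square_integrableP; split=> //.
have := @rintegrableZ _ K _ iS; apply: le_integrable => //.
  apply/measurable_EFinP.
  by apply: measurable_funD; apply: measurable_funX.
move=> x _ /=; rewrite lee_fin ger0_norm ?cabs2_ge0//.
by rewrite (le_trans (uK x))// ler_norm.
Qed.

Lemma free_sol_L2 : free_sol \in @square_integrable R.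
Proof. exact: square_integrable_dominated free_sol_continuous free_sol_pointwise. Qed.

Lemma free_der_L2 : free_der \in @square_integrable R.
Proof. exact: square_integrable_dominated free_der_continuous free_der_pointwise. Qed.

Lemma free_sol_norm : \int[leb]_x cabs2 (free_sol x) <=
  8 / (s ^+ 2 * cabs2 z) * \int[leb]_x cabs2 (f x).
Proof.
have [iS eS] := integrable_S.
have /square_integrableP[_ _ iu] := free_sol_L2.
apply: (@le_trans _ _ (\int[leb]_x (4 / (s * cabs2 z) * S x))).
  by apply: le_Rintegral => // [|x _]; [exact: rintegrableZ|exact: free_sol_pointwise].
rewrite RintegralZl// eS le_eqVlt; apply/orP; left; apply/eqP; field.
by rewrite !gt_eqF// cabs2z_gt0.
Qed.

Lemma free_sol_H2 : H2_derivative2 setT free_sol (fun x => z ^+ 2 * free_sol x - f x).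
Proof.
have u2 := free_sol_L2; have v2 := free_der_L2.
exists free_der; split; apply/weak_derivativeP; split.
- exact/square_integrable_onT.
- exact/square_integrable_onT.
- exact: free_sol_weak.
- exact/square_integrable_onT.
- have := square_integrable_on_lin (z ^+ 2) ((square_integrable_onT _).2 u2)
    (square_integrable_on_lin (-1) ((square_integrable_onT _).2 f2')
      ((square_integrable_onT _).2 (rpred0 _))).
  congr square_integrable_on; apply/funext => x.
  by rewrite mulN1r -[X in _ + X]/(- f x + 0) addr0.
- exact: free_der_weak.
Qed.

Lemma free_sol_classical x : [/\ derivable (fun y => Re (free_sol y)) x 1,
  derive1 (fun y => Re (free_sol y)) x = Re (free_der x),
  derivable (fun y => Im (free_sol y)) x 1 &
  derive1 (fun y => Im (free_sol y)) x = Im (free_der x)].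
Proof.
have [c1 c2] := free_sol_continuous; have [d1 d2] := free_der_continuous.
have [w1 w2] := free_sol_weak.
have [h1 h2] := weak_to_classical c1 d1 w1 x; have [h3 h4] := weak_to_classical c2 d2 w2 x.
exact: (And4 h1 h2 h3 h4).
Qed.

Lemma free_sol0 : free_sol 0 = cintegral setT (fun y => cwave (- z) `|y| * f y) / (2 * z).
Proof.
rewrite /free_sol !cwave0 !mul1r; congr (_ / _).
have [l1 l2] := left_integrable 0; have [r1 r2] := right_integrable 0.
have key (p q g : R -> R) : leb.-integrable `]-oo, 0] (EFin \o p) ->
    leb.-integrable `[0, +oo[ (EFin \o q) ->
    (forall y, y <= 0 -> g y = p y) -> (forall y, 0 <= y -> g y = q y) ->
    \int[leb]_(y in `]-oo, 0]) p y + \int[leb]_(y in `[0, +oo[) q y = \int[leb]_y g y.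
  move=> ip iq gp gq.
  have iq' : leb.-integrable `]0, +oo[ (EFin \o q).
    by apply: integrableS iq => //; apply: subset_itvr; rewrite bnd_simp.
  rewrite -Rintegral_itv_obnd_cbnd// Rintegral_mkcond [X in _ + X]Rintegral_mkcond.
  rewrite -RintegralD//; last 2 first.
  - rewrite -restrict_EFin.
    exact: (proj1 (@integrable_mkcond _ _ _ leb _ (EFin \o p) (measurable_itv `]-oo, 0])) ip).
  - rewrite -restrict_EFin.
    exact: (proj1 (@integrable_mkcond _ _ _ leb _ (EFin \o q) (measurable_itv `]0, +oo[)) iq').
  apply: eq_Rintegral => y _; rewrite !patchE !mem_setE !in_itv/= andbT.
  by case: leP => y0; rewrite ?addr0 ?add0r; [rewrite gp|rewrite gq// ltW].
have Ep y : y <= 0 -> cwave (- z) `|y| = cwave z y.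
  by move=> y0; rewrite ler0_norm// /cwave rmorphN /=; congr cexp; ring.
have Eq y : 0 <= y -> cwave (- z) `|y| = cwave (- z) y.
  by move=> y0; rewrite ger0_norm.
apply: complex_eq.
  rewrite cReD !Re_cintegral; by apply: key => // y y0; [rewrite Ep|rewrite Eq].
rewrite cImD !Im_cintegral; by apply: key => // y y0; [rewrite Ep|rewrite Eq].
Qed.

End FreeSolution.

(** * The operators T and their adjoints *)

Section L2Classes.
Variable R : realType.
Local Open Scope quotient_scope.
Local Notation leb := (@lebesgue_measure R).
Local Notation C := R[i].
Implicit Types (U V : L2 R) (u v : R -> C).

Lemma L2_of_exists u : u \in @square_integrable R -> exists U, L2_of U u.
Proof. by move=> hu; exists (\pi_(L2 R) (L2Fun hu)); exact: (L2_reprP (L2Fun hu)). Qed.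

Lemma L2_of_repr U : L2_of U (repr U).
Proof. exact: ae_all. Qed.

Lemma L2_of_ae U u v : L2_of U u -> {ae leb, forall x, u x = v x} -> L2_of U v.
Proof. by move=> hu uv; apply: (ae_impl2 _ hu uv) => x -> ->. Qed.

Lemma L2_of_lin U V u v (a : C) : L2_of U u -> L2_of V v ->
  L2_of (a *: U + V) (fun x => a * u x + v x).
Proof.
move=> hU hV; have h := L2_repr_linear a U V.
have {}hU : {ae leb, forall x, repr (a *: U + V) x = a * u x + repr V x}.
  by apply: (ae_impl2 _ h hU) => x -> ->.
by apply: (ae_impl2 _ hU hV) => x -> ->.
Qed.

Lemma L2_repr_L2 U : (repr U : R -> C) \in @square_integrable R.
Proof. exact: (valP (repr U)). Qed.

Lemma cintegrable_L2 u v : u \in @square_integrable R -> v \in @square_integrable R ->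
  cintegrable (fun x => u x * Num.conj (v x)).
Proof. by move=> hu hv; exact: (cintegrable_mul (L2Fun hu) (L2Fun hv)). Qed.

Lemma L2_dot_of U V u v : L2_of U u -> L2_of V v ->
  u \in @square_integrable R -> v \in @square_integrable R ->
  L2_dot U V = cintegral setT (fun x => u x * Num.conj (v x)).
Proof.
move=> hU hV hu hv; apply: ae_eq_cintegral.
- exact: cintegrable_mul.
- exact: cintegrable_L2.
- by apply: (ae_impl2 _ hU hV) => x -> ->.
Qed.

Lemma hnorm2_L2_of U u : L2_of U u -> u \in @square_integrable R ->
  hnorm2 (@L2_dot R) U = \int[leb]_x cabs2 (u x).
Proof.
move=> hU hu; have -> : hnorm2 (@L2_dot R) U = Re (L2_dot U U) by [].
rewrite (L2_dot_of hU hU)// Re_cintegral.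
by apply: eq_Rintegral => x _; rewrite cReM cReJ cImJ /cabs2; ring.
Qed.

Lemma hnorm2_L2 U : hnorm2 (@L2_dot R) U = \int[leb]_x cabs2 (repr U x).
Proof. by apply: hnorm2_L2_of; [exact: L2_of_repr|exact: L2_repr_L2]. Qed.

Lemma cintegrableZ (a : C) u : cintegrable u -> cintegrable (fun x => a * u x).
Proof.
move=> hu; have h := cintegrableP a hu (cintegrableP (-1) hu hu).
suff -> : (fun x => a * u x) = (fun x => a * u x + (-1 * u x + u x)) by [].
by apply/funext => x; rewrite mulN1r addNr addr0.
Qed.

Lemma cintegralZ (a : C) u : cintegrable u ->
  cintegral setT (fun x => a * u x) = a * cintegral setT u.
Proof.
move=> hu; have h := cintegralP (a - 1) hu hu.
rewrite mulrBl mul1r subrK in h; rewrite -h; congr cintegral.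
by apply/funext => x; rewrite mulrBl mul1r subrK.
Qed.

End L2Classes.

Section EtaFunctions.
Variables (R : realType) (L : R[i]).
Hypothesis hL : Im L != 0.
Local Notation leb := (@lebesgue_measure R).
Local Notation C := R[i].

Definition qroot (n : nat) : R := (n%:R + 2^-1) `^ 4^-1.

Lemma qroot_gt0 n : 0 < qroot n.
Proof. by rewrite powR_gt0// half_shift_gt0. Qed.

Lemma qroot_sqr n : qroot n ^+ 2 = Num.sqrt (n%:R + 2^-1).
Proof.
rewrite /qroot -powR_mulrn ?powR_ge0// -powRrM -powR12_sqrt ?ltW ?half_shift_gt0//.
congr (_ `^ _); lra.
Qed.

(** The origin of the off-diagonal entries: [(n + 1)^2 - 1/4] is the product of [n + 1/2] and
    [n + 3/2], so [d_] is the coefficient of the jump condition times the weights of its two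
    neighbours. *)
Lemma d_qroot n : d_ R n.+1 = Num.sqrt n.+1%:R * (qroot n * qroot n.+1).
Proof.
rewrite /d_ /qroot -powRM ?ltW ?half_shift_gt0//; congr (_ * (_ `^ _)).
by rewrite -[n.+1]addn1 natrD; field.
Qed.

Lemma etaE n x : eta n L x = (qroot n)%:C * cwave (- zeta n L) `|x|.
Proof. by []. Qed.

Lemma wave_abs_continuous (z : C) : complex_continuous (fun x : R => cwave z `|x|).
Proof.
have [cr ci] := cwave_continuous z; split=> x.
  apply: (@continuous_comp _ _ _ (fun x : R => `|x|) (fun x => Re (cwave z x))).
    exact: cvg_norm.
  exact: cr.
apply: (@continuous_comp _ _ _ (fun x : R => `|x|) (fun x => Im (cwave z x))).
  exact: cvg_norm.
exact: ci.
Qed.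

Lemma wave_abs_L2 (z : C) : 0 < Re z -> (fun x : R => cwave (- z) `|x|) \in @square_integrable R.
Proof.
move=> z0; have [cr ci] := wave_abs_continuous (- z).
apply/square_integrableP; split; [exact: continuous_measurable_fun..|].
have s0 : 0 < 2 * Re z by rewrite mulr_gt0.
have := integrable_ekernel 0 s0; apply: eq_integrable => // x _ /=.
by rewrite cabs2_cwave /ekernel sub0r normrN cReN mulrN.
Qed.

Lemma wave_abs_norm (z : C) : 0 < Re z ->
  \int[leb]_x cabs2 (cwave (- z) `|x|) = (Re z)^-1.
Proof.
move=> z0; have s0 : 0 < 2 * Re z by rewrite mulr_gt0.
transitivity (\int[leb]_x ekernel (2 * Re z) 0 x).
  by apply: eq_Rintegral => x _; rewrite cabs2_cwave /ekernel sub0r normrN cReN mulrN.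
by rewrite /Rintegral integral_ekernel//= invfM mulVKf.
Qed.

Lemma square_integrableZ (a : C) (u : R -> C) : u \in @square_integrable R ->
  (fun x => a * u x) \in @square_integrable R.
Proof.
move=> hu; apply/square_integrable_onT.
have hu' := (square_integrable_onT u).2 hu.
have := square_integrable_on_lin (a - 1) hu' hu'; congr square_integrable_on.
by apply/funext => x; rewrite mulrBl mul1r subrK.
Qed.

Lemma eta_L2 n : eta n L \in @square_integrable R.
Proof. by apply: square_integrableZ; apply: wave_abs_L2; exact: Re_zeta_gt0. Qed.

Lemma eta_norm (a : C) n : \int[leb]_x cabs2 (a * eta n L x) =
  Num.sqrt (n%:R + 2^-1) / Re (zeta n L) * cabs2 a.
Proof.
have z0 := Re_zeta_gt0 hL n.
under eq_Rintegral do rewrite etaE 2!cabs2M cabs2_real mulrA.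
have /square_integrableP[_ _ i] := wave_abs_L2 z0.
by rewrite RintegralZl// wave_abs_norm// qroot_sqr; ring.
Qed.

(** [Re zeta_n] is comparable to [(n + 1/2)^(1/2)]. The upper bound makes [T] and its adjoint
    bounded; the lower one recovers square summable coefficients in [eta_coefficients]. *)
Lemma eta_norm_bounds : exists2 k : R, 0 < k & forall n,
  k <= Num.sqrt (n%:R + 2^-1) / Re (zeta n L) <= k^-1.
Proof.
have [k k0 hk] := Re_zeta_lower hL; have [K K0 hK] := zeta_upper L.
pose m := Num.min (Num.sqrt k) (Num.sqrt K)^-1.
have m0 : 0 < m by rewrite lt_min invr_gt0 !sqrtr_gt0 k0.
exists m => // n; have z0 := Re_zeta_gt0 hL n; have n0 := half_shift_gt0 R n.
set r := Re _ in z0 *; set t := n%:R + _ in n0 *.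
have s0 : 0 < Num.sqrt t by rewrite sqrtr_gt0.
have rE : r = Num.sqrt (r ^+ 2) by rewrite sqrtr_sqr gtr0_norm.
have h1 : Num.sqrt k * Num.sqrt t <= r.
  by rewrite rE -sqrtrM ?(ltW k0)// ler_wsqrtr// hk.
have h2 : r <= Num.sqrt K * Num.sqrt t.
  rewrite rE -sqrtrM ?(ltW K0)// ler_wsqrtr// (le_trans _ (hK n))//.
  by rewrite lerDl sqr_ge0.
apply/andP; split.
  rewrite ler_pdivlMr// (le_trans (ler_wpM2l (ltW m0) h2))// mulrA.
  rewrite ler_piMl ?(ltW s0)//.
  by rewrite -ler_pdivlMr ?sqrtr_gt0// mul1r ge_min lexx orbT.
rewrite ler_pdivrMr// mulrC ler_pdivlMr//.
by rewrite (le_trans _ h1)// mulrC ler_wpM2r ?(ltW s0)// ge_min lexx.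
Qed.

(** Both sides have the same square, and their positive real parts exclude opposite roots. *)
Lemma zeta_conj n : zeta n (Num.conj L) = Num.conj (zeta n L).
Proof.
have hL' : Im (Num.conj L) != 0 by rewrite cImJ oppr_eq0.
have e : zeta n (Num.conj L) ^+ 2 = Num.conj (zeta n L) ^+ 2.
  rewrite sqr_zeta -rmorphXn /= sqr_zeta rmorphB rmorphD /= half_real.
  apply: complex_eq; rewrite !(cReD, cImD, cReN, cImN, cReJ, cImJ, Re_natr, Im_natr) /= ?cReJ ?cImJ ?Re_natr ?Im_natr ?oppr0 //.
move/eqP: e; rewrite eqf_sqr => /orP[/eqP //|/eqP e].
have := Re_zeta_gt0 hL' n; have := Re_zeta_gt0 hL n.
by rewrite e cReN cReJ oppr_gt0 => h1 /(lt_trans h1); rewrite ltxx.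
Qed.

Lemma cexp_conj (z : C) : cexp (Num.conj z) = Num.conj (cexp z).
Proof.
rewrite /cexp cReJ cImJ cosN sinN.
by apply: complex_eq; rewrite ?cReJ ?cImJ !(cReM, cImM) /=; ring.
Qed.

Lemma eta_conj n x : eta n (Num.conj L) x = Num.conj (eta n L x).
Proof.
rewrite /eta rmorphM /= -cexp_conj zeta_conj; congr (_ * cexp _); last first.
  by rewrite rmorphM rmorphN /=; congr (_ * _); apply: complex_eq; rewrite ?cReJ ?cImJ/= ?oppr0.
by apply: complex_eq; rewrite ?cReJ ?cImJ/= ?oppr0.
Qed.

End EtaFunctions.

Section Derivative2.
Variable R : realType.
Local Notation leb := (@lebesgue_measure R).
Local Notation C := R[i].
Implicit Types (D : set R) (u v w : R -> C).

Lemma weak_derivative_lin D u v u' v' (a : C) : weak_derivative D u v ->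
  weak_derivative D u' v' ->
  weak_derivative D (fun x => a * u x + u' x) (fun x => a * v x + v' x).
Proof.
move=> /weak_derivativeP[hu hv huv] /weak_derivativeP[hu' hv' huv'].
apply/weak_derivativeP; split; [exact: square_integrable_on_lin..|].
have := complex_weak_derivative_lin a 1 huv huv'.
by apply: complex_weak_derivative_ext => x; rewrite mul1r.
Qed.

Lemma H2_derivative2_lin D u w u' w' (a : C) : H2_derivative2 D u w ->
  H2_derivative2 D u' w' ->
  H2_derivative2 D (fun x => a * u x + u' x) (fun x => a * w x + w' x).
Proof.
move=> [v [uv vw]] [v' [uv' vw']]; exists (fun x => a * v x + v' x).
by split; exact: weak_derivative_lin.
Qed.

Lemma weak_derivative_restrict D u v : measurable D -> weak_derivative setT u v ->
  weak_derivative D u v.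
Proof.
move=> mD /weak_derivativeP[/square_integrable_onT hu /square_integrable_onT hv [hr hi]].
apply/weak_derivativeP; split; [exact: square_integrable_onW..|].
by split; [move: hr|move: hi]; apply: real_weak_derivative_sub; exact: subsetT.
Qed.

Lemma H2_derivative2_restrict D u w : measurable D -> H2_derivative2 setT u w ->
  H2_derivative2 D u w.
Proof. by move=> mD [v [uv vw]]; exists v; split; exact: weak_derivative_restrict. Qed.

Lemma H2_derivative2_eq_on D u w u' w' : {in D, u =1 u'} -> {in D, w =1 w'} ->
  H2_derivative2 D u w -> H2_derivative2 D u' w'.
Proof.
move=> uu' ww' [v [[su sv huv] [_ sw hvw]]]; exists v.
have pe (p q : R -> C) : {in D, p =1 q} -> square_integrable_on D p -> square_integrable_on D q.
  move=> pq; rewrite /square_integrable_on.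
  suff -> : patch (cst 0) D p = patch (cst 0) D q by [].
  by apply/funext => x; rewrite /patch; case: ifPn => // xD; rewrite pq.
have ce (p q : R -> C) : {in D, p =1 q} -> cintegral D p = cintegral D q.
  by move=> pq; apply: complex_eq; rewrite ?Re_cintegral ?Im_cintegral;
    apply: eq_Rintegral => x xD; rewrite pq.
split; split=> //; [exact: pe su| |exact: pe sw|].
  by move=> phi /huv <-; apply: ce => x xD; rewrite uu'.
by move=> phi /hvw ->; congr (- _); apply: ce => x xD; rewrite ww'.
Qed.

End Derivative2.

Section FreeResolvent.
Variables (R : realType) (L : R[i]).
Hypothesis hL : Im L != 0.
Local Notation leb := (@lebesgue_measure R).
Local Notation C := R[i].
Local Notation H := (ell2 (@L2_dot R)).
Local Notation Hdot := (@ell2_dot R _ (@L2_dot R)).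

Lemma resolventE (U : lmodType C) (A : operator U U) F V :
  resolvent A L (F, V) <-> A (V, F + L *: V).
Proof.
split=> [[y [t [Ay [t' e1 e2] e3]]]|h].
  have {}e1 : t' = V := e1; have {}e2 : t = L *: t' := e2.
  have {}e3 : F = y - t := e3.
  by rewrite e3 e2 e1 subrK.
exists (F + L *: V), (L *: V); split=> //=; last by rewrite addrK.
by exists V.
Qed.

Lemma ell2_lin (V : lmodType C) (f : {dot V for @Num.conj C}) (a : C) (X Y : ell2 f) n :
  (a *: X + Y) n = a *: X n + Y n.
Proof. by []. Qed.

Lemma L2_of_shift (F V : L2 R) (u w : R -> C) n : L2_of V u ->
  L2_of (F + L *: V) (fun x => - w x + (2^-1 + n%:R) * u x) <->
  {ae leb, forall x, w x = zeta n L ^+ 2 * u x - repr F x}.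
Proof.
move=> hV; have hF := L2_of_lin L hV (L2_of_repr F); rewrite addrC in hF.
rewrite sqr_zeta; split=> h; apply: (ae_impl2 _ h hF) => x; last by move=> -> ->; ring.
move=> -> e; have : w x = (2^-1 + n%:R) * u x - (L * u x + repr F x).
  by rewrite -e; ring.
by move=> ->; ring.
Qed.

(** Two solutions of the inhomogeneous equation in H^2 of the whole line differ by a solution of the
    homogeneous one, which is zero almost everywhere. *)
Lemma free_resolventE (F V : H) : resolvent (@opA0 R) L (F, V) <->
  forall n, L2_of (V n) (free_sol (zeta n L) (repr (F n))).
Proof.
rewrite resolventE; split=> [h n|h n].
  have z0 := Re_zeta_gt0 hL n; have f2 := L2_repr_L2 (F n).
  have [u [w [hV hw /(L2_of_shift _ _ _ hV) e]]] := h n.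
  have h2 := H2_derivative2_lin (-1) (free_sol_H2 z0 f2) hw.
  apply: L2_of_ae hV _.
  have h0 : {ae leb, forall x, -1 * free_sol (zeta n L) (repr (F n)) x + u x = 0}.
    apply: (full_line_solution z0 h2); apply: (ae_impl2 _ e e) => x -> _; ring.
  apply: (ae_impl2 _ h0 h0) => x /eqP + _.
  by rewrite mulN1r addrC subr_eq0 => /eqP.
have z0 := Re_zeta_gt0 hL n; have f2 := L2_repr_L2 (F n).
exists (free_sol (zeta n L) (repr (F n))).
exists (fun x => zeta n L ^+ 2 * free_sol (zeta n L) (repr (F n)) x - repr (F n) x).
split; [exact: h|exact: free_sol_H2|].
apply/(L2_of_shift _ _ _ (h n)); exact: ae_all.
Qed.

Lemma H_exists (U : nat -> L2 R) (K : R) :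
  (forall N, \sum_(i < N) hnorm2 (@L2_dot R) (U i) <= K) ->
  exists V : H, forall n, V n = U n.
Proof. by move=> h; exists (Ell2 (square_summable_bounded h)). Qed.

Lemma free_resolvent_bounded : bounded_operator Hdot Hdot (resolvent (@opA0 R) L).
Proof.
have [k k0 hk] := Re_zeta_lower hL.
(* From [8 / (s^2 |z|^2)] in [free_sol_norm], where [s^2] and [|z|^2] are both at least
   [k (n + 1/2) >= k / 2]. *)
pose K := 32 / k ^+ 2.
have K0 : 0 <= K by rewrite divr_ge0// sqr_ge0.
have bnd (F : L2 R) n V : L2_of V (free_sol (zeta n L) (repr F)) ->
    hnorm2 (@L2_dot R) V <= K * hnorm2 (@L2_dot R) F.
  have z0 := Re_zeta_gt0 hL n; have f2 := L2_repr_L2 F; move=> hV.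
  rewrite (hnorm2_L2_of hV); last exact: free_sol_L2.
  rewrite hnorm2_L2 (le_trans (free_sol_norm z0 f2))// ler_wpM2r//.
    by apply: Rintegral_ge0 => x _; exact: cabs2_ge0.
  have h1 : k / 2 <= Re (zeta n L) ^+ 2.
    apply: le_trans (hk n); apply: ler_wpM2l; first exact: ltW.
    by rewrite lerDr.
  have h2 : Re (zeta n L) ^+ 2 <= cabs2 (zeta n L) by rewrite lerDl sqr_ge0.
  have k20 : 0 < k / 2 by rewrite divr_gt0.
  have -> : K = 8 / (k / 2 * (k / 2)) by rewrite /K; field; rewrite gt_eqF.
  apply: ler_wpM2l => //; rewrite lef_pV2 ?posrE ?mulr_gt0 ?exprn_gt0 ?(cabs2z_gt0 z0)//.
  by apply: ler_pM => //; [exact: ltW|exact: ltW|exact: le_trans h2].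
apply: (@linear_relation_bounded_operator _ _ _ _ _ _ K).
- move=> F.
  have [U hU] : exists U : nat -> L2 R, forall n, L2_of (U n) (free_sol (zeta n L) (repr (F n))).
    have h n : exists V, L2_of V (free_sol (zeta n L) (repr (F n))).
      by apply: L2_of_exists; apply: free_sol_L2; [exact: Re_zeta_gt0|exact: L2_repr_L2].
    by exists (fun n => projT1 (cid (h n))) => n; case: cid.
  have [|V hV] := @H_exists U (K * hnorm2 Hdot F).
    move=> N; rewrite (le_trans _ (ler_wpM2l K0 (hnorm2_ell2_partial F N)))//.
    by rewrite mulr_sumr; apply: ler_sum => i _; exact: bnd (hU i).
  by exists V; apply/free_resolventE => n; rewrite hV.
(* Linearity is read off the differential equation: representatives depend linearly on classes only
   up to null sets, which makes the formula with [free_sol] awkward here. *)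
- move=> a F V F' V' /resolventE h /resolventE h'; apply/resolventE => n.
  have [u [w [hu hw hF]]] := h n; have [u' [w' [hu' hw' hF']]] := h' n.
  exists (fun x => a * u x + u' x), (fun x => a * w x + w' x); split.
  + exact: L2_of_lin.
  + exact: H2_derivative2_lin.
  + have := L2_of_lin a hF hF'.
    have <- : ((a *: F + F') + L *: (a *: V + V')) n =
        a *: ((F + L *: V) n) + (F' + L *: V') n.
      rewrite -ell2_lin; congr (ell2_val _ n).
      by rewrite !scalerDr !scalerA [a * L]mulrC addrACA.
    move=> H1; apply: L2_of_ae H1 _; apply: ae_all => x; ring.
- move=> F V /free_resolventE h; apply: hnorm2_ell2_le => N.
  rewrite (le_trans _ (ler_wpM2l K0 (hnorm2_ell2_partial F N)))//.
  by rewrite mulr_sumr; apply: ler_sum => i _; exact: bnd (h i).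
Qed.

End FreeResolvent.

Section TOperator.
Variable R : realType.
Local Notation leb := (@lebesgue_measure R).
Local Notation C := R[i].
Local Notation l2 := (ell2 (@complex_dot R)).
Local Notation l2dot := (@ell2_dot R _ (@complex_dot R)).
Local Notation H := (ell2 (@L2_dot R)).
Local Notation Hdot := (@ell2_dot R _ (@L2_dot R)).

Lemma hnorm2_l2_partial (x : l2) N : \sum_(i < N) cabs2 (x i) <= hnorm2 l2dot x.
Proof.
rewrite (le_trans _ (hnorm2_ell2_partial x N))//.
by apply: ler_sum => i _; rewrite hnorm2_complex.
Qed.

Lemma opT_bounded (L : C) : Im L != 0 -> bounded_operator l2dot Hdot (opT L).
Proof.
move=> hL; have [k k0 hk] := eta_norm_bounds hL.
have K0 : 0 <= k^-1 by rewrite invr_ge0 ltW.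
have bnd (a : C) n V : L2_of V (fun x => a * eta n L x) ->
    hnorm2 (@L2_dot R) V <= k^-1 * cabs2 a.
  move=> hV; rewrite (hnorm2_L2_of hV); last by apply: square_integrableZ; exact: eta_L2.
  by rewrite eta_norm// ler_wpM2r ?cabs2_ge0//; have /andP[] := hk n.
apply: (@linear_relation_bounded_operator _ _ _ _ _ _ k^-1).
- move=> X.
  have [U hU] : exists U : nat -> L2 R, forall n, L2_of (U n) (fun x => X n * eta n L x).
    have h n : exists V, L2_of V (fun x => X n * eta n L x).
      by apply: L2_of_exists; apply: square_integrableZ; exact: eta_L2.
    by exists (fun n => projT1 (cid (h n))) => n; case: cid.
  have [|V hV] := @H_exists R U (k^-1 * hnorm2 l2dot X).
    move=> N; rewrite (le_trans _ (ler_wpM2l K0 (hnorm2_l2_partial X N)))//.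
    by rewrite mulr_sumr; apply: ler_sum => i _; exact: bnd (hU i).
  by exists V => n /=; rewrite hV; exact: hU.
- move=> a X V X' V' h h' n.
  apply: L2_of_ae (L2_of_lin a (h n) (h' n)) _; apply: ae_all => x.
  change (a * (X n * eta n L x) + X' n * eta n L x = (a * X n + X' n) * eta n L x).
  by rewrite mulrDl mulrA.
- move=> X V h; apply: hnorm2_ell2_le => N.
  rewrite (le_trans _ (ler_wpM2l K0 (hnorm2_l2_partial X N)))//.
  by rewrite mulr_sumr; apply: ler_sum => i _; exact: bnd (h i).
Qed.

Lemma csum_single (F : nat -> C) n : (forall m, m != n -> F m = 0) -> csum F = F n.
Proof.
move=> F0.
have key (p : nat -> R) : (forall m, m != n -> p m = 0) -> limn (series p) = p n.
  move=> p0; apply: cvg_lim => //; apply: cvg_near_cst; exists n.+1 => // N /= nN.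
  rewrite /series/= (bigD1_seq n) /= ?mem_index_iota ?nN ?iota_uniq//.
  by rewrite big1 ?addr0// => m mn; exact: p0.
apply: complex_eq; rewrite /csum /=; apply: key => m mn; by rewrite F0.
Qed.

Variable L : C.
Hypothesis hL : Im L != 0.

Let hL' : Im (Num.conj L) != 0. Proof. by rewrite cImJ oppr_eq0. Qed.

Lemma cintegrable_eta (V : L2 R) n : cintegrable (fun x => repr V x * eta n L x).
Proof.
have := cintegrable_L2 (L2_repr_L2 V) (eta_L2 hL' n).
suff -> : (fun x => repr V x * Num.conj (eta n (Num.conj L) x)) =
  (fun x => repr V x * eta n L x) by [].
by apply/funext => x; rewrite eta_conj// Num.Theory.conjCK.
Qed.

Lemma L2_dot_eta (V Y : L2 R) n (a : C) :
  L2_of Y (fun x => a * eta n (Num.conj L) x) ->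
  L2_dot Y V = a * Num.conj (cintegral setT (fun x => repr V x * eta n L x)).
Proof.
move=> hY.
rewrite (L2_dot_of hY (L2_of_repr V)) ?L2_repr_L2//; last first.
  by apply: square_integrableZ; exact: eta_L2.
rewrite -cintegral_conj; last exact: cintegrable_eta.
rewrite -cintegralZ.
  congr cintegral; apply/funext => x; rewrite eta_conj// -mulrA; congr (_ * _).
  rewrite (_ : forall p q : C, Num.conj (p * q) = Num.conj p * Num.conj q); first exact: mulrC.
  by move=> p q; rewrite rmorphM.
have [h1 h2] := cintegrable_eta V n; split.
  by apply: eq_integrable h1 => // x _ /=; rewrite cReJ.
have := @rintegrableZ _ (-1) _ h2; apply: eq_integrable => // x _ /=.
by rewrite cImJ mulN1r.
Qed.

Lemma dot_opT (X : l2) (Y V : H) : opT (Num.conj L) (X, Y) ->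
  Hdot Y V = csum (fun n =>
    X n * Num.conj (cintegral setT (fun y => repr (V n) y * eta n L y))).
Proof.
by move=> h; congr csum; apply/funext => n; exact: L2_dot_eta (h n).
Qed.

(** [T] acts entrywise, so testing the adjoint relation on unit sequences determines every entry. No
    conjugate remains because [eta n (conj L)] is the conjugate of [eta n L]. *)
Lemma adjointE (V : H) (x : l2) : op_adjoint l2dot Hdot (opT (Num.conj L)) (V, x) <->
  forall n, x n = cintegral setT (fun y => repr (V n) y * eta n L y).
Proof.
split=> [h n|h X Y hXY].
  have dn : ((fun m => if m == n then 1 else 0) : nat -> C) \in
      square_summable (@complex_dot R).
    by apply: (@square_summable_finite _ _ n.+1) => m nm; rewrite gtn_eqF.
  have [Y hY] := bounded_operator_total (Ell2 dn) (opT_bounded hL').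
  have := etrans (esym (dot_opT V hY)) (h _ _ hY); rewrite /= /ell2_dot.
  rewrite (@csum_single _ n) => [|m /negPf mn]; last by rewrite /= mn mul0r.
  rewrite (@csum_single _ n) => [|m /negPf mn]; last by rewrite /= /complex_dot mn mul0r.
  rewrite /= /complex_dot eqxx !mul1r.
  by move=> /(congr1 Num.conj); rewrite !Num.Theory.conjCK.
apply: etrans (dot_opT V hXY) _; congr csum; apply/funext => n /=.
by rewrite /complex_dot h.
Qed.

(** Each entry is an inner product with a single [eta n (conj L)], so Cauchy-Schwarz bounds it,
    uniformly in [n] by [eta_norm_bounds]. *)
Lemma adjoint_bounded : bounded_operator Hdot l2dot (op_adjoint l2dot Hdot (opT (Num.conj L))).
Proof.
have [k k0 hk] := eta_norm_bounds hL'.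
have K0 : 0 <= k^-1 by rewrite invr_ge0 ltW.
pose c (V : L2 R) n := cintegral setT (fun y => repr V y * eta n L y).
have bnd (V : L2 R) n : cabs2 (c V n) <= k^-1 * hnorm2 (@L2_dot R) V.
  have [Y hY] := L2_of_exists (square_integrableZ 1 (eta_L2 hL' n)).
  have := cauchy_schwarz (@L2_dot R) Y V.
  have e : L2_dot Y V = Num.conj (c V n) by rewrite (L2_dot_eta V hY) mul1r.
  rewrite [X in Re X ^+ 2 + _]e [X in _ + Im X ^+ 2]e -/(cabs2 _) cabs2J => /le_trans; apply.
  rewrite ler_wpM2r ?hnorm2_ge0// (hnorm2_L2_of hY); last first.
    by apply: square_integrableZ; exact: eta_L2.
  rewrite eta_norm// (_ : cabs2 1 = 1) ?mulr1; first by have /andP[] := hk n.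
  by rewrite /cabs2/= expr1n expr0n addr0.
apply: (@linear_relation_bounded_operator _ _ _ _ _ _ k^-1).
- move=> V.
  have cs : ((fun n => c (V n) n) : nat -> C) \in square_summable (@complex_dot R).
    apply: (@square_summable_le _ _ (fun n => hnorm2 (@L2_dot R) (V n)) k^-1) => //.
    - by move=> n; exact: hnorm2_ge0.
    - exact: ell2_cvg.
  by exists (Ell2 cs); apply/adjointE.
- move=> a V x V' x' h h' X Y hXY /=.
  have := h _ _ hXY; have := h' _ _ hXY => /= e1 e2.
  by rewrite !linearDr !linearZr_LR /= e1 e2.
- move=> V x /adjointE h; apply: hnorm2_l2_le => N.
  rewrite (le_trans _ (ler_wpM2l K0 (hnorm2_ell2_partial V N)))//.
  by rewrite mulr_sumr; apply: ler_sum => n _; rewrite h; exact: bnd.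
Qed.

(* The value at the origin of the free solution is a matrix entry of T^*. *)
Lemma adjoint_free_sol (F : L2 R) n :
  cintegral setT (fun y => repr F y * eta n L y) =
  2 * (qroot R n)%:C * zeta n L * free_sol (zeta n L) (repr F) 0.
Proof.
have z0 := Re_zeta_gt0 hL n; have zn0 := zeta_neq0 hL n.
have q0 : (qroot R n)%:C != 0 :> C by rewrite fmorph_eq0 gt_eqF// qroot_gt0.
have e x : repr F x * eta n L x = (qroot R n)%:C * (cwave (- zeta n L) `|x| * repr F x).
  by rewrite etaE; ring.
rewrite (_ : (fun y => _) = (fun y => (qroot R n)%:C * (cwave (- zeta n L) `|y| * repr F y))); last first.
  by apply/funext => y; exact: e.
rewrite cintegralZ.
  rewrite free_sol0 ?L2_repr_L2//; set I := cintegral _ _; field.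
  by rewrite ?pnatr_eq0 ?zn0.
have := cintegrableZ (qroot R n)%:C^-1 (cintegrable_eta F n).
suff -> : (fun x => (qroot R n)%:C^-1 * (repr F x * eta n L x)) =
  (fun x => cwave (- zeta n L) `|x| * repr F x) by [].
by apply/funext => x; rewrite e mulKf.
Qed.

End TOperator.

(** * The half-line problems and the jump at the origin *)

Section OneSided.
Variable R : realType.
Local Notation leb := (@lebesgue_measure R).
Local Notation C := R[i].
Implicit Types (x y : R).

Lemma derivative_0p_eq (u v : R -> C) : complex_continuous v ->
  (forall x, 0 < x -> derive1 (fun y => Re (u y)) x = Re (v x) /\
                      derive1 (fun y => Im (u y)) x = Im (v x)) ->
  derivative_0p u = v 0.
Proof.
move=> [vr vi] uv; apply: complex_eq; apply: cvg_lim => //.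
  apply: cvg_trans (cvg_at_right_filter (vr 0)); apply: near_eq_cvg; near=> x.
  by rewrite (uv x _).1.
apply: cvg_trans (cvg_at_right_filter (vi 0)); apply: near_eq_cvg; near=> x.
by rewrite (uv x _).2.
Unshelve. all: by end_near. Qed.

Lemma derivative_0m_eq (u v : R -> C) : complex_continuous v ->
  (forall x, x < 0 -> derive1 (fun y => Re (u y)) x = Re (v x) /\
                      derive1 (fun y => Im (u y)) x = Im (v x)) ->
  derivative_0m u = v 0.
Proof.
move=> [vr vi] uv; apply: complex_eq; apply: cvg_lim => //.
  apply: cvg_trans (cvg_at_left_filter (vr 0)); apply: near_eq_cvg; near=> x.
  by rewrite (uv x _).1.
apply: cvg_trans (cvg_at_left_filter (vi 0)); apply: near_eq_cvg; near=> x.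
by rewrite (uv x _).2.
Unshelve. all: by end_near. Qed.

Lemma continuous_extend0p (u v : R -> C) : complex_continuous u -> complex_continuous v ->
  (forall x, 0 < x -> u x = v x) -> u 0 = v 0.
Proof.
have key (p q : R -> R) : continuous p -> continuous q ->
    (forall x, 0 < x -> p x = q x) -> p 0 = q 0.
  move=> cp cq pq; have hp := cvg_at_right_filter (cp 0).
  have hq : p x @[x --> 0^'+] --> q 0.
    apply: cvg_trans (cvg_at_right_filter (cq 0)); apply: near_eq_cvg; near=> x.
    by rewrite pq.
  exact: cvg_unique hp hq.
move=> [ur ui] [vr vi] uv; apply: complex_eq.
  by apply: (key _ _ ur vr) => x x0; rewrite uv.
by apply: (key _ _ ui vi) => x x0; rewrite uv.
Unshelve. all: by end_near. Qed.

Lemma continuous_extend0m (u v : R -> C) : complex_continuous u -> complex_continuous v ->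
  (forall x, x < 0 -> u x = v x) -> u 0 = v 0.
Proof.
have cN (p : R -> R) : continuous p -> continuous (fun x => p (- x)).
  move=> cp x; apply: (@continuous_comp _ _ _ (fun x : R => - x) p); last exact: cp.
  exact: cvgN.
move=> [ur ui] [vr vi] uv.
have h1 : complex_continuous (fun x => u (- x)).
  by split; [exact: (cN (fun x => Re (u x)))|exact: (cN (fun x => Im (u x)))].
have h2 : complex_continuous (fun x => v (- x)).
  by split; [exact: (cN (fun x => Re (v x)))|exact: (cN (fun x => Im (v x)))].
rewrite -oppr0; apply: (continuous_extend0p h1 h2) => x x0.
by rewrite uv// oppr_lt0.
Qed.

Lemma cwave_weak_derivative (D : set R) (a : C) :
  complex_weak_derivative D (cwave a) (fun x => a * cwave a x).
Proof.
have h : complex_weak_derivative D (cst 1) (cst 0).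
  by split; exact: real_weak_derivative_cst.
have := complex_weak_derivative_cwave_mul a h.
by apply: complex_weak_derivative_ext => x /=; rewrite ?mulr0 ?add0r mulr1.
Qed.

Variables (z : C) (f : R -> C).
Hypotheses (z0 : 0 < Re z) (f2 : f \in @square_integrable R).

Let wave x : C := cwave (- z) `|x|.

(** On [D] the wave is a smooth exponential: square integrability is that of the wave, the
    derivatives are those of [cwave a], which may grow outside [D]. The half-lines correspond to
    [a = - z] and [a = z]. *)
Lemma wave_H2 (D : set R) (a : C) : measurable D -> a ^+ 2 = z ^+ 2 ->
  (forall x, D x -> wave x = cwave a x) ->
  H2_derivative2 D wave (fun x => z ^+ 2 * wave x).
Proof.
move=> mD az wa.
have s2 b : square_integrable_on D (fun x => b * cwave a x).
  have := square_integrable_onW mD (square_integrableZ b (wave_abs_L2 z0)).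
  rewrite /square_integrable_on; suff -> : patch (cst 0) D (fun x => b * cwave (- z) `|x|) =
    patch (cst 0) D (fun x => b * cwave a x) by [].
  apply/funext => x; rewrite /patch; case: ifPn => // /set_mem Dx.
  by rewrite -[cwave (- z) _]/(wave x) wa.
apply: (@H2_derivative2_eq_on _ _ (cwave a) (fun x => a ^+ 2 * cwave a x)).
- by move=> x /set_mem /wa ->.
- by move=> x /set_mem /wa ->; rewrite az.
have wd := @cwave_weak_derivative D a.
exists (fun x => a * cwave a x); split; apply/weak_derivativeP; split=> //.
- have := s2 1; suff -> : (fun x => 1 * cwave a x) = cwave a by [].
  by apply/funext => x; rewrite mul1r.
- have := complex_weak_derivative_lin a 0 wd wd.
  by apply: complex_weak_derivative_ext => x; rewrite mul0r addr0// mulrA -expr2.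
Qed.

Lemma wavep x : 0 <= x -> wave x = cwave (- z) x.
Proof. by move=> x0; rewrite /wave ger0_norm. Qed.

Lemma wavem x : x <= 0 -> wave x = cwave z x.
Proof.
by move=> x0; rewrite /wave ler0_norm// /cwave; congr cexp; apply: complex_eq;
  rewrite !(cReM, cImM) !(cReN, cImN)/=; ring.
Qed.

Lemma wave_H2p : H2_derivative2 (@Rpos R) wave (fun x => z ^+ 2 * wave x).
Proof.
apply: (@wave_H2 _ (- z)); [exact: measurable_itv|by rewrite sqrrN|].
by move=> x; rewrite /Rpos/= in_itv/= andbT => /ltW; exact: wavep.
Qed.

Lemma wave_H2m : H2_derivative2 (@Rneg R) wave (fun x => z ^+ 2 * wave x).
Proof.
apply: (@wave_H2 _ z); [exact: measurable_itv|by []|].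
by move=> x; rewrite /Rneg/= in_itv/= => /ltW; exact: wavem.
Qed.

Variable c : C.

Definition kink_sol x : C := free_sol z f x + c * cwave (- z) `|x|.

Lemma kink_sol0 : kink_sol 0 = free_sol z f 0 + c.
Proof. by rewrite /kink_sol normr0 cwave0 mulr1. Qed.

Lemma kink_sol_continuous : complex_continuous kink_sol.
Proof.
apply: complex_continuousD; first exact: free_sol_continuous.
by apply: complex_continuousM; [exact: complex_continuous_cst|exact: wave_abs_continuous].
Qed.

Lemma kink_sol_H2 (D : set R) : measurable D ->
  H2_derivative2 D wave (fun x => z ^+ 2 * wave x) ->
  H2_derivative2 D kink_sol (fun x => z ^+ 2 * kink_sol x - f x).
Proof.
move=> mD hw; have := H2_derivative2_lin c hw (H2_derivative2_restrict mD (free_sol_H2 z0 f2)).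
by apply: H2_derivative2_eq_on => x _; rewrite /kink_sol /wave; ring.
Qed.

Lemma kink_sol_H2p : H2_derivative2 (@Rpos R) kink_sol (fun x => z ^+ 2 * kink_sol x - f x).
Proof. by apply: kink_sol_H2; [exact: measurable_itv|exact: wave_H2p]. Qed.

Lemma kink_sol_H2m : H2_derivative2 (@Rneg R) kink_sol (fun x => z ^+ 2 * kink_sol x - f x).
Proof. by apply: kink_sol_H2; [exact: measurable_itv|exact: wave_H2m]. Qed.

Lemma kink_sol_calW : calW kink_sol.
Proof.
have [c1 c2] := kink_sol_continuous.
by split=> //; eexists; [exact: kink_sol_H2p|exact: kink_sol_H2m].
Qed.

Lemma kink_sol_derive (a : C) x : (\forall y \near x, wave y = cwave a y) ->
  derive1 (fun y => Re (kink_sol y)) x = Re (free_der z f x + c * (a * cwave a x)) /\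
  derive1 (fun y => Im (kink_sol y)) x = Im (free_der z f x + c * (a * cwave a x)).
Proof.
move=> wa; have [dr er di ei] := free_sol_classical z0 f2 x.
have hr : is_derive x 1 (fun y => Re (free_sol z f y)) (Re (free_der z f x)).
  exact: DeriveDef dr (etrans (esym (derive1E _ _)) er).
have hi : is_derive x 1 (fun y => Im (free_sol z f y)) (Im (free_der z f x)).
  exact: DeriveDef di (etrans (esym (derive1E _ _)) ei).
have wr := is_derive_Re_cwave a x; have wi := is_derive_Im_cwave a x.
split; rewrite derive1E; apply: derive_val.
  have h := is_deriveD hr (is_deriveB (is_deriveZ (Re c) wr) (is_deriveZ (Im c) wi)).
  rewrite cReD (cReM c); apply: near_eq_is_derive h.
  by apply: filterS wa => y e; rewrite /kink_sol -/(wave y) e cReD (cReM c).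
have h := is_deriveD hi (is_deriveD (is_deriveZ (Re c) wi) (is_deriveZ (Im c) wr)).
rewrite cImD (cImM c); apply: near_eq_is_derive h.
by apply: filterS wa => y e; rewrite /kink_sol -/(wave y) e cImD (cImM c).
Qed.

(** [free_der] is continuous, so only the wave contributes: its slope passes from [z c] to
    [- z c]. *)
Lemma kink_sol_jump : derivative_0p kink_sol - derivative_0m kink_sol = - 2 * z * c.
Proof.
have cc a : complex_continuous (fun x => free_der z f x + c * (a * cwave a x)).
  apply: complex_continuousD; first exact: free_der_continuous.
  do 2![apply: complex_continuousM; first exact: complex_continuous_cst].
  exact: cwave_continuous.
have -> := derivative_0p_eq (cc (- z)); last first.
  move=> x x0; apply: kink_sol_derive; near=> y; apply: wavep; apply: ltW; near: y.
  exact: lt_nbhsr.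
have -> := derivative_0m_eq (cc z); last first.
  move=> x x0; apply: kink_sol_derive; near=> y; apply: wavem; apply: ltW; near: y.
  exact: lt_nbhsl.
by rewrite !cwave0; ring.
Unshelve. all: by end_near. Qed.

End OneSided.

Section Uniqueness.
Variable R : realType.
Local Notation leb := (@lebesgue_measure R).
Local Notation C := R[i].
Variables (z : C) (f : R -> C).
Hypotheses (z0 : 0 < Re z) (f2 : f \in @square_integrable R).

Lemma ae_complex_eq_open (D : set R) (u v : R -> C) : open D -> complex_continuous u ->
  complex_continuous v -> {ae leb, forall x, D x -> u x = v x} ->
  forall x, D x -> u x = v x.
Proof.
move=> oD [ur ui] [vr vi] uv x Dx; apply: complex_eq.
  apply: (ae_eq_open (p := fun x => Re (u x)) (q := fun x => Re (v x)) oD) Dx => // [y _|y _|].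
  - exact: ur.
  - exact: vr.
  - by apply: (ae_impl2 _ uv uv) => y + _ Dy => ->.
apply: (ae_eq_open (p := fun x => Im (u x)) (q := fun x => Im (v x)) oD) Dx => // [y _|y _|].
- exact: ui.
- exact: vi.
- by apply: (ae_impl2 _ uv uv) => y + _ Dy => ->.
Qed.

(** The difference from the free solution is a decaying exponential on each half-line, and its
    continuity at 0 makes the two coefficients equal. Equality holds at every point, so boundary
    values and one-sided derivatives can be transferred. *)
Lemma kink_sol_unique (u w : R -> C) : calW u ->
  H2_derivative2 (@Rpos R) u w -> H2_derivative2 (@Rneg R) u w ->
  {ae leb, forall x, w x = z ^+ 2 * u x - f x} ->
  u = kink_sol z f (u 0 - free_sol z f 0).
Proof.
move=> [ur ui _ _] wp wm wE; set h := fun x => -1 * free_sol z f x + u x.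
have ch : complex_continuous h.
  apply: complex_continuousD => //; apply: complex_continuousM.
    exact: complex_continuous_cst.
  exact: free_sol_continuous.
have hp := H2_derivative2_lin (-1) (H2_derivative2_restrict (measurable_itv _) (free_sol_H2 z0 f2)) wp.
have hm := H2_derivative2_lin (-1) (H2_derivative2_restrict (measurable_itv _) (free_sol_H2 z0 f2)) wm.
have hE (D : set R) : {ae leb, forall x, D x ->
    -1 * (z ^+ 2 * free_sol z f x - f x) + w x = z ^+ 2 * h x}.
  by apply: (ae_impl2 _ wE wE) => x + _ _ => ->; rewrite /h; ring.
have cw a k : complex_continuous (fun x : R => k * cwave a x).
  apply: complex_continuousM; first exact: complex_continuous_cst.
  exact: cwave_continuous.
have [k hk] := decaying_solution (@openRpos R) (@itvRpos R) (@subset_refl _ _) z0 hp (hE _).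
have [l hl] := decaying_solution_neg (@openRneg R) (@itvRneg R) (@subset_refl _ _) z0 hm (hE _).
have {}hk x : 0 < x -> h x = k * cwave (- z) x.
  move=> x0; apply: (ae_complex_eq_open (@openRpos R) ch (cw _ _) hk).
  by rewrite /Rpos/= in_itv/= x0.
have {}hl x : x < 0 -> h x = l * cwave z x.
  move=> x0; apply: (ae_complex_eq_open (@openRneg R) ch (cw _ _) hl).
  by rewrite /Rneg/= in_itv/= x0.
have k0 := continuous_extend0p ch (cw _ _) hk.
have l0 := continuous_extend0m ch (cw _ _) hl.
rewrite cwave0 mulr1 in k0; rewrite cwave0 mulr1 in l0.
have uE x : u x = free_sol z f x + h x by rewrite /h; ring.
have h0 : h 0 = u 0 - free_sol z f 0 by rewrite /h; ring.
apply/funext => x; rewrite uE /kink_sol -h0; congr (_ + _).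
have [x0|x0|->] := ltgtP x 0.
- by rewrite hl// l0 -(wavem z (ltW x0)).
- by rewrite hk// k0 -(wavep z (ltW x0)).
- by rewrite normr0 cwave0 mulr1.
Qed.

End Uniqueness.

(** * The resolvent formula *)

Section ResolventDifference.
Variables (R : realType) (L : R[i]) (alpha : R).
Hypotheses (hL : Im L != 0) (alpha0 : 0 < alpha).
Local Notation leb := (@lebesgue_measure R).
Local Notation C := R[i].
Local Notation l2 := (ell2 (@complex_dot R)).
Local Notation l2dot := (@ell2_dot R _ (@complex_dot R)).
Local Notation H := (ell2 (@L2_dot R)).
Local Notation Hdot := (@ell2_dot R _ (@L2_dot R)).

Let mu : R := Num.sqrt 2 / alpha.
Let mu0 : 0 < mu. Proof. by rewrite divr_gt0// sqrtr_gt0. Qed.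
Let q n : C := (qroot R n)%:C.
Let b n : C := (2 * mu)%:C * y_ n L.
Let g (F : H) n : C := cintegral setT (fun y => repr (F n) y * eta n L y).

Let q_neq0 n : q n != 0. Proof. by rewrite fmorph_eq0 gt_eqF// qroot_gt0. Qed.
Let mu_neq0 : mu%:C != 0 :> C. Proof. by rewrite fmorph_eq0 gt_eqF. Qed.

Let yE n : y_ n L = q n ^+ 2 * zeta n L.
Proof. by rewrite /y_ -qroot_sqr /q rmorphXn. Qed.

Definition krein_operator : operator H H :=
  op_comp (opT L)
    (op_comp (op_sub (op_scale mu%:C (op_inv (opJ L mu)))
                     (op_inv (op_scale 2 (opY L))))
             (op_adjoint l2dot Hdot (opT (Num.conj L)))).

Lemma krein_operator_bounded : bounded_operator Hdot Hdot krein_operator.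
Proof.
apply: bounded_operator_comp; first exact: opT_bounded.
apply: bounded_operator_comp; last exact: adjoint_bounded.
apply: bounded_operator_sub; last exact: opY_inverse_bounded.
by apply: bounded_operator_scale; exact: opJ_inverse_bounded.
Qed.

Lemma krein_operatorE (F Z : H) : krein_operator (F, Z) <-> exists G X : l2,
  [/\ forall n, G n = g F n,
      forall n, G n = jacobi b X n &
      forall n, L2_of (Z n) (fun x => (mu%:C * X n - G n / (2 * y_ n L)) * eta n L x)].
Proof.
split.
  move=> [W [G /adjointE-/(_ hL) FG [X1 [Y [/= [X JX X1E] /(opY_inverseE hL) YG WE]]]] TW].
  exists G, X; split=> [n||n]; [exact: FG|exact: ((opJE mu hL X G).1 JX)|].
  have {TW} := TW n; rewrite /= [W]WE [X1]X1E.
  have -> : (mu%:C *: X - Y) n = mu%:C * X n - Y n by [].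
  by rewrite YG.
move=> [G [X [FG GX ZX]]].
have [Y hY] := bounded_operator_total G (opY_inverse_bounded hL).
exists (mu%:C *: X - Y).
  exists G; first exact/(adjointE hL).
  exists (mu%:C *: X), Y; split=> //.
  by exists X => //; exact: ((opJE mu hL X G).2 GX).
move=> n; have -> : (mu%:C *: X - Y, Z).1 n = mu%:C * X n - Y n by [].
by have -> : Y n = G n / (2 * y_ n L) by exact: ((opY_inverseE hL G Y).1 hY n).
Qed.

(* Multiplied by [q n], the jump condition at the origin is row [n] of the Jacobi
   equation. *)
Lemma jump_jacobi (G X : nat -> C) n :
  mu%:C * (- 2 * zeta n L * (q n * (mu%:C * X n - G n / (2 * y_ n L)))) =
    (Num.sqrt n.+1%:R)%:C * (q n.+1 * mu%:C * X n.+1) +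
    (Num.sqrt n%:R)%:C * (q n.-1 * mu%:C * X n.-1) <->
  G n = jacobi b X n.
Proof.
set lhs := (X in X = _ <-> _); set rhs := (X in _ = X <-> _).
have z0 := zeta_neq0 hL n.
(* For [n = 0] both sides vanish, whatever value [q n.-1] takes. *)
have dn : (d_ R n)%:C = (Num.sqrt n%:R)%:C * (q n.-1 * q n) :> C.
  case: n {lhs rhs z0} => [|n]; first by rewrite /= sqrtr0 mul0r.
  by rewrite d_qroot !rmorphM.
have dn1 : (d_ R n.+1)%:C = (Num.sqrt n.+1%:R)%:C * (q n * q n.+1) :> C.
  by rewrite d_qroot !rmorphM.
have e : q n * (lhs - rhs) = mu%:C * (G n - jacobi b X n).
  have b2 : (2 * mu)%:C = 2 * mu%:C :> C by rewrite rmorphM rmorph_nat.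
  rewrite /jacobi dn dn1 /b /lhs /rhs yE b2.
  by field; rewrite z0 q_neq0.
split=> h.
  apply/eqP; rewrite -subr_eq0; apply/eqP; apply: (mulfI mu_neq0).
  by rewrite mulr0 -e h subrr mulr0.
apply/eqP; rewrite -subr_eq0; apply/eqP; apply: (mulfI (q_neq0 n)).
by rewrite mulr0 e h subrr mulr0.
Qed.

(** The role of the term with [(2 Y)^(-1)]: it cancels the value at 0 of the free solution, so the
    boundary value is a multiple of [X n] alone. *)
Lemma kink_sol0_jacobi (F : H) (X : nat -> C) n :
  kink_sol (zeta n L) (repr (F n)) (q n * (mu%:C * X n - g F n / (2 * y_ n L))) 0 =
  q n * mu%:C * X n.
Proof.
rewrite kink_sol0 /g (adjoint_free_sol hL) -/(q n) yE.
by field; rewrite (zeta_neq0 hL) q_neq0.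
Qed.

Lemma kink_L2_of (F : H) (U V : L2 R) (c : C) n :
  L2_of U (free_sol (zeta n L) (repr (F n))) -> L2_of V (fun x => c * eta n L x) ->
  L2_of (U + V) (kink_sol (zeta n L) (repr (F n)) (q n * c)).
Proof.
move=> hU hV; rewrite -[U]scale1r; apply: L2_of_ae (L2_of_lin 1 hU hV) _.
by apply: ae_all => x; rewrite /kink_sol etaE -/(q n); ring.
Qed.

(** [T] is bounded below, so membership in the large space forces summability of the coefficients;
    these come from boundary values, about which nothing is known a priori. *)
Lemma eta_coefficients (V : H) (c : nat -> C) :
  (forall n, L2_of (V n) (fun x => c n * eta n L x)) ->
  c \in square_summable (@complex_dot R).
Proof.
move=> hV; have [k k0 hk] := eta_norm_bounds hL.
apply: (@square_summable_le _ _ (fun n => hnorm2 (@L2_dot R) (V n)) k^-1).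
- by move=> n; exact: hnorm2_ge0.
- exact: ell2_cvg.
- move=> n; rewrite ler_pdivlMl// (hnorm2_L2_of (hV n)); last first.
    by apply: square_integrableZ; exact: eta_L2.
  by rewrite eta_norm// ler_wpM2r ?cabs2_ge0//; have /andP[] := hk n.
Qed.

(** The decomposition is stated between relations, because the resolvent of [opA] is not yet known
    to be total or single-valued. *)
Lemma resolvent_opAE (F U : H) : resolvent (opA alpha) L (F, U) <->
  exists U0 Z, [/\ resolvent (@opA0 R) L (F, U0), krein_operator (F, Z) & U = U0 + Z].
Proof.
rewrite resolventE; split.
  move=> [u [w h]].
  have uE n : u n = kink_sol (zeta n L) (repr (F n)) (u n 0 - free_sol (zeta n L) (repr (F n)) 0).
    have [[hu uW] hp hm _ hw] := h n.
    apply: (kink_sol_unique (Re_zeta_gt0 hL n) (L2_repr_L2 (F n)) uW hp hm).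
    apply: (L2_of_shift L (F n) (w n) n hu).1; apply: L2_of_ae hw _.
    by apply: ae_all => x; ring.
  have [U0 hU0] := bounded_operator_total F (free_resolvent_bounded hL).
  have /(free_resolventE hL) U0E := hU0.
  (* The division removes the weight that [eta n L] carries in addition to the wave. *)
  pose c n := (u n 0 - free_sol (zeta n L) (repr (F n)) 0) / q n.
  have hZ n : L2_of ((U - U0) n) (fun x => c n * eta n L x).
    have [[hu _] _ _ _ _] := h n; have {}hu : L2_of (U n) (u n) := hu.
    have -> : (U - U0) n = (-1) *: U0 n + U n by rewrite scaleN1r addrC.
    apply: L2_of_ae (L2_of_lin (-1) (U0E n) hu) _; apply: ae_all => x.
    by rewrite {1}uE /kink_sol etaE -/(q n) /c mulrA divfK//; ring.
  have cs := eta_coefficients hZ.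
  have [G hG] := bounded_operator_total F (adjoint_bounded hL).
  have /(adjointE hL) GE := hG.
  have [Y hY] := bounded_operator_total G (opY_inverse_bounded hL).
  have /(opY_inverseE hL) YE := hY.
  (* Solved from [c = mu X - Y], with [Y] the image of [G] under the inverse of [2 Y(Lambda)]. *)
  pose X : l2 := mu%:C^-1 *: (Ell2 cs + Y).
  have XE n : mu%:C * X n - G n / (2 * y_ n L) = c n.
    have -> : X n = mu%:C^-1 * (c n + Y n) by [].
    by rewrite mulVKf// YE addrK.
  have u0 n : u n 0 = q n * mu%:C * X n.
    rewrite -(kink_sol0_jacobi F) -/(g F n) -[g F n]GE XE uE; congr (kink_sol _ _ _ _).
    by rewrite /c mulrC divfK.
  exists U0, (U - U0); split=> //; last by rewrite addrC subrK.
  apply/krein_operatorE; exists G, X; split=> [n|n|n]; [exact: GE| |by rewrite XE].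
  apply/jump_jacobi; rewrite -!u0 XE; have [_ _ _ <- _] := h n.
  by rewrite uE kink_sol_jump ?Re_zeta_gt0 ?L2_repr_L2// /c [q n * _]mulrC divfK.
move=> [U0 [Z [/(free_resolventE hL) U0E /krein_operatorE[G [X [GE GX ZE]]] ->]]].
pose c n := mu%:C * X n - G n / (2 * y_ n L).
pose u n := kink_sol (zeta n L) (repr (F n)) (q n * c n).
have u0 n : u n 0 = q n * mu%:C * X n.
  by rewrite -(kink_sol0_jacobi F) /u /c GE.
exists u, (fun n x => zeta n L ^+ 2 * u n x - repr (F n) x) => n.
have z0 := Re_zeta_gt0 hL n; have f2 := L2_repr_L2 (F n).
have hu : L2_of ((U0 + Z) n) (u n) by apply: kink_L2_of; [exact: U0E|exact: ZE].
split.
- by split=> //; exact: kink_sol_calW.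
- exact: kink_sol_H2p.
- exact: kink_sol_H2m.
- by rewrite !u0 kink_sol_jump//; apply/jump_jacobi.
- have /L2_of_ae : L2_of (F n + L *: (U0 + Z) n)
      (fun x => - (zeta n L ^+ 2 * u n x - repr (F n) x) + (2^-1 + n%:R) * u n x).
    by apply: (L2_of_shift L (F n) _ n hu).2; exact: ae_all.
  by apply; apply: ae_all => x; ring.
Qed.

(** The boundedness of the resolvent of [opA] is a consequence of the decomposition, both parts of
    which are bounded; the subtraction is legitimate because the free resolvent is total and
    single-valued. *)
Lemma resolvent_difference :
  bounded_operator Hdot Hdot (resolvent (opA alpha) L) /\
  op_sub (resolvent (opA alpha) L) (resolvent (@opA0 R) L) = krein_operator.
Proof.
have R0 := free_resolvent_bounded hL; have K := krein_operator_bounded.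
(* Sums are expressed through [op_sub] and the scalar [-1], since only differences of graphs are at
   hand. *)
have E : resolvent (opA alpha) L =
    op_sub (resolvent (@opA0 R) L) (op_scale (-1) krein_operator).
  apply/seteqP; split=> -[F U].
    move=> /resolvent_opAE[U0 [Z [h1 h2 h3]]]; exists U0, (-1 *: Z); split=> //.
      by exists Z.
    by rewrite /= h3 scaleN1r opprK.
  move=> [U0 [Z1 [h1 [Z h2 h3] h4]]]; apply/resolvent_opAE; exists U0, Z.
  by split=> //; have {}h4 : U = _ := h4; rewrite h4 [Z1]h3 scaleN1r opprK.
split; first by rewrite E; apply: bounded_operator_sub => //; exact: bounded_operator_scale.
apply/seteqP; split=> -[F V].
  move=> [U [U0' [/resolvent_opAE[U0 [Z [h1 h2 h3]]] h4 h5]]].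
  have {}h5 : V = U - U0' := h5.
  by rewrite h5 h3 (bounded_operator_functional R0 h4 h1) addrC addKr.
move=> hK; have [U0 hU0] := bounded_operator_total F R0.
exists (U0 + V), U0; split=> //; last by rewrite /= addrC addKr.
by apply/resolvent_opAE; exists U0, V.
Qed.

End ResolventDifference.

Lemma Im_neq0_of_not_real (R : realType) (z : R[i]) : z \isn't Num.real -> Im z != 0.
Proof.
apply: contraNneq => z0; have -> : z = (Re z)%:C by exact: complex_eq.
by rewrite realE -(rmorph0 (real_complex R)) !lecR le_total.
Qed.

(** An equality of graphs could hold between small or multivalued relations. The boundedness clauses
    guarantee that the inverses in the formula are everywhere defined bounded maps. *)
Theorem theorem6p1 (R : realType) (alpha : R) (Lambda : R[i])
    (halpha : 0 < alpha) (hLambda : Lambda \isn't Num.real) :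
  let mu : R := Num.sqrt 2 / alpha in
  let l2dot := @ell2_dot R _ (@complex_dot R) in
  let Hdot := @ell2_dot R _ (@L2_dot R) in
  [/\ bounded_operator Hdot Hdot (resolvent (opA alpha) Lambda),
      bounded_operator Hdot Hdot (resolvent (@opA0 R) Lambda),
      bounded_operator l2dot l2dot (op_inv (opJ Lambda mu)) &
      op_sub (resolvent (opA alpha) Lambda) (resolvent (@opA0 R) Lambda) =
      op_comp (opT Lambda)
        (op_comp
          (op_sub (op_scale mu%:C (op_inv (opJ Lambda mu)))
                  (op_inv (op_scale 2 (opY Lambda))))
          (op_adjoint l2dot Hdot (opT (Num.conj Lambda))))].
Proof.
move=> mu l2dot Hdot; have hL := Im_neq0_of_not_real hLambda.
have mu0 : 0 < mu by rewrite divr_gt0// sqrtr_gt0.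
have [bounded diff] := resolvent_difference hL halpha.
split=> //; [exact: free_resolvent_bounded|exact: opJ_inverse_bounded].
Qed.
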